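(* Let $M>0$ and let $\Phi\in C^1([0,\infty[)\cap C^2(]0,\infty[)$ satisfy $\Phi(0)=0=\Phi'(0)$ and: ($\Phi1$) $\Phi$ is strictly convex; ($\Phi2$) $\Phi(\rho)\ge C\rho^{1+1/n}$ for all sufficiently large $\rho\ge 0$, for some constants $C>0$ and $0<n<3$; ($\Phi3$) $\Phi(\rho)\le C\rho^{1+1/n'}$ for all sufficiently small $\rho\ge 0$, for some constants $C>0$ and $0<n'<3$. Suppose that $\rho_0\in\mathcal F_M$ is a minimizer of the functional $\mathcal H_r$ over $\mathcal F_M$, and let $V_0:=V_{\rho_0}$ be its induced potential. Then there exists a Lagrange multiplier $E_0\le 0$ such that \[ \rho_0=\begin{cases}(\Phi')^{-1}(E_0-V_0), & V_0<E_0,\\ 0, & V_0\ge E_0.\end{cases} \] The functions $\rho_0$ and $V_0$ are spherically symmetric with respect to some point of $\mathbb R^3$; as functions of the radial variable, $\rho_0$ is decreasing and $V_0$ is increasing; $\rho_0\in C(\mathbb R^3)$ with finite mass $M$, $V_0\in C^2(\mathbb R^3)$ with $\lim_{|x|\to\infty}V_0(x)=0$; and $(\rho_0,u_0=0)$ is a time-independent solution of the Euler–Poisson system \[ \partial_t\rho+\nabla\cdot(\rho u)=0,\quad \rho\partial_t u+\rho(u\cdot\nabla)u=-\nabla p-\rho\nabla V,\quad \Delta V=4\pi\rho,\ \lim_{|x|\to\infty}V(t,x)=0, \] with equation of state $p=P(\rho)$, $P(\rho)=\int_0^\rho\sigma\,\Phi''(\sigma)\,d\sigma$. If moreover $\Phi'(\rho)\le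 C\rho^{1/n'}$ for all sufficiently small $\rho\ge0$, then $E_0<0$ and $\rho_0$ has compact support.
   Context: For a function $\rho$ on $\mathbb R^3$, the induced potential is $V_\rho(x):=-\int_{\mathbb R^3}\frac{\rho(y)}{|x-y|}\,dy$ and the potential energy is $E_{\rm pot}(\rho):=-\frac12\iint\frac{\rho(x)\rho(y)}{|x-y|}\,dy\,dx$. The reduced energy functional is $\mathcal H_r(\rho):=\int_{\mathbb R^3}\Phi(\rho(x))\,dx+E_{\rm pot}(\rho)$, and the constraint set is $\mathcal F_M:=\{\rho\in L^1(\mathbb R^3)\mid \rho\ge0,\ \int\Phi(\rho)\,dx<\infty,\ \int\rho\,dx=M\}$. A minimizer means $\rho_0\in\mathcal F_M$ with $\mathcal H_r(\rho_0)=\inf_{\mathcal F_M}\mathcal H_r$; $\rho_0$ is understood as a pointwise defined representative. Under the assumptions on $\Phi$, $\Phi'$ is invertible on $[0,\infty[$. *)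

(* Defs.v *)
From HB Require Import structures.
From mathcomp Require Import all_boot all_order all_algebra.
From mathcomp Require Import all_classical all_reals all_analysis.
Set Implicit Arguments. Unset Strict Implicit. Unset Printing Implicit Defensive.
Import Order.TTheory GRing.Theory Num.Theory.
Import numFieldNormedType.Exports.
Local Open Scope classical_set_scope.
Local Open Scope ring_scope.

Definition pt (R : realType) := ((R * R) * R)%type.

Section Defs.
Variable R : realType.

Definition leb3 := ((@lebesgue_measure R \x @lebesgue_measure R) \x @lebesgue_measure R)%E.

Definition coord (i : 'I_3) (x : pt R) : R :=
  if val i == 0%N then x.1.1 else if val i == 1%N then x.1.2 else x.2.
Definition ebasis (i : 'I_3) : pt R :=
  if val i == 0%N then ((1, 0), 0) else if val i == 1%N then ((0, 1), 0) else ((0, 0), 1).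

Definition enorm (x : pt R) : R := Num.sqrt (\sum_(i < 3) coord i x ^+ 2).

Definition Vpot (rho : pt R -> R) (x : pt R) : R :=
  - Rintegral leb3 setT (fun y => rho y / enorm (x - y)).

Definition Epot (rho : pt R -> R) : \bar R :=
  (- (2^-1)%:E * \int[leb3]_x \int[leb3]_y (rho x * rho y / enorm (x - y))%:E)%E.

Definition Hr (Phi : R -> R) (rho : pt R -> R) : \bar R :=
  (\int[leb3]_x (Phi (rho x))%:E + Epot rho)%E.

Definition FM (Phi : R -> R) (M : R) : set (pt R -> R) :=
  [set rho | leb3.-integrable setT (fun x => (rho x)%:E)
           /\ (forall x, 0 <= rho x)
           /\ (\int[leb3]_x (Phi (rho x))%:E < +oo)%E
           /\ (\int[leb3]_x (rho x)%:E = M%:E)%E].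

Definition is_minimizer (Phi : R -> R) (M : R) (rho0 : pt R -> R) :=
  FM Phi M rho0 /\ Hr Phi rho0 = ereal_inf [set Hr Phi rho | rho in FM Phi M].

(* inverse of a function f on a domain D (meaningful when f is injective on D) *)
Definition inv_on (D : set R) (f : R -> R) (y : R) : R :=
  xget 0 [set r | D r /\ f r = y].

Definition pd (i : 'I_3) (f : pt R -> R) : pt R -> R := fun x => 'D_(ebasis i) f x.

Definition C1 (f : pt R -> R) :=
  forall i, (forall x, derivable f x (ebasis i)) /\ continuous (pd i f).
Definition C2 (f : pt R -> R) := C1 f /\ forall i, C1 (pd i f).

Definition laplacian (f : pt R -> R) (x : pt R) : R := \sum_(i < 3) pd i (pd i f) x.

Definition vanishes_at_infinity (f : pt R -> R) :=
  forall eps : R, 0 < eps -> exists r : R, forall x, r < enorm x -> `|f x| < eps.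

Definition EulerPoisson (P : R -> R) (rho : R -> pt R -> R) (u : R -> pt R -> pt R)
    (V : R -> pt R -> R) :=
  forall t x,
  [/\ derivable (fun s => rho s x) t 1,
      (forall i, derivable (fun y => rho t y * coord i (u t y)) x (ebasis i)) &
      'D_1 (fun s => rho s x) t
        + \sum_(i < 3) pd i (fun y => rho t y * coord i (u t y)) x = 0]
  /\
  (forall i,
   [/\ derivable (fun s => coord i (u s x)) t 1,
       (forall j, derivable (fun y => coord i (u t y)) x (ebasis j)),
       derivable (fun y => P (rho t y)) x (ebasis i),
       derivable (V t) x (ebasis i) &
       rho t x * 'D_1 (fun s => coord i (u s x)) t
       + rho t x * (\sum_(j < 3) coord j (u t x) * pd j (fun y => coord i (u t y)) x)
       = - pd i (fun y => P (rho t y)) x - rho t x * pd i (V t) x])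
  /\
  ((forall i, derivable (V t) x (ebasis i) /\ derivable (pd i (V t)) x (ebasis i))
   /\ laplacian (V t) x = 4 * pi * rho t x)
  /\
  vanishes_at_infinity (V t).

Definition pressure (ddPhi : R -> R) (r : R) : R :=
  Rintegral (@lebesgue_measure R) `[0, r] (fun s => s * ddPhi s).

End Defs.

(* Main.v *)
(* Moving a small amount of mass between level sets of Phi'(rho0) - v, where v = -V0, shows that this
   function is almost everywhere equal to a constant E0 on {rho0 > 0} and at least E0 elsewhere; E0 > 0 would
   bound rho0 below on all of R^3. Reflection in a plane followed by two-point rearrangement preserves the
   constraints and does not decrease the interaction energy, strictly unless rho0 dominates its mirror
   image on one of the two sides. If the plane halves the mass, rho0 is therefore symmetric. The three
   coordinate planes that halve the mass meet in a point x0; rho0 is symmetric under x -> 2 x0 - x, hence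
   every plane through x0 halves the mass, and v is radial about x0. By Newton's shell theorem v becomes
   a one-dimensional integral in w = |x - x0|^2, from which finiteness, monotonicity and the derivatives
   of V0 are read off. Since P(rho0) is the Legendre transform of Phi at E0 - V0, its gradient is
   -rho0 grad V0. Finally the decay rho0 = O(r^-3) of a decreasing integrable density is incompatible
   with E0 = 0, where Phi'(rho0) = v >= c / r would give rho0 >= c' r^-n' with n' < 3. *)
Require Import Defs.
From HB Require Import structures.
From mathcomp Require Import all_boot all_order all_algebra.
From mathcomp Require Import all_classical all_reals all_analysis measurable_realfun.
From mathcomp Require Import ring lra.
Import Order.TTheory GRing.Theory Num.Theory.
Import numFieldNormedType.Exports.
Local Open Scope classical_set_scope.
Local Open Scope ring_scope.
Set Implicit Arguments.
Unset Strict Implicit.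
Unset Printing Implicit Defensive.

(** * Integration over R^3 *)

(** The potential is a priori only an extended real, and the energy is a difference of two integrals
    that might both be infinite. The condition n < 3 removes this obstacle. It places F_M in the
    intersection of L^1 and L^(4/3), where the interaction energy is finite; until the potential
    itself is known to be finite, inequalities are arranged without subtracting it. The same
    condition gives finiteness at the centre: L^(4/3) bounds the potential by a multiple of
    r^(-1/2), the inverse of Phi' turns this into a density of order at most r^(-3/2), and such a
    density has a finite potential at 0. A density is determined only almost everywhere, its
    potential at every point. Symmetry is therefore passed from rho0 to V0, and the pointwise
    representative is recovered from V0 through the inverse of Phi'. Isometries are composed of maps
    that act on one coordinate by a sign and a translation depending on the other two, so Tonelli
    reduces their invariance to the line. The density need not be differentiable at the edge of its
    support, but the Legendre transform is differentiable everywhere; this is why the pressure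
    gradient exists at every point. *)

Section sprod.
Context d1 d2 (T1 : measurableType d1) (T2 : measurableType d2) (R : realType).
Variable m1 : {sigma_finite_measure set T1 -> \bar R}.
Variable m2 : {sigma_finite_measure set T2 -> \bar R}.

(* The library's canonical sigma-finite structure on products only covers subprobabilities. *)
Definition sprod : set (T1 * T2)%type -> \bar R := (m1 \x m2)%E.

HB.instance Definition _ := Measure.on sprod.

Lemma sprod_sigma_finite : sigma_finite setT sprod.
Proof.
have /sigma_finiteP[F [TF ndF Foo]] := sigma_finiteT m1.
have /sigma_finiteP[G [TG ndG Goo]] := sigma_finiteT m2.
exists (fun n => F n `*` G n).
  rewrite -setXTT TF TG; apply/seteqP; split=> -[x y] /=.
    move=> [[n _ Fnx] [k _ Gky]]; exists (maxn n k) => //; split.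
    - by move: x Fnx; exact/subsetPset/ndF/leq_maxl.
    - by move: y Gky; exact/subsetPset/ndG/leq_maxr.
  by move=> [n _ []/= ? ?]; split; exists n.
move=> k; have [? ?] := Foo k; have [? ?] := Goo k.
split; first exact: measurableX.
by rewrite /sprod product_measure1E// lte_mul_pinfty// ge0_fin_numE.
Qed.

HB.instance Definition _ := Measure_isSigmaFinite.Build _ _ _ sprod sprod_sigma_finite.

Lemma sprod_setT : sprod setT = (m1 setT * m2 setT)%E.
Proof. by rewrite /sprod -setXTT product_measure1E. Qed.
End sprod.
Arguments sprod {d1 d2 T1 T2 R}.

Section mu3.
Variable R : realType.
Local Notation T1 := (measurableTypeR R).
Local Notation T2 := (T1 * T1)%type.
Local Notation T3 := (T2 * T1)%type.
Local Notation leb := (@lebesgue_measure R).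
(** The same measure as [leb3], packaged with the sigma-finiteness that Tonelli requires; the two
    are convertible. *)
Definition mu3 : {sigma_finite_measure set T3 -> \bar R} := sprod (sprod leb leb) leb.
Arguments mu3 : simpl never.

Lemma leb3E : @leb3 R = mu3. Proof. by []. Qed.

Lemma tonelli2 (f : T2 -> \bar R) : measurable_fun setT f -> (forall x, 0 <= f x)%E ->
  (\int[sprod leb leb]_p f p = \int[leb]_x \int[leb]_y f (x, y))%E.
Proof. by move=> mf f0; exact: (fubini_tonelli1 f mf f0). Qed.

Lemma tonelli2C (f : T2 -> \bar R) : measurable_fun setT f -> (forall x, 0 <= f x)%E ->
  (\int[sprod leb leb]_p f p = \int[leb]_y \int[leb]_x f (x, y))%E.
Proof. by move=> mf f0; exact: (fubini_tonelli2 f mf f0). Qed.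

Lemma tonelli3 (f : T3 -> \bar R) : measurable_fun setT f -> (forall x, 0 <= f x)%E ->
  (\int[mu3]_x f x = \int[sprod leb leb]_p \int[leb]_z f (p, z))%E.
Proof. by move=> mf f0; exact: (@fubini_tonelli1 _ _ _ _ _ (sprod leb leb) leb f mf f0). Qed.

Lemma tonelli3C (f : T3 -> \bar R) : measurable_fun setT f -> (forall x, 0 <= f x)%E ->
  (\int[mu3]_x f x = \int[leb]_z \int[sprod leb leb]_p f (p, z))%E.
Proof. by move=> mf f0; exact: (@fubini_tonelli2 _ _ _ _ _ (sprod leb leb) leb f mf f0). Qed.

Lemma tonelli6 (f : T3 * T3 -> \bar R) : measurable_fun setT f -> (forall x, 0 <= f x)%E ->
  (\int[mu3]_x \int[mu3]_y (f (x, y)) = \int[mu3]_y \int[mu3]_x (f (x, y)))%E.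
Proof. by move=> mf f0; exact: (@fubini_tonelli _ _ _ _ _ mu3 mu3). Qed.

End mu3.
(** Reduced to real powers by x^-1 = x (x^2)^-1, an identity that survives at 0 because 0^-1 = 0. *)
Lemma measurable_invr (R : realType) : measurable_fun setT (fun x : R => x^-1).
Proof.
have -> : (fun x : R => x^-1) = (fun x => x * (x ^+ 2) `^ (-1)).
  apply/funext => x; rewrite powR_inv1 ?sqr_ge0//.
  have [->|x0] := eqVneq x 0; first by rewrite invr0 mul0r.
  by field.
apply: measurable_funM => //.
exact: (measurableT_comp (measurable_powR _) (measurable_funX _ (@measurable_id _ _ _))).
Qed.

Lemma measurable_sqrtr (R : realType) : measurable_fun setT (@Num.sqrt R).
Proof. by apply: continuous_measurable_fun; exact: sqrt_continuous. Qed.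

Lemma measurable_natr_bool d (T : measurableType d) (R : realType) (b : T -> bool) :
  measurable_fun setT b -> measurable_fun setT (fun x => (b x)%:R : R).
Proof.
move=> mb; rewrite (_ : (fun x => _) = \1_[set x | b x]).
  apply: measurable_indic; rewrite -[X in measurable X]setTI.
  exact: (mb measurableT [set true]).
by apply/funext => x; rewrite indicE mem_setE.
Qed.

Ltac meas1 := lazymatch goal with
  | H : measurable_fun ?D ?f |- measurable_fun ?D ?f => exact: H
  | |- measurable_fun _ (fun x => x) => exact: measurable_id
  | |- measurable_fun _ fst => exact: measurable_fst
  | |- measurable_fun _ snd => exact: measurable_snd
  | |- measurable_fun _ (fun x => (@?f x) + (@?g x)) =>
      first [apply: (measurable_funD (f := f) (g := g)) | apply: (emeasurable_funD (f := f) (g := g))]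
  | |- measurable_fun _ (fun x => (@?f x) * (@?g x)) => apply: (measurable_funM (f := f) (g := g))
  | |- measurable_fun _ (fun x => - (@?f x)) => apply: (measurable_funN (f := f))
  | |- measurable_fun _ (fun x => `|(@?f x)|) => refine (measurableT_comp (@normr_measurable _ _) (_ : measurable_fun _ f))
  | |- measurable_fun _ (fun x => (@?f x) ^+ _) => apply: (measurable_funX (f := f))
  | |- measurable_fun _ (fun x => (@?f x) `^ ?p) => apply: (measurableT_comp (measurable_powR p) (g := f))
  | |- measurable_fun _ (fun x => (@?f x)^-1) => apply: (measurableT_comp (@measurable_invr _) (g := f))
  | |- measurable_fun _ (fun x => Num.sqrt (@?f x)) => apply: (measurableT_comp (@measurable_sqrtr _) (g := f))
  | |- measurable_fun _ (fun x => (nat_of_bool (@?b x))%:R) => apply: (measurable_natr_bool (b := b))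
  | |- measurable_fun _ (fun x => ((@?f x) < (@?g x))%R) => apply: (measurable_fun_ltr (f := f) (g := g))
  | |- measurable_fun _ (fun x => ((@?f x) <= (@?g x))%R) => apply: (measurable_fun_ler (f := f) (g := g))
  | |- measurable_fun _ (fun x => (@?f x) && (@?g x)) => apply: (measurable_and (f := f) (g := g))
  | |- measurable_fun _ (fun x => Num.max (@?f x) (@?g x)) => apply: (measurable_maxr (f := f) (g := g))
  | |- measurable_fun _ (fun x => Num.min (@?f x) (@?g x)) => apply: (measurable_minr (f := f) (g := g))
  | |- measurable_fun _ (fun x => ((@?f x), (@?g x))) => apply: (measurable_fun_pair (f := f) (g := g))
  | |- measurable_fun _ (fun x => fst (@?f x)) => apply: (measurableT_comp measurable_fst (g := f))
  | |- measurable_fun _ (fun x => snd (@?f x)) => apply: (measurableT_comp measurable_snd (g := f))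
  | |- measurable_fun _ (fun x => EFin (@?f x)) => apply/measurable_EFinP
  | |- measurable_fun _ (fun x => (@?f x) * (@?g x))%E => apply: (emeasurable_funM (f := f) (g := g))
  | H : measurable_fun setT ?h |- measurable_fun _ (fun x => ?h (@?f x)) => apply: (measurableT_comp H (g := f))
  | |- measurable_fun _ (fun x => ?c) => exact: measurable_cst
  end.
Ltac meas := repeat meas1.

(** * Affine changes of variable and measure-preserving maps *)

Section affine.
Variable R : realType.
Local Notation T1 := (measurableTypeR R).
Local Notation T2 := (T1 * T1)%type.
Local Notation T3 := (T2 * T1)%type.
Local Notation leb := (@lebesgue_measure R).
Local Notation mu3 := (@mu3 R).

Lemma measurable_affine (a b : R) : measurable_fun (setT : set T1) (fun x : T1 => (a * x + b : T1)).
Proof. by apply: measurable_funD => //; apply: measurable_funM. Qed.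

(** The pushforward of Lebesgue measure under x |-> a x + b, multiplied by a, agrees with Lebesgue
    measure on half-open intervals, hence on all measurable sets. *)
Lemma integral_affine (a b : R) (f : T1 -> \bar R) : 0 < a -> measurable_fun setT f ->
  (forall x, 0 <= f x)%E ->
  (\int[leb]_x f x = a%:E * \int[leb]_x f (a * x + b)%R)%E.
Proof.
move=> a0 mf f0.
pose phi : T1 -> T1 := fun x => a * x + b.
have mphi : measurable_fun (setT : set T1) phi := measurable_affine a b.
have a0' : 0 <= a by exact: ltW.
pose p : {measure set T1 -> \bar R} :=
  measure_function_pushforward__canonical__measure_function_Measure leb mphi.
pose m := mscale (NngNum a0') p.
have E A : measurable A -> leb A = m A.
  move=> mA; apply: lebesgue_measure_unique => // _ [[c d]] _ <-.
  pose I := `](c - b) / a, (d - b) / a]%classic.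
  transitivity (a%:E * leb I)%E; last first.
    rewrite /I; congr (_ * leb _)%E; apply/seteqP; split => x /=; rewrite !in_itv/= /phi;
    by rewrite ltr_pdivrMr// ler_pdivlMr// ltrBlDr lerBrDr [x * a]mulrC.
  rewrite !lebesgue_measure_itv /= !lte_fin ltr_pM2r ?invr_gt0// ltrD2r.
  case: ifPn => _; last by rewrite mule0.
  by rewrite -!EFinB -EFinM; congr EFin; field; rewrite gt_eqF.
rewrite (eq_measure_integral m); last by move=> A mA _; exact: E.
rewrite ge0_integral_mscale//; congr (_ * _)%E.
by rewrite ge0_integral_pushforward.
Qed.

Lemma integral_oppr (f : T1 -> \bar R) : measurable_fun setT f ->
  (forall x, 0 <= f x)%E -> (\int[leb]_x f x = \int[leb]_x f (- x)%R)%E.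
Proof.
move=> mf f0.
have mphi : measurable_fun (setT : set T1) (fun x : T1 => - x : T1) by exact: oppr_measurable.
rewrite (eq_measure_integral (pushforward leb (fun x : T1 => - x : T1))).
  by rewrite ge0_integral_pushforward.
by move=> A mA _; rewrite [RHS]lebesgue_measureN.
Qed.

(** The condition [s ^+ 2 = 1] encodes a sign, so that translations and reflections of the line are
    treated together. *)
Lemma integral_isometry (s b : R) (f : T1 -> \bar R) : s ^+ 2 = 1 -> measurable_fun setT f ->
  (forall x, 0 <= f x)%E -> (\int[leb]_x f (s * x + b)%R = \int[leb]_x f x)%E.
Proof.
move=> /eqP; rewrite sqrf_eq1 => /orP[] /eqP-> mf f0.
  by rewrite [RHS](integral_affine (a := 1) b)// mul1e.
rewrite [RHS](integral_affine (a := 1) b)// mul1e [RHS]integral_oppr//.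
- by apply: eq_integral => x _; rewrite mul1r mulN1r.
- by apply: measurableT_comp => //; exact: measurable_affine.
Qed.
End affine.


Section mpres.
Variable R : realType.
Local Notation T1 := (measurableTypeR R).
Local Notation T2 := (T1 * T1)%type.
Local Notation T3 := (T2 * T1)%type.
Local Notation leb := (@lebesgue_measure R).
Local Notation mu3 := (@mu3 R).

(** Invariance is stated for integrals of nonnegative functions, the form in which it is used; on
    indicators it is the usual preservation of measure. *)
Definition mpres (T : T3 -> T3) := measurable_fun setT T /\
  forall f : T3 -> \bar R, measurable_fun setT f -> (forall x, 0 <= f x)%E ->
    (\int[mu3]_x f (T x) = \int[mu3]_x f x)%E.

Lemma mpres_comp (S T : T3 -> T3) : mpres S -> mpres T -> mpres (S \o T).
Proof.
move=> [mS IS] [mT IT]; split; first exact: (measurableT_comp mS mT).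
move=> f mf f0; by rewrite (IT (f \o S)); [exact: IS|exact: (measurableT_comp mf mS)|move=> x; exact: f0].
Qed.

(** Tonelli integrates the sheared coordinate innermost; with the other two fixed, the map is an
    isometry of the line. Reflections and translations of R^3 are composed from these shears. *)
Lemma mpres_coord1 (s : R) (phi : T2 -> R) : s ^+ 2 = 1 -> measurable_fun setT phi ->
  mpres (fun x => ((s * x.1.1 + phi (x.1.2, x.2), x.1.2), x.2)).
Proof.
move=> s2 mphi; split; first by meas.
move=> f mf f0; rewrite !tonelli3C//; last by meas.
apply: eq_integral => z _; rewrite !tonelli2C//=; [|by meas..].
apply: eq_integral => y _.
rewrite (@integral_isometry R s _ (fun x : T1 => f (x, y, z)))//.
by meas.
Qed.

Lemma mpres_coord2 (s : R) (phi : T2 -> R) : s ^+ 2 = 1 -> measurable_fun setT phi ->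
  mpres (fun x => ((x.1.1, s * x.1.2 + phi (x.1.1, x.2)), x.2)).
Proof.
move=> s2 mphi; split; first by meas.
move=> f mf f0; rewrite !tonelli3C//; last by meas.
apply: eq_integral => z _; rewrite !tonelli2//=; [|by meas..].
apply: eq_integral => y _.
rewrite (@integral_isometry R s _ (fun x : T1 => f (y, x, z)))//.
by meas.
Qed.

Lemma mpres_coord3 (s : R) (phi : T2 -> R) : s ^+ 2 = 1 -> measurable_fun setT phi ->
  mpres (fun x => (x.1, s * x.2 + phi x.1)).
Proof.
move=> s2 mphi; split; first by meas.
move=> f mf f0; rewrite !tonelli3//; last by meas.
apply: eq_integral => p _ /=.
rewrite (@integral_isometry R s _ (fun x : T1 => f (p, x)))//.
by meas.
Qed.
End mpres.

Lemma mu3_setT (R : realType) : mu3 R setT = +oo%E.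
Proof.
have l : @lebesgue_measure R setT = +oo%E.
  by have := @lebesgue_measure_itv R `]-oo, +oo[; rewrite set_itvNyy => ->.
have e := sprod_setT (sprod (@lebesgue_measure R) (@lebesgue_measure R)) (@lebesgue_measure R).
apply: (etrans e); apply: (etrans (f_equal2 (fun a b => a * b)%E _ l)); last exact: mulyy.
apply: (etrans (sprod_setT (@lebesgue_measure R) (@lebesgue_measure R))).
by apply: (etrans (f_equal2 (fun a b => a * b)%E l l)); exact: mulyy.
Qed.

Global Opaque mu3.

(** * Polar coordinates and the volume element in the radial variable *)

Section planar.
Variable R : realType.
Local Notation T1 := (measurableTypeR R).
Local Notation T2 := (T1 * T1)%type.
Local Notation T3 := (T2 * T1)%type.
Local Notation leb := (@lebesgue_measure R).
Local Notation leb2 := (sprod leb leb).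

Definition sq2 (p : T2) : T1 := p.1 ^+ 2 + p.2 ^+ 2.

Lemma measurable_sq2 : measurable_fun setT sq2. Proof. rewrite /sq2; meas. Qed.

(** Image of the planar measure under |p|^2. Dilation by sqrt t multiplies areas by t, so the image
    measure of ]-oo, t] is linear in t > 0; this replaces the trigonometric change of variables. *)
Definition sq2_measure : {measure set T1 -> \bar R} :=
  measure_function_pushforward__canonical__measure_function_Measure leb2 measurable_sq2.

Lemma integral_leb2_scale (a : R) (f : T2 -> \bar R) : 0 < a -> measurable_fun setT f ->
  (forall x, 0 <= f x)%E ->
  (\int[leb2]_p f p = (a ^+ 2)%:E * \int[leb2]_p f (a * p.1, a * p.2)%R)%E.
Proof.
move=> a0 mf f0; rewrite !tonelli2//; last by meas.
rewrite (integral_affine (a := a) 0)//; last 2 first.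
- exact: measurable_fun_fubini_tonelli_F.
- by move=> x; exact: integral_ge0.
rewrite EFinM -muleA; congr (_ * _)%E.
rewrite -ge0_integralZl//; last 3 first.
- apply: (measurable_fun_fubini_tonelli_F (m2 := leb) (fun p : T2 => f (a * p.1, a * p.2))) => //.
  by meas.
- by move=> x _; exact: integral_ge0.
- by rewrite lee_fin ltW.
apply: eq_integral => x _; rewrite addr0 (integral_affine (a := a) 0)//; last by meas.
by congr (_ * _)%E; apply: eq_integral => y _; rewrite addr0.
Qed.

Let N t : \bar R := sq2_measure `]-oo, t]%classic.

Let NE t : 0 < t -> N t = (t%:E * N 1%R)%E.
Proof.
move=> t0.
have E s : N s = (\int[leb2]_p (\1_(`]-oo, s]%classic) (sq2 p))%:E)%E.
  transitivity (\int[leb2]_p (\1_(sq2 @^-1` `]-oo, s]) p)%:E)%E => //.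
  rewrite integral_indic// ?setIT// -[X in measurable X]setTI; exact: measurable_sq2.
rewrite !E (@integral_leb2_scale (Num.sqrt t))//=.
- rewrite (sqr_sqrtr (ltW t0)); congr (_ * _)%E; apply: eq_integral => p _.
  rewrite !indicE !mem_setE !in_itv/= /sq2 /= !exprMn -mulrDr (sqr_sqrtr (ltW t0)).
  by rewrite -[leRHS]mulr1 ler_pM2l.
- by rewrite sqrtr_gt0.
- have mI : measurable_fun setT (\1_(`]-oo, t]%classic : set T1) : T1 -> R).
    by apply: measurable_indic; exact: measurable_itv.
  by apply/measurable_EFinP; exact: (measurableT_comp mI measurable_sq2).
Qed.

Let N1_fin : N 1%R \is a fin_num.
Proof.
rewrite ge0_fin_numE//.
pose Q : set T1 := `]-2, 2]%classic.
have mQ : measurable Q by exact: measurable_itv.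
apply: (@le_lt_trans _ _ (leb2 (Q `*` Q))).
  rewrite /N /sq2_measure /= /pushforward; apply: le_measure; rewrite ?inE.
  - by rewrite -[X in measurable X]setTI; apply: measurable_sq2 => //; exact: measurable_itv.
  - exact: measurableX.
  - move=> [x y] /=; rewrite /Q /sq2 /= !in_itv/= => h.
    by split; apply/andP; split; nra.
have lQ : leb Q = _ := lebesgue_measure_itv `](-2 : R), 2].
rewrite /sprod product_measure1E//.
suff : (leb Q * leb Q < +oo)%E by [].
by rewrite lQ/=; case: ifP => _; rewrite -?EFinB -EFinM ltry.
Qed.

Let Nmax t : N t = ((Num.max 0 t)%:E * N 1%R)%E.
Proof.
case: (ltP 0 t) => [t0|t0]; first exact: NE.
rewrite mul0e; apply/eqP; rewrite eq_le measure_ge0 andbT.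
apply: (@le_trans _ _ (leb2 ([set 0] `*` [set 0]))).
  rewrite /N /sq2_measure /= /pushforward; apply: le_measure; rewrite ?inE.
  - by rewrite -[X in measurable X]setTI; apply: measurable_sq2 => //; exact: measurable_itv.
  - by apply: measurableX.
  - move=> [x y] /=; rewrite /sq2 /= !in_itv/= => h.
    by split; apply/eqP; rewrite -sqrf_eq0; apply/eqP; nra.
rewrite /sprod product_measure1E//.
pose Z : set R := [set 0].
have l0 : leb Z = 0%E := lebesgue_measure_set1 (0 : R).
suff : (leb Z * leb Z <= 0)%E by [].
by rewrite l0 mule0.
Qed.

(** The area of the unit disc, identified with [pi] only in [c_pi]. *)
Let c := fine (N 1%R).

Let sq2_measure_oc a b : a <= b -> sq2_measure `]a, b]%classic = (c * (Num.max 0 b - Num.max 0 a))%:E.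
Proof.
move=> ab.
have -> : `]a, b]%classic = `]-oo, b]%classic `\` `]-oo, a]%classic :> set T1.
  apply/seteqP; split => x /=; rewrite !in_itv/=.
    by move=> /andP[h1 h2]; split => //; apply/negP; rewrite -ltNge.
  by move=> [-> /negP]; rewrite -ltNge => ->.
have Nc t : N t = (c * Num.max 0 t)%:E by rewrite Nmax -(fineK N1_fin) -EFinM mulrC.
rewrite measureD//=; last by have := Nc b; rewrite /N => ->; rewrite ltry.
rewrite setIidr; last by move=> x /=; rewrite !in_itv/= => /le_trans; exact.
by have := Nc b; have := Nc a; rewrite /N => -> ->; rewrite -EFinB mulrBr.
Qed.

Let c_gt0 : 0 < c.
Proof.
pose Q : set T1 := `]0, 2^-1]%classic.
have mQ : measurable Q by exact: measurable_itv.
have lQ : leb Q = _ := lebesgue_measure_itv `](0 : R), 2^-1].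
rewrite /c fine_gt0// ltey_eq N1_fin/= andbT.
apply: (@lt_le_trans _ _ (leb2 (Q `*` Q))); last first.
  rewrite /N /sq2_measure /= /pushforward; apply: le_measure; rewrite ?inE.
  - exact: measurableX.
  - by rewrite -[X in measurable X]setTI; apply: measurable_sq2 => //; exact: measurable_itv.
  - by move=> [x y] /=; rewrite /Q /sq2 /= !in_itv/= => -[/andP[? ?] /andP[? ?]]; nra.
rewrite /sprod product_measure1E//.
suff : (0 < leb Q * leb Q)%E by [].
by rewrite lQ/= lte_fin invr_gt0 ltr0n/= sube0 -EFinM lte_fin; lra.
Qed.

(** Uniqueness of Lebesgue measure asks for agreement on all intervals of the line. The image
    measure lives on the nonnegative half line, so [c^-1] times it is completed by Lebesgue measure
    on the negative half line before uniqueness is applied. *)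
Let sq2_measureE (A : set T1) : measurable A -> (forall x, A x -> 0 <= x) ->
  sq2_measure A = (c%:E * leb A)%E.
Proof.
move=> mA A0; have c0 := c_gt0.
have ci0 : 0 <= c^-1 by rewrite invr_ge0 ltW.
pose m1 : {measure set T1 -> \bar R} := mscale (NngNum ci0) sq2_measure.
pose NEG : set T1 := `]-oo, (0 : R)]%classic.
have mneg : measurable NEG by exact: measurable_itv.
pose m2 : {measure set T1 -> \bar R} := mrestr leb mneg.
pose m := measure_add m1 m2.
have mE B : m B = (m1 B + m2 B)%E by exact: measure_addE.
have E : leb A = m A.
  apply: lebesgue_measure_unique => // _ [[a b]] _ <-.
  have [ab|ba] := leP a b; last first.
    by rewrite set_itv_ge ?measure0// -leNgt bnd_simp ltW.
  pose I : set T1 := `]a, b]%classic.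
  suff -> : leb I = (m1 I + m2 I)%E by exact/esym/mE.
  transitivity ((c^-1)%:E * sq2_measure I + leb (I `&` NEG))%E => //.
  rewrite sq2_measure_oc//.
  have -> : I `&` NEG = `]a, (Num.min b 0)]%classic.
    apply/seteqP; split => x; rewrite /I /NEG /= !in_itv/= le_min.
      by move=> [/andP[-> ->] ->].
    by move=> /andP[-> /andP[-> ->]].
  rewrite !lebesgue_measure_itv/= !lte_fin -EFinM mulKf ?gt_eqF//.
  case: ltgtP ab => // [ab _|<- _].
    case: ifPn; rewrite -?EFinB -?EFinD => h; congr EFin.
      by move: h; rewrite lt_min => /andP[_ a0]; rewrite (max_l (ltW a0)); case: (leP 0 b); case: (leP b 0); lra.
    move: h; rewrite lt_min ab/= -leNgt => a0; rewrite !max_r//; first lra.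
    by rewrite (le_trans a0)// ltW.
  by rewrite subrr add0r lt_min ltxx.
transitivity (c%:E * m A)%E; last by rewrite E.
rewrite mE.
transitivity (c%:E * ((c^-1)%:E * sq2_measure A + leb (A `&` NEG)))%E => //.
have -> : leb (A `&` NEG) = 0.
  apply/eqP; rewrite eq_le measure_ge0 andbT -(lebesgue_measure_set1 (0:R)).
  apply: le_measure; rewrite ?inE; [exact: measurableI|exact: measurable_set1|].
  move=> x [/A0 h1]; rewrite /NEG /= in_itv/= => h2.
  by apply/eqP; rewrite eq_le h1 h2.
by rewrite adde0 muleA -EFinM divff ?gt_eqF// mul1e.
Qed.

Let integral_sq2_c (h : T1 -> \bar R) : measurable_fun setT h -> (forall w, 0 <= h w)%E ->
  (\int[leb2]_p h (sq2 p) = c%:E * \int[leb]_(w in `[0%R, +oo[) h w)%E.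
Proof.
move=> mh h0; have c0 := c_gt0.
pose P : set T1 := `[(0 : R), +oo[%classic.
have mP : measurable P by exact: measurable_itv.
have sq2P : sq2 @^-1` P = setT.
  by apply/seteqP; split => // x _; rewrite /P /= in_itv/= andbT /sq2; nra.
have mhP : measurable_fun P h by exact: measurable_funTS.
have c0' : 0 <= c by exact: ltW.
pose m : {measure set T1 -> \bar R} := mscale (NngNum c0') leb.
transitivity (\int[sq2_measure]_(w in P) h w)%E.
  rewrite (ge0_integral_pushforward measurable_sq2)// sq2P.
  by apply: eq_integral.
rewrite (eq_measure_integral m).
  by rewrite ge0_integral_mscale.
move=> A mA AP; apply: sq2_measureE => // x /AP; by rewrite /P /= in_itv/= andbT.
Qed.

Let integral_expN : (\int[leb]_(w in `[0%R, +oo[) (expR (- w))%:E = 1)%E.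
Proof.
rewrite (@ge0_continuous_FTC2y _ (fun w => expR (- w)) (fun w => - expR (- w)) 0 0).
- by rewrite oppr0 expR0 sub0e -EFinN opprK.
- by move=> x _; exact: expR_ge0.
- apply: continuous_subspaceT => x; apply: continuous_comp; first exact: opp_continuous.
  exact: continuous_expR.
- rewrite -oppr0; apply: cvgN; apply: (@cvgr_expR R).
- by move=> x _; apply: ex_derive.
- apply: cvg_at_right_filter; apply: cvgN; apply: continuous_comp; first exact: opp_continuous.
  exact: continuous_expR.
- move=> x _; by rewrite derive1E derive_val mulrN1 opprK.
Qed.

(* Integrating the Gaussian exp (- |p|^2) identifies the constant. *)
Let c_pi : c = pi.
Proof.
have mg : measurable_fun setT (fun w : T1 => (expR (- w))%:E).
  apply/measurable_EFinP.
  exact: (measurableT_comp (@measurable_expR R) (@oppr_measurable R setT)).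
have mgauss : measurable_fun setT (fun x : T1 => (gauss_fun x)%:E).
  by apply/measurable_EFinP; exact: measurable_gauss_fun.
have := integral_sq2_c mg (fun w => expR_ge0 (- w)).
rewrite integral_expN mule1 => E; apply: EFin_inj; rewrite -E.
rewrite tonelli2//; last exact: (measurableT_comp mg measurable_sq2).
transitivity (\int[leb]_x ((Num.sqrt pi)%:E * (gauss_fun x)%:E))%E.
  apply: eq_integral => x _.
  transitivity (\int[leb]_y ((gauss_fun x)%:E * (gauss_fun y)%:E))%E.
    apply: eq_integral => y _.
    by rewrite /sq2 /= opprD expRD EFinM.
  rewrite ge0_integralZl//; last by rewrite lee_fin gauss_fun_ge0.
    by rewrite integralT_gauss muleC.
  by move=> y _; rewrite lee_fin gauss_fun_ge0.
rewrite ge0_integralZl//.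
  by rewrite integralT_gauss -EFinM -expr2 sqr_sqrtr// pi_ge0.
by move=> y _; rewrite lee_fin gauss_fun_ge0.
Qed.

Lemma integral_sq2 (h : T1 -> \bar R) : measurable_fun setT h -> (forall w, 0 <= h w)%E ->
  (\int[leb2]_p h (sq2 p) = pi%:E * \int[leb]_w (h w * (0 <= w)%R%:R%:E))%E.
Proof.
move=> mh h0; rewrite integral_sq2_c// c_pi; congr (_ * _)%E.
pose P : set T1 := `[(0 : R), +oo[%classic.
have mP : measurable P by exact: measurable_itv.
rewrite -[LHS]/(\int[leb]_(w in P) h w)%E [LHS]integral_mkcond; apply: eq_integral => w _.
rewrite /patch mem_setE in_itv/= andbT; case: ifP => _; first by rewrite mule1.
by rewrite mule0.
Qed.
End planar.

Section axial.
Variable R : realType.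
Local Notation T1 := (measurableTypeR R).
Local Notation T2 := (T1 * T1)%type.
Local Notation T3 := (T2 * T1)%type.
Local Notation leb := (@lebesgue_measure R).
Local Notation leb2 := (sprod leb leb).
Local Notation mu3 := (@mu3 R).

Definition sqn (x : T3) : T1 := x.1.1 ^+ 2 + x.1.2 ^+ 2 + x.2 ^+ 2.

Lemma measurable_sqn : measurable_fun setT sqn. Proof. rewrite /sqn; meas. Qed.

Lemma measurable_sqle : measurable_fun setT (fun q : T2 => (q.2 ^+ 2 <= q.1)%R%:R : R).
Proof. meas. Qed.

(** On the slice at height z, the planar variable |p|^2 is shifted by z^2 to become w = |y|^2, and
    the constraint |p|^2 >= 0 becomes z^2 <= w. *)
Lemma integral_axial (g : T2 -> \bar R) : measurable_fun setT g -> (forall q, 0 <= g q)%E ->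
  (\int[mu3]_y g (sqn y, y.2) =
   pi%:E * \int[leb]_w \int[leb]_z (g (w, z) * (z ^+ 2 <= w)%R%:R%:E))%E.
Proof.
move=> mg g0; have ms := measurable_sqle; have msqn := measurable_sqn.
have msq2 := @measurable_sq2 R.
have mG : measurable_fun setT (fun q : T2 => (g q * (q.2 ^+ 2 <= q.1)%R%:R%:E)%E).
  by meas.
have G0 q : (0 <= g q * (q.2 ^+ 2 <= q.1)%R%:R%:E)%E by rewrite mule_ge0// lee_fin.
rewrite tonelli3C//; last by meas.
rewrite -(tonelli2 mG)// tonelli2C// -ge0_integralZl//; first last.
- by rewrite lee_fin pi_ge0.
- by move=> z _; exact: integral_ge0.
- exact: (measurable_fun_fubini_tonelli_G (m1 := leb) _ mG).
apply: eq_integral => z _.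
pose h (w : T1) := g (w + z ^+ 2, z).
have mh : measurable_fun setT h by rewrite /h; meas.
transitivity (\int[leb2]_p h (sq2 p))%E; first by [].
rewrite integral_sq2//; last by move=> w; exact: g0.
congr (_ * _)%E.
rewrite [RHS](integral_affine (a := 1) (z ^+ 2))//=; last exact: (measurable_fun_pair1 z mG).
rewrite mul1e; apply: eq_integral => w _.
by rewrite mul1r lerDr.
Qed.

(* With w = |y|^2 as the radial variable, the volume element of R^3 is shell w dw. *)
Definition shell (w : R) : R := 2 * pi * Num.sqrt w.

Lemma integral_sqle (w : R) : (\int[leb]_z ((z ^+ 2 <= w)%R%:R%:E) = (2 * Num.sqrt w)%:E)%E.
Proof.
pose I : set T1 := `[(- Num.sqrt w), (Num.sqrt w)]%classic.
have mI : measurable I by exact: measurable_itv.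
have [w0|w0] := leP 0 w; last first.
  rewrite ltr0_sqrtr// mulr0 integral0_eq// => z _.
  by rewrite leNgt (lt_le_trans w0)// sqr_ge0.
transitivity (\int[leb]_z (\1_I z)%:E)%E.
  apply: eq_integral => z _; rewrite indicE mem_setE in_itv/= -ler_norml.
  by rewrite -[X in (X <= w)%R]real_normK ?num_real// -ler_sqrt// sqrtr_sqr normr_id.
rewrite integral_indic// setIT.
have lI : leb I = _ := lebesgue_measure_itv `[(- Num.sqrt w), (Num.sqrt w)].
suff : leb I = (2 * Num.sqrt w)%:E by [].
rewrite lI/= lte_fin; case: ifPn => [_|].
  by rewrite -EFinB; congr EFin; ring.
rewrite -leNgt => h; congr EFin; have := sqrtr_ge0 w; lra.
Qed.

(** Integrate [integral_axial] over z: the chord z^2 <= w has length 2 sqrt w. The right-hand side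
    runs over the whole line because [shell] vanishes for w <= 0, where [Num.sqrt] is 0. *)
Lemma integral_radial (h : T1 -> \bar R) : measurable_fun setT h -> (forall w, 0 <= h w)%E ->
  (\int[mu3]_y h (sqn y) = \int[leb]_w (h w * (shell w)%:E))%E.
Proof.
move=> mh h0; have ms := measurable_sqle.
rewrite (integral_axial (g := fun q => h q.1))//; last by meas.
rewrite -ge0_integralZl//; first last.
- by rewrite lee_fin pi_ge0.
- by move=> w _; apply: integral_ge0 => z _; rewrite mule_ge0// lee_fin.
- apply: (measurable_fun_fubini_tonelli_F (m2 := leb) (fun q : T2 => (h q.1 * (q.2 ^+ 2 <= q.1)%R%:R%:E)%E)).
    by meas.
  by move=> q; rewrite mule_ge0// lee_fin.
apply: eq_integral => w _ /=.
rewrite ge0_integralZl//; last first.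
  by apply/measurable_EFinP; exact: (measurable_fun_pair2 w ms).
by rewrite integral_sqle muleCA -EFinM /shell mulrA [pi * 2]mulrC.
Qed.
End axial.

(** * Integrals of derivatives and of powers *)

Section ftc.
Variable R : realType.
Local Notation leb := (@lebesgue_measure R).

Lemma integral_itvcc_is_derive (f F : R -> R) (a b : R) : a <= b ->
  (forall x, a <= x <= b -> is_derive x 1 F (f x)) ->
  (forall x, a <= x <= b -> {for x, continuous f}) ->
  (\int[leb]_(x in `[a, b]) (f x)%:E = (F b - F a)%:E)%E.
Proof.
rewrite le_eqVlt => /orP[/eqP <- _ _|ab dF cf].
  by rewrite set_itv1 integral_set1 subrr.
have cF x : a <= x <= b -> {for x, continuous F}.
  move=> xab; have [d _] := dF _ xab.
  exact/differentiable_continuous/derivable1_diffP.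
rewrite (@continuous_FTC2 _ f F)//.
- by apply: continuous_in_subspaceT => x /[!inE]/= /[!in_itv]/= h; exact: cf.
- split.
  + by move=> x /[!in_itv]/= /andP[ax xb]; have [] := dF x; rewrite ?(ltW ax) ?(ltW xb).
  + by apply: cvg_at_right_filter; apply: cF; rewrite lexx ltW.
  + by apply: cvg_at_left_filter; apply: cF; rewrite lexx ltW.
- move=> x /[!in_itv]/= /andP[ax xb]; rewrite derive1E.
  by have := dF x; rewrite !ltW// => /(_ isT)[_ ->].
Qed.

(** On [1/(k+1), 1] the primitive bounds the integral by 1/(e+1), uniformly in k; monotone
    convergence does the rest. *)
Lemma integral_powR_fin (e : R) : -1 < e ->
  (\int[leb]_w (w `^ e * (0 < w < 1)%R%:R)%:E < +oo)%E.
Proof.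
move=> e1.
pose F (k : nat) : set (measurableTypeR R) := `[(k.+1%:R^-1 : R), (1 : R)]%classic.
have mF k : measurable (F k) by exact: measurable_itv.
pose f (w : measurableTypeR R) : \bar R := (w `^ e)%:E.
have mf : measurable_fun setT f.
  by apply/measurable_EFinP; exact: measurable_powR.
have f0 w : (0 <= f w)%E by rewrite lee_fin powR_ge0.
have sU w : 0 < w < 1 -> (\bigcup_i F i) w.
  move=> /andP[w0 w1]; exists (Num.truncn w^-1) => //=.
  rewrite /F /= in_itv/= (ltW w1) andbT invf_ple ?posrE// ltW//.
  by rewrite -truncn_lt_nat ?invr_ge0 ?ltW.
have e10 : 0 < e + 1 by lra.
have bnd k : (\int[leb]_(w in F k) f w <= ((e + 1)^-1)%:E)%E.
  have k0 : 0 < k.+1%:R^-1 :> R by rewrite invr_gt0.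
  have k1 : k.+1%:R^-1 <= 1 :> R by rewrite invf_le1// ler1n.
  have E : (\int[leb]_(w in `[(k.+1%:R^-1)%R, 1%R]) (w `^ e)%:E =
      ((e + 1)^-1 * 1 `^ (e + 1) - (e + 1)^-1 * k.+1%:R^-1 `^ (e + 1))%:E)%E.
    apply: (@integral_itvcc_is_derive (fun w => w `^ e) (fun w => (e + 1)^-1 * w `^ (e + 1))) => //.
      move=> x /andP[kx _]; have x0 : 0 < x := lt_le_trans k0 kx.
      have h := is_derive1_powR (e + 1) x0.
      apply: is_derive_eq; rewrite addrK /GRing.scale/= mulrA mulVf ?mul1r// gt_eqF//.
    move=> x /andP[kx _]; have x0 : 0 < x := lt_le_trans k0 kx.
    by have [d _] := is_derive1_powR e x0; exact/differentiable_continuous/derivable1_diffP.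
  rewrite [X in (X <= _)%E]E lee_fin powR1 mulr1 lerBlDr lerDl mulr_ge0 ?powR_ge0// invr_ge0 ltW//.
have mU : measurable (\bigcup_i F i) by exact: bigcup_measurable.
apply: (@le_lt_trans _ _ (\int[leb]_(w in \bigcup_i F i) f w)%E).
  rewrite [leRHS]integral_mkcond; apply: ge0_le_integral => //.
  - by move=> w _; rewrite lee_fin mulr_ge0// powR_ge0.
  - apply/measurable_EFinP; apply: measurable_funM; first exact: measurable_powR.
    have -> : (fun w : R => (0 < w < 1)%R%:R : R) = \1_(`]0, 1[%classic).
      by apply/funext => w; rewrite indicE mem_setE in_itv.
    by apply: measurable_indic; exact: measurable_itv.
  - exact/(measurable_restrictT f)/measurable_funTS.
  - move=> w _; rewrite /patch; case: ifPn => [_|].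
      by rewrite lee_fin ler_piMr ?powR_ge0//; case: (_ && _).
    move=> /negP; rewrite inE => h; case: (boolP (0 < w < 1)) => [/sU//|_]; by rewrite mulr0.
apply: (@le_lt_trans _ _ ((e + 1)^-1)%:E); last exact: ltry.
have ndF : nondecreasing_seq F.
  apply/nondecreasing_seqP => n; rewrite subsetEset => x; rewrite /F /= !in_itv/= => /andP[h ->].
  by rewrite andbT (le_trans _ h)// lef_pV2 ?posrE// ler_nat.
have cv := @ge0_nondecreasing_set_cvg_integral _ _ _ F f leb _ mF _ _.
rewrite -(cvg_lim _ (cv _ _ _))//.
- apply: lime_le; last by near=> k; exact: bnd.
  apply: cvgP; apply: cv => //.
  + by move=> i; exact: measurable_funTS.
- by move=> i; exact: measurable_funTS.
Unshelve. all: by end_near. Qed.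
End ftc.

(** * Newton's shell theorem *)

Section newton.
Variable R : realType.
Local Notation T1 := (measurableTypeR R).
Local Notation T2 := (T1 * T1)%type.
Local Notation T3 := (T2 * T1)%type.
Local Notation leb := (@lebesgue_measure R).
Local Notation mu3 := (@mu3 R).

Lemma enormE (x : T3) : enorm x = Num.sqrt (sqn x).
Proof. by rewrite /enorm !big_ord_recl big_ord0 /coord /= addr0 /sqn addrA. Qed.

Lemma sqn_ge0 (x : T3) : 0 <= sqn x.
Proof. by rewrite /sqn !addr_ge0// sqr_ge0. Qed.

Lemma enorm_ge0 (x : T3) : 0 <= enorm x. Proof. exact: sqrtr_ge0. Qed.

Lemma enorm_sqr (x : T3) : enorm x ^+ 2 = sqn x.
Proof. by rewrite enormE sqr_sqrtr// sqn_ge0. Qed.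

(** The Newtonian kernel; on the diagonal it takes the value 0, since 0^-1 = 0. *)
Definition ker (x y : T3) : R := (enorm (x - y))^-1.

Lemma invr_sqrt (a : R) : 0 <= a -> (Num.sqrt a)^-1 = a `^ (- 2^-1).
Proof.
move=> a0; rewrite powRN powR12_sqrt//.
Qed.

Lemma kerE x y : ker x y = sqn (x - y) `^ (- 2^-1).
Proof. by rewrite /ker enormE invr_sqrt// sqn_ge0. Qed.

Lemma ker_ge0 x y : 0 <= ker x y. Proof. by rewrite kerE powR_ge0. Qed.

Lemma sqnBC (x y : T3) : sqn (x - y) = sqn (y - x).
Proof.
have E (a b : R) : (a - b) ^+ 2 = (b - a) ^+ 2 by rewrite -sqrrN opprB.
by rewrite /sqn; congr (_ + _ + _); exact: E.
Qed.

Lemma kerC x y : ker x y = ker y x.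
Proof. by rewrite !kerE sqnBC. Qed.

Lemma measurable_ker : measurable_fun setT (fun q : T3 * T3 => ker q.1 q.2).
Proof.
have -> : (fun q : T3 * T3 => ker q.1 q.2) = (fun q : T3 * T3 =>
   ((q.1.1.1 - q.2.1.1) ^+ 2 + (q.1.1.2 - q.2.1.2) ^+ 2 + (q.1.2 - q.2.2) ^+ 2) `^ (- 2^-1)).
  by apply/funext => q; rewrite kerE.
meas.
Qed.

(** The primitive [F] takes the values -|a - r|/r and -(a + r)/r at the two ends, and a + r - |a -
    r| = 2 min(a, r). The condition a != r keeps the square root away from 0. *)
Let inner_pos (a r : R) : 0 < a -> 0 < r -> a != r ->
  (\int[leb]_(z in `[(- a)%R, a]) ((a ^+ 2 - 2 * r * z + r ^+ 2) `^ (- 2^-1))%:E =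
   (2 * a / Num.max r a)%:E)%E.
Proof.
move=> a0 r0 ar.
have pos z : - a <= z <= a -> 0 < a ^+ 2 - 2 * r * z + r ^+ 2.
  move=> /andP[h1 h2]; have : 0 < (a - r) ^+ 2 by rewrite lt_neqAle sqr_ge0 andbT eq_sym sqrf_eq0 subr_eq0.
  by nra.
pose F z := - r^-1 * Num.sqrt (a ^+ 2 - 2 * r * z + r ^+ 2).
transitivity (F a - F (- a))%:E; last first.
  rewrite /F (_ : a ^+ 2 - 2 * r * a + r ^+ 2 = (a - r) ^+ 2); last by ring.
  rewrite (_ : a ^+ 2 - 2 * r * - a + r ^+ 2 = (a + r) ^+ 2); last by ring.
  rewrite !sqrtr_sqr [`|a + r|]ger0_norm; last by lra.
  congr EFin; have r0' : r != 0 by rewrite gt_eqF.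
  have a0' : a != 0 by rewrite gt_eqF.
  by case: (leP r a) => h; [rewrite ger0_norm ?subr_ge0//|rewrite ltr0_norm ?subr_lt0//];
    field; rewrite ?r0' ?a0' //.
apply: (@integral_itvcc_is_derive R (fun z => (a ^+ 2 - 2 * r * z + r ^+ 2) `^ (- 2^-1)) F).
- by lra.
- move=> z hz; have p := pos _ hz.
  have h := is_derive1_sqrt p.
  have h2 : is_derive z 1 (fun z : R => a ^+ 2 - 2 * r * z + r ^+ 2) (- (2 * r)).
    by apply: is_derive_eq; rewrite /GRing.scale/=; ring.
  have h3 : is_derive z 1 (fun z : R => Num.sqrt (a ^+ 2 - 2 * r * z + r ^+ 2))
     ((2 * Num.sqrt (a ^+ 2 - 2 * r * z + r ^+ 2))^-1 * - (2 * r)).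
    exact: (is_derive1_comp (f := Num.sqrt)).
  apply: is_derive_eq; rewrite -invr_sqrt ?(ltW p)// /GRing.scale/=.
  have s0 : Num.sqrt (a ^+ 2 - 2 * r * z + r ^+ 2) != 0 by rewrite gt_eqF// sqrtr_gt0.
  by field; rewrite s0 gt_eqF.
- move=> z hz; have p := pos _ hz.
  apply: (@continuous_comp _ _ _ (fun z : R => a ^+ 2 - 2 * r * z + r ^+ 2) (fun u : R => u `^ (- 2^-1))).
    have h2 : is_derive z 1 (fun z : R => a ^+ 2 - 2 * r * z + r ^+ 2) (- (2 * r)).
      by apply: is_derive_eq; rewrite /GRing.scale/=; ring.
    by have [d _] := h2; exact/differentiable_continuous/derivable1_diffP.
  by have [d _] := is_derive1_powR (- 2^-1) p; exact/differentiable_continuous/derivable1_diffP.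
Qed.

Let inner (w r : R) : 0 <= r -> w != r ^+ 2 ->
  (\int[leb]_z ((w - 2 * r * z + r ^+ 2) `^ (- 2^-1) * (z ^+ 2 <= w)%R%:R)%:E =
   (2 * Num.sqrt w / Num.max r (Num.sqrt w))%:E)%E.
Proof.
move=> r0 wr.
have [w0|w0] := ltP w 0.
  rewrite ltr0_sqrtr// mulr0 mul0r integral0_eq// => z _.
  by rewrite leNgt (lt_le_trans w0) ?sqr_ge0// mulr0.
set a := Num.sqrt w; have a0 : 0 <= a by exact: sqrtr_ge0.
have wa : w = a ^+ 2 by rewrite sqr_sqrtr.
have I_set z : (z ^+ 2 <= w) = (z \in `[- a, a]).
  rewrite in_itv/= -ler_norml.
  by rewrite -[X in (X <= w)%R]real_normK ?num_real// -ler_sqrt// sqrtr_sqr normr_id.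
transitivity (\int[leb]_(z in `[(- a)%R, a]) ((a ^+ 2 - 2 * r * z + r ^+ 2) `^ (- 2^-1))%:E)%E.
  rewrite [RHS]integral_mkcond; apply: eq_integral => z _.
  rewrite /patch mem_setE I_set -wa; case: ifP => _; by rewrite ?mulr1 ?mulr0.
have [a0'|a0'] := eqVneq a 0.
  by rewrite a0' oppr0 set_itv1 integral_set1 mulr0 mul0r.
have [r0'|r0'] := eqVneq r 0; last first.
  apply: inner_pos; rewrite ?lt_neqAle ?a0 ?r0 ?andbT 1?eq_sym//.
  by apply: contra wr => /eqP ra; rewrite ra wa.
have ap : 0 < a by rewrite lt_neqAle a0 eq_sym a0'.
rewrite r0' max_r//.
transitivity (\int[leb]_(z in `[(- a)%R, a]) (cst (a^-1)%:E z))%E.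
  apply: eq_integral => z _ /=.
  rewrite mulr0 mul0r subr0 expr0n addr0 -invr_sqrt ?sqr_ge0//.
  by rewrite sqrtr_sqr ger0_norm.
rewrite integral_cst//.
pose I : set T1 := `[(- a)%R, a]%classic.
have lI : leb I = _ := lebesgue_measure_itv `[(- a), a].
suff : ((a^-1)%:E * leb I = (2 * a / a)%:E)%E by [].
rewrite lI/= lte_fin ifT; last by lra.
by rewrite -EFinB -EFinM; congr EFin; field.
Qed.

Lemma measurable_shell : measurable_fun setT (@shell R). Proof. rewrite /shell; meas. Qed.

Lemma shell_ge0 (w : R) : 0 <= shell w.
Proof. by rewrite /shell mulr_ge0 ?sqrtr_ge0// mulr_ge0 ?pi_ge0. Qed.

(** The mean of 1/|x - y| over the sphere |y|^2 = w is 1/max(r, sqrt w) for x = (0, 0, r). In the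
    variables of [integral_axial], |x - y|^2 is w - 2 r z + r^2, which is affine in z. *)
Lemma newton_axis (h : T1 -> \bar R) (r : R) : 0 <= r -> measurable_fun setT h ->
  (forall w, 0 <= h w)%E ->
  (\int[mu3]_y (h (sqn y) * (ker (0, 0, r) y)%:E) =
   \int[leb]_w (h w * (shell w / Num.max r (Num.sqrt w))%:E))%E.
Proof.
move=> r0 mh h0; have ms := @measurable_sqle R.
pose g (q : T2) := (h q.1 * ((q.1 - 2 * r * q.2 + r ^+ 2) `^ (- 2^-1))%:E)%E.
have mg : measurable_fun setT g by rewrite /g; meas.
have g0 q : (0 <= g q)%E by rewrite mule_ge0// lee_fin powR_ge0.
have mgs : measurable_fun setT (fun q : T2 => (g q * (q.2 ^+ 2 <= q.1)%R%:R%:E)%E) by meas.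
have gs0 q : (0 <= g q * (q.2 ^+ 2 <= q.1)%R%:R%:E)%E by rewrite mule_ge0// lee_fin.
transitivity (\int[mu3]_y g (sqn y, y.2))%E.
  apply: eq_integral => y _; rewrite /g /= kerE; congr (_ * (_ `^ _)%:E)%E.
  by rewrite /sqn /=; ring.
rewrite integral_axial// -ge0_integralZl//; first last.
- by rewrite lee_fin pi_ge0.
- by move=> w _; exact: integral_ge0.
- exact: (measurable_fun_fubini_tonelli_F (m2 := leb) _ mgs).
apply: ge0_ae_eq_integral => //.
- apply: emeasurable_funM => //.
  exact: (measurable_fun_fubini_tonelli_F (m2 := leb) _ mgs).
- by have := measurable_shell => mshell; meas.
- by move=> w _; rewrite mule_ge0 ?lee_fin ?pi_ge0// integral_ge0.
- move=> w _; rewrite mule_ge0// lee_fin divr_ge0 ?shell_ge0//.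
  by rewrite le_max r0.
(* The sphere through the field point, excluded in [inner], corresponds to a single value of w. *)
exists [set r ^+ 2]; split => //; first exact: lebesgue_measure_set1.
move=> w /=; apply: contra_notP => /eqP wr _.
have mz : measurable_fun setT (fun z : T1 => ((w - 2 * r * z + r ^+ 2) `^ (- 2^-1) * (z ^+ 2 <= w)%R%:R)%:E).
  apply/measurable_EFinP; apply: measurable_funM; first by meas.
  exact: (measurable_fun_pair2 w ms).
transitivity (pi%:E * (h w * \int[leb]_z ((w - 2 * r * z + r ^+ 2) `^ (- 2^-1) * (z ^+ 2 <= w)%R%:R)%:E))%E.
  congr (_ * _)%E; rewrite -ge0_integralZl//.
    by apply: eq_integral => z _; rewrite /g /= -muleA.
  by move=> z _; rewrite lee_fin mulr_ge0 ?powR_ge0.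
by rewrite inner// muleCA -EFinM /shell; congr (_ * _%:E)%E; ring.
Qed.
End newton.

(** * Interaction energy *)

(** The negative of the gravitational potential, kept in the extended reals until it is shown to be
    finite. *)
HB.lock Definition pot (R : realType) (f : pt R -> R) (x : pt R) : \bar R :=
  (\int[@mu3 R]_y (f y * ker x y)%:E)%E.

HB.lock Definition mutual (R : realType) (f g : pt R -> R) : \bar R :=
  (\int[@mu3 R]_x \int[@mu3 R]_y (f x * g y * ker x y)%:E)%E.

Section energy.
Variable R : realType.
Local Notation T1 := (measurableTypeR R).
Local Notation T2 := (T1 * T1)%type.
Local Notation T3 := (T2 * T1)%type.
Local Notation leb := (@lebesgue_measure R).
Local Notation mu3 := (@mu3 R).

Lemma mpres_affine (s : R) (x : T3) : s ^+ 2 = 1 ->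
  mpres (fun y : T3 => ((s * y.1.1 + x.1.1, s * y.1.2 + x.1.2), s * y.2 + x.2)).
Proof.
move=> s2.
have h1 := mpres_coord1 s2 (@measurable_cst _ _ T2 R setT x.1.1).
have h2 := mpres_coord2 s2 (@measurable_cst _ _ T2 R setT x.1.2).
have h3 := mpres_coord3 s2 (@measurable_cst _ _ T2 R setT x.2).
exact: (mpres_comp h1 (mpres_comp h2 h3)).
Qed.

Lemma mpres_sub (x : T3) : mpres (fun y : T3 => (x - y : T3)).
Proof.
have := @mpres_affine (-1) x (sqrr_sign _ 1).
rewrite (_ : (fun y : T3 => _) = (fun y : T3 => (x - y : T3)))//.
by apply/funext => -[[a b] c]; rewrite !mulN1r /= ![- _ + _]addrC.
Qed.

Lemma mpres_shift (x : T3) : mpres (fun y : T3 => (y + x : T3)).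
Proof.
have := @mpres_affine 1 x (expr1n _ _).
rewrite (_ : (fun y : T3 => _) = (fun y : T3 => (y + x : T3)))//.
by apply/funext => -[[a b] c]; rewrite !mul1r.
Qed.

(** In the radial variable the integrand is a multiple of w^(1/2 - s) on ]0, 1[, and 1/2 - s >
    -1. *)
Lemma integral_ball_powR_fin (s : R) : s < 3 / 2 ->
  (\int[mu3]_y (sqn y `^ (- s) * (sqn y < 1)%R%:R)%:E < +oo)%E.
Proof.
move=> s32.
rewrite (@integral_radial R (fun w => (w `^ (- s) * (w < 1)%R%:R)%:E)); last 2 first.
- by meas.
- by move=> w; rewrite lee_fin mulr_ge0// powR_ge0.
apply: (@le_lt_trans _ _ (\int[leb]_w ((2 * pi)%:E * (w `^ (2^-1 - s) * (0 < w < 1)%R%:R)%:E))%E).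
  apply: ge0_le_integral => //.
  - by move=> w _; rewrite mule_ge0// lee_fin ?shell_ge0// mulr_ge0// powR_ge0.
  - by have := @measurable_shell R => ms; meas.
  - by meas.
  - move=> w _; rewrite -!EFinM lee_fin /shell.
    have [w0|w0] := leP w 0.
      by rewrite ler0_sqrtr// mulr0 mulr0 !mulr_ge0 ?pi_ge0// powR_ge0.
    have pw : w `^ (2^-1 - s) = w `^ 2^-1 * w `^ (- s).
      by apply: powRD; rewrite (gt_eqF w0) implybT.
    rewrite -(powR12_sqrt (ltW w0)) pw /=.
    have p1 := powR_ge0 w 2^-1; have p2 := powR_ge0 w (- s); have := pi_ge0 R.
    by case: (w < 1); nra.
rewrite ge0_integralZl//.
- rewrite lte_mul_pinfty// ?lee_fin ?mulr_ge0 ?pi_ge0//.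
  by apply: integral_powR_fin; lra.
- by meas.
- by move=> w _; rewrite lee_fin mulr_ge0// powR_ge0.
- by rewrite lee_fin mulr_ge0// pi_ge0.
Qed.

Lemma potEint (f : T3 -> R) (x : T3) : pot f x = (\int[mu3]_y (f y * ker x y)%:E)%E.
Proof. by rewrite pot.unlock. Qed.

Lemma mutualEint (f g : T3 -> R) :
  mutual f g = (\int[mu3]_x \int[mu3]_y (f x * g y * ker x y)%:E)%E.
Proof. by rewrite mutual.unlock. Qed.

(** Nonnegative functions in both L^1 and L^(4/3). This class contains F_M ([FM_L43]) and has finite
    interaction energies ([mutual_fin]). *)
Definition L43 (f : T3 -> R) := [/\ measurable_fun setT f, forall x, 0 <= f x,
  (\int[mu3]_x (f x)%:E < +oo)%E & (\int[mu3]_x (f x `^ (4 / 3))%:E < +oo)%E].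

Let mk := @measurable_ker R.

Lemma measurable_ker_comp d (T : measurableType d) (a b : T -> T3) :
  measurable_fun setT a -> measurable_fun setT b -> measurable_fun setT (fun z => ker (a z) (b z)).
Proof.
by move=> ma mb; exact: (measurableT_comp mk (measurable_fun_pair ma mb)).
Qed.

Lemma measurable_mutual (f g : T3 -> R) : measurable_fun setT f -> measurable_fun setT g ->
  measurable_fun setT (fun q : T3 * T3 => (f q.1 * g q.2 * ker q.1 q.2)%:E).
Proof.
by move=> mf mg; apply/measurable_EFinP; apply: measurable_funM => //; meas.
Qed.

Lemma measurable_pot (f : T3 -> R) : measurable_fun setT f -> (forall x, 0 <= f x) ->
  measurable_fun setT (pot f).
Proof.
move=> mf f0; rewrite (funext (potEint f)).
apply: (@measurable_fun_fubini_tonelli_F _ _ T3 T3 R mu3 (fun q : T3 * T3 => (f q.2 * ker q.1 q.2)%:E)).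
  by apply/measurable_EFinP; apply: measurable_funM => //; meas.
by move=> q; rewrite lee_fin mulr_ge0// ker_ge0.
Qed.

Lemma pot_ge0 (f : T3 -> R) x : (forall x, 0 <= f x) -> (0 <= pot f x)%E.
Proof. by move=> f0; rewrite potEint; apply: integral_ge0 => y _; rewrite lee_fin mulr_ge0// ker_ge0. Qed.

Lemma mutualE (f g : T3 -> R) : measurable_fun setT g -> (forall x, 0 <= f x) ->
  (forall x, 0 <= g x) -> mutual f g = (\int[mu3]_x ((f x)%:E * pot g x))%E.
Proof.
move=> mg f0 g0; rewrite mutualEint; apply: eq_integral => x _; rewrite potEint -ge0_integralZl//.
- by apply: eq_integral => y _; rewrite -EFinM mulrA.
- apply/measurable_EFinP; apply: measurable_funM => //.
  by apply: measurable_ker_comp => //; exact: measurable_cst.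
- by move=> y _; rewrite lee_fin mulr_ge0// ker_ge0.
- by rewrite lee_fin.
Qed.

Lemma mutualC (f g : T3 -> R) : measurable_fun setT f -> measurable_fun setT g ->
  (forall x, 0 <= f x) -> (forall x, 0 <= g x) -> mutual f g = mutual g f.
Proof.
move=> mf mg f0 g0; rewrite mutualEint [RHS]mutualEint.
have -> : (\int[mu3]_x \int[mu3]_y (f x * g y * ker x y)%:E)%E = (\int[mu3]_y \int[mu3]_x (f x * g y * ker x y)%:E)%E.
  apply: (@tonelli6 R (fun q => (f q.1 * g q.2 * ker q.1 q.2)%:E)).
    exact: measurable_mutual.
  by move=> q; rewrite lee_fin !mulr_ge0// ker_ge0.
by apply: eq_integral => x _; apply: eq_integral => y _; rewrite kerC [f _ * _]mulrC.
Qed.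

Lemma mutual_ge0 (f g : T3 -> R) : (forall x, 0 <= f x) -> (forall x, 0 <= g x) ->
  (0 <= mutual f g)%E.
Proof.
move=> f0 g0; rewrite mutualEint; apply: integral_ge0 => x _; apply: integral_ge0 => y _.
by rewrite lee_fin !mulr_ge0// ker_ge0.
Qed.

Lemma potD (f g : T3 -> R) x : measurable_fun setT f -> measurable_fun setT g ->
  (forall x, 0 <= f x) -> (forall x, 0 <= g x) ->
  (pot (fun x => f x + g x)%R x = pot f x + pot g x)%E.
Proof.
move=> mf mg f0 g0; rewrite !potEint -ge0_integralD//.
- by apply: eq_integral => y _; rewrite mulrDl EFinD.
- by move=> y _; rewrite lee_fin mulr_ge0// ker_ge0.
- apply/measurable_EFinP; apply: measurable_funM => //.
  by apply: measurable_ker_comp => //; exact: measurable_cst.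
- by move=> y _; rewrite lee_fin mulr_ge0// ker_ge0.
- apply/measurable_EFinP; apply: measurable_funM => //.
  by apply: measurable_ker_comp => //; exact: measurable_cst.
Qed.

Lemma mutualDr (e f g : T3 -> R) : measurable_fun setT e -> measurable_fun setT f ->
  measurable_fun setT g -> (forall x, 0 <= e x) ->
  (forall x, 0 <= f x) -> (forall x, 0 <= g x) ->
  (mutual e (fun x => f x + g x)%R = mutual e f + mutual e g)%E.
Proof.
move=> me mf mg e0 f0 g0; rewrite !mutualE//; last 2 first.
- exact: measurable_funD.
- by move=> x; rewrite addr_ge0.
rewrite -ge0_integralD//.
- by apply: eq_integral => x _; rewrite potD// muleDr// ge0_adde_def// inE pot_ge0.
- by move=> x _; rewrite mule_ge0 ?lee_fin// pot_ge0.
- by apply: emeasurable_funM; [exact/measurable_EFinP|exact: measurable_pot].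
- by move=> x _; rewrite mule_ge0 ?lee_fin// pot_ge0.
- by apply: emeasurable_funM; [exact/measurable_EFinP|exact: measurable_pot].
Qed.

Lemma mutualDl (e f g : T3 -> R) : measurable_fun setT e -> measurable_fun setT f ->
  measurable_fun setT g -> (forall x, 0 <= e x) ->
  (forall x, 0 <= f x) -> (forall x, 0 <= g x) ->
  (mutual (fun x => f x + g x)%R e = mutual f e + mutual g e)%E.
Proof.
move=> me mf mg e0 f0 g0.
have mfg : measurable_fun setT (fun x => f x + g x) by exact: measurable_funD.
have fg0 x : 0 <= f x + g x by rewrite addr_ge0.
have E := mutualDr me mf mg e0 f0 g0.
have E1 := mutualC mfg me fg0 e0.
have E2 := mutualC mf me f0 e0.
have E3 := mutualC mg me g0 e0.
exact: (etrans E1 (etrans E (esym (f_equal2 _ E2 E3)))).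
Qed.

(** The square |z|^-2 of the kernel, cut off to the unit ball, where it is integrable because 2 <
    3. *)
Let nearker (z : T3) : R := sqn z `^ (- 1) * (sqn z < 1)%R%:R.

Let nearker_ge0 z : 0 <= nearker z. Proof. by rewrite /nearker mulr_ge0// powR_ge0. Qed.

Let measurable_nearker : measurable_fun setT nearker.
Proof. by have := @measurable_sqn R => ms; rewrite /nearker; meas. Qed.

(* With f = a^3 and g = b^3, AM-GM gives a^3 b^3 k <= a^4 b^4 / 2 + (a^4 + b^4) k^2 / 4. *)
Let ker_bound (f g : R) (x y : T3) : 0 <= f -> 0 <= g ->
  f * g * ker x y <= f * g + 2^-1 * (f `^ (4 / 3) * g `^ (4 / 3)) +
    (4^-1 * (f `^ (4 / 3) * nearker (x - y)) + 4^-1 * (g `^ (4 / 3) * nearker (x - y))).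
Proof.
move=> f0 g0.
have cube (u : R) : 0 <= u -> u = (u `^ 3^-1) ^+ 3.
  by move=> u0; rewrite -powR_mulrn ?powR_ge0// -powRrM mulVf ?powRr1// pnatr_eq0.
have four (u : R) : u `^ (4 / 3) = (u `^ 3^-1) ^+ 4.
  by rewrite -powR_mulrn ?powR_ge0// -powRrM [X in _ `^ X = _]mulrC.
have k2 : sqn (x - y) `^ (- 1) = ker x y ^+ 2.
  by rewrite kerE -powR_mulrn ?powR_ge0// -powRrM; congr (_ `^ _); field.
have k0 := ker_ge0 x y.
have ff := powR_ge0 f (4 / 3); have gg := powR_ge0 g (4 / 3).
have fgk := mulr_ge0 f0 g0; have h4 := mulr_ge0 ff gg.
have [s1|s1] := ltP (sqn (x - y)) 1; last first.
  (* Away from the diagonal the kernel is at most 1, so the term f g alone suffices. *)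
  have : ker x y <= 1.
    rewrite /ker enormE invf_le1 ?sqrtr_gt0 ?(lt_le_trans ltr01)//.
    by rewrite -[leLHS]sqrtr1 ler_sqrt// (le_trans ler01).
  have n0 := nearker_ge0 (x - y); have := mulr_ge0 ff n0; have := mulr_ge0 gg n0; nra.
rewrite /nearker s1 k2 mulr1 !four.
set a := f `^ 3^-1; set b := g `^ 3^-1; set k := ker x y.
suff : f * g * k <= 2^-1 * (a ^+ 4 * b ^+ 4) + (4^-1 * (a ^+ 4 * k ^+ 2) + 4^-1 * (b ^+ 4 * k ^+ 2)) by lra.
have h1 : 0 <= (a ^+ 2 * b ^+ 2 - a * b * k) ^+ 2 by exact: sqr_ge0.
have h2 : 0 <= ((a ^+ 2 - b ^+ 2) * k) ^+ 2 by exact: sqr_ge0.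
rewrite (cube _ f0) (cube _ g0) -/a -/b.
rewrite -subr_ge0.
(* Both uses of AM-GM at once: the difference of the two sides is a sum of squares. *)
rewrite (_ : _ - _ = 2^-1 * (a ^+ 2 * b ^+ 2 - a * b * k) ^+ 2 + 4^-1 * ((a ^+ 2 - b ^+ 2) * k) ^+ 2); last by field.
by rewrite addr_ge0// mulr_ge0.
Qed.

Let integral_nearker_fin : (\int[mu3]_z (nearker z)%:E < +oo)%E.
Proof. by apply: (@integral_ball_powR_fin 1); lra. Qed.

Let integral_sep (f g : T3 -> R) : measurable_fun setT f -> measurable_fun setT g ->
  (forall x, 0 <= f x) -> (forall x, 0 <= g x) ->
  (\int[mu3]_x (f x)%:E < +oo)%E -> (\int[mu3]_x (g x)%:E < +oo)%E ->
  (\int[mu3]_x \int[mu3]_y (f x * g y)%:E < +oo)%E.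
Proof.
move=> mf mg f0 g0 ff gf.
have -> : (\int[mu3]_x \int[mu3]_y (f x * g y)%:E = \int[mu3]_x (f x)%:E * \int[mu3]_y (g y)%:E)%E.
  have G0 : (0 <= \int[mu3]_y (g y)%:E)%E by apply: integral_ge0 => x _; rewrite lee_fin.
  transitivity (\int[mu3]_x (\int[mu3]_y (g y)%:E * (f x)%:E))%E.
    apply: eq_integral => x _; rewrite muleC -ge0_integralZl_EFin//.
    - by move=> y _; rewrite lee_fin.
    - exact/measurable_EFinP.
  rewrite [RHS]muleC; apply: ge0_integralZl => //; first exact/measurable_EFinP.
  by move=> x _; rewrite lee_fin.
have f1 : (0 <= \int[mu3]_x (f x)%:E)%E by apply: integral_ge0 => x _; rewrite lee_fin.
have g1 : (0 <= \int[mu3]_x (g x)%:E)%E by apply: integral_ge0 => x _; rewrite lee_fin.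
by rewrite lte_mul_pinfty// ge0_fin_numE.
Qed.

Let integral_conv (f : T3 -> R) : measurable_fun setT f ->
  (forall x, 0 <= f x) -> (\int[mu3]_x (f x)%:E < +oo)%E ->
  (\int[mu3]_x \int[mu3]_y (f x * nearker (x - y)%R)%:E < +oo)%E.
Proof.
move=> mf f0 ff; have mn := measurable_nearker.
rewrite (_ : (\int[mu3]_x _) = \int[mu3]_x \int[mu3]_y (f x * nearker y)%:E)%E.
  by apply: integral_sep => //; exact: integral_nearker_fin.
apply: eq_integral => x _.
rewrite -((mpres_sub x).2 (fun y => (f x * nearker y)%:E))//.
  by meas.
by move=> y; rewrite lee_fin mulr_ge0.
Qed.

(** A weak substitute for the Hardy-Littlewood-Sobolev inequality. After [ker_bound], two of the
    four terms are products of finite integrals; in the other two a translation decouples the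
    integrable [nearker] from the power of f or g. *)
Lemma mutual_fin (f g : T3 -> R) : L43 f -> L43 g -> (mutual f g < +oo)%E.
Proof.
move=> [mf f0 f1 f4] [mg g0 g1 g4].
pose f' x := f x `^ (4 / 3); pose g' x := g x `^ (4 / 3).
have mf' : measurable_fun setT f' by rewrite /f'; meas.
have mg' : measurable_fun setT g' by rewrite /g'; meas.
have f'0 x : 0 <= f' x by exact: powR_ge0.
have g'0 x : 0 <= g' x by exact: powR_ge0.
have mn := measurable_nearker.
have mn2 : measurable_fun setT (fun q : T3 * T3 => nearker (q.1 - q.2)).
  apply: (measurableT_comp mn (g := fun q : T3 * T3 => (q.1 - q.2 : T3))).
  have -> : (fun q : T3 * T3 => (q.1 - q.2 : T3)) =
      (fun q => ((q.1.1.1 - q.2.1.1, q.1.1.2 - q.2.1.2), q.1.2 - q.2.2)).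
    by apply/funext => q.
  by meas.
pose mu6 : {measure set (T3 * T3)%type -> \bar R} := sprod mu3 mu3.
have I2 (u : T3 * T3 -> R) : measurable_fun setT u -> (forall q, 0 <= u q) ->
    (\int[mu6]_q (u q)%:E = \int[mu3]_x \int[mu3]_y (u (x, y))%:E)%E.
  move=> mu u0; apply: (@fubini_tonelli1 _ _ _ _ _ mu3 mu3 (fun q => (u q)%:E)) => //.
  exact/measurable_EFinP.
rewrite mutualEint -(I2 (fun q => f q.1 * g q.2 * ker q.1 q.2)); last 2 first.
- by have /measurable_EFinP := measurable_mutual mf mg.
- by move=> q; rewrite !mulr_ge0// ker_ge0.
pose u1 (q : T3 * T3) := f q.1 * g q.2.
pose u2 (q : T3 * T3) := f' q.1 * g' q.2.
pose u3 (q : T3 * T3) := f' q.1 * nearker (q.1 - q.2).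
pose u4 (q : T3 * T3) := g' q.2 * nearker (q.1 - q.2).
have mu1 : measurable_fun setT u1 by rewrite /u1; meas.
have mu2 : measurable_fun setT u2 by rewrite /u2; meas.
have mu3' : measurable_fun setT u3 by apply: measurable_funM => //; meas.
have mu4 : measurable_fun setT u4 by apply: measurable_funM => //; meas.
have u1p q : 0 <= u1 q by rewrite mulr_ge0.
have u2p q : 0 <= u2 q by rewrite mulr_ge0.
have u3p q : 0 <= u3 q by rewrite mulr_ge0.
have u4p q : 0 <= u4 q by rewrite mulr_ge0.
apply: (@le_lt_trans _ _ (\int[mu6]_q ((u1 q)%:E + 2^-1%:E * (u2 q)%:E +
   (4^-1%:E * (u3 q)%:E + 4^-1%:E * (u4 q)%:E)))%E).
  apply: ge0_le_integral => //.
  - by move=> q _; rewrite lee_fin !mulr_ge0// ker_ge0.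
  - exact: measurable_mutual.
  - by meas.
  - by move=> q _; rewrite -!EFinM -!EFinD lee_fin; exact: ker_bound.
have J1 : (\int[mu6]_q (u1 q)%:E < +oo)%E by rewrite (I2 _ mu1 u1p); exact: (integral_sep mf mg f0 g0 f1 g1).
have J2 : (\int[mu6]_q (u2 q)%:E < +oo)%E by rewrite (I2 _ mu2 u2p); exact: (integral_sep mf' mg' f'0 g'0 f4 g4).
have J3 : (\int[mu6]_q (u3 q)%:E < +oo)%E by rewrite (I2 _ mu3' u3p); exact: (integral_conv mf' f'0 f4).
have J4 : (\int[mu6]_q (u4 q)%:E < +oo)%E.
  rewrite (I2 _ mu4 u4p).
  have mEu4 : measurable_fun setT (fun q => (u4 q)%:E) by exact/measurable_EFinP.
  have E4 := tonelli6 mEu4 u4p.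
  apply: le_lt_trans (integral_conv mg' g'0 g4).
  rewrite le_eqVlt; apply/orP; left; apply/eqP; apply: (etrans E4).
  apply: eq_integral => x _; apply: eq_integral => y _; rewrite /u4 /=.
  by rewrite /nearker sqnBC.
have pe (u : T3 * T3 -> R) c : (forall q, 0 <= u q) -> 0 <= c -> forall q, setT q -> (0 <= c%:E * (u q)%:E)%E.
  by move=> h1 h2 q _; rewrite mule_ge0 ?lee_fin.
have fin_scale c (u : T3 * T3 -> R) : 0 <= c -> measurable_fun setT u -> (forall q, 0 <= u q) ->
    (\int[mu6]_q (u q)%:E < +oo)%E -> (\int[mu6]_q (c%:E * (u q)%:E) < +oo)%E.
  move=> c0 mu u0 ufin; rewrite ge0_integralZl//.
  - by rewrite lte_mul_pinfty// lee_fin.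
  - exact/measurable_EFinP.
  - by move=> q _; rewrite lee_fin.
have fin_add (u v : T3 * T3 -> \bar R) : measurable_fun setT u -> measurable_fun setT v ->
    (forall q, 0 <= u q)%E -> (forall q, 0 <= v q)%E ->
    (\int[mu6]_q u q < +oo)%E -> (\int[mu6]_q v q < +oo)%E ->
    (\int[mu6]_q (u q + v q) < +oo)%E.
  by move=> mu mv u0 v0 ? ?; rewrite ge0_integralD// lte_add_pinfty.
have mZ c (u : T3 * T3 -> R) : measurable_fun setT u -> measurable_fun setT (fun q => (c%:E * (u q)%:E)%E).
  by move=> mu; meas.
have h2 : 0 <= 2^-1 :> R by [].
have h4 : 0 <= 4^-1 :> R by [].
apply: (fin_add (fun q => (u1 q)%:E + 2^-1%:E * (u2 q)%:E)%E (fun q => 4^-1%:E * (u3 q)%:E + 4^-1%:E * (u4 q)%:E)%E).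
- by apply: emeasurable_funD; [exact/measurable_EFinP|exact: mZ].
- by apply: emeasurable_funD; exact: mZ.
- by move=> q; rewrite adde_ge0 ?pe ?lee_fin.
- by move=> q; rewrite adde_ge0 ?pe ?lee_fin.
- apply: (fin_add (fun q => (u1 q)%:E) (fun q => 2^-1%:E * (u2 q)%:E)%E) => //.
  + exact/measurable_EFinP.
  + exact: mZ.
  + by move=> q; apply: pe.
  + exact: (fin_scale _ _ h2 mu2 u2p J2).
- apply: (fin_add (fun q => 4^-1%:E * (u3 q)%:E)%E (fun q => 4^-1%:E * (u4 q)%:E)%E) => //.
  + exact: mZ.
  + exact: mZ.
  + by move=> q; apply: pe.
  + by move=> q; apply: pe.
  + exact: (fin_scale _ _ h4 mu3' u3p J3).
  + exact: (fin_scale _ _ h4 mu4 u4p J4).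
Qed.
Lemma mutualZ (a b : R) (f g : T3 -> R) : measurable_fun setT f -> measurable_fun setT g ->
  (forall x, 0 <= f x) -> (forall x, 0 <= g x) -> 0 <= a -> 0 <= b ->
  mutual (fun x => a * f x) (fun x => b * g x) = ((a * b)%:E * mutual f g)%E.
Proof.
move=> mf mg f0 g0 a0 b0.
have ab0 : 0 <= a * b by rewrite mulr_ge0.
have mh := measurable_mutual mf mg.
have h0 (q : T3 * T3) : (0 <= (f q.1 * g q.2 * ker q.1 q.2)%:E)%E.
  by rewrite lee_fin !mulr_ge0// ker_ge0.
rewrite !mutualEint -ge0_integralZl//; last 2 first.
- exact: (measurable_fun_fubini_tonelli_F (m2 := mu3) _ mh).
- by move=> x _; apply: integral_ge0 => y _; exact: (h0 (x, y)).
apply: eq_integral => x _; rewrite -ge0_integralZl//; last 2 first.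
- exact: (measurable_fun_pair2 x mh).
- by move=> y _; exact: (h0 (x, y)).
by apply: eq_integral => y _; rewrite -EFinM; congr EFin; ring.
Qed.

End energy.

(** * Integrals of derivatives up to a singular left endpoint *)

Section ftc_left.
Variable R : realType.
Local Notation leb := (@lebesgue_measure R).

(** The derivative is controlled only on ]a, b], as for functions built from sqrt at 0.
    Nonnegativity of f allows the left end [e k] of the interval to decrease to a by monotone
    convergence. *)
Lemma integral_itvcc_is_derive_ge0 (f F : R -> R) (a b : R) : a < b ->
  (forall x, a < x <= b -> 0 <= f x) ->
  (forall x, a < x <= b -> is_derive x 1 F (f x)) ->
  (forall x, a < x <= b -> {for x, continuous f}) ->
  F x @[x --> a^'+] --> F a ->
  (\int[leb]_(x in `[a, b]) (f x)%:E = (F b - F a)%:E)%E.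
Proof.
move=> ab f0 dF cf Fa.
pose e k : R := a + (b - a) / k.+1%:R.
have k0 k : 0 < k.+1%:R :> R by [].
have ea k : a < e k by rewrite /e ltrDl divr_gt0// subr_gt0.
have eb k : e k <= b.
  by rewrite /e -lerBrDl ler_pdivrMr// ler_peMr ?subr_ge0 ?(ltW ab)// ler1n.
pose I (k : nat) : set (measurableTypeR R) := `[e k, b]%classic.
have mI k : measurable (I k) by exact: measurable_itv.
have ndI : nondecreasing_seq I.
  apply/nondecreasing_seqP => n; rewrite subsetEset => x; rewrite /I /= !in_itv/= => /andP[h ->].
  rewrite andbT (le_trans _ h)// /e lerD2l ler_pM2l ?subr_gt0//.
  by rewrite lef_pV2 ?posrE// ler_nat.
have UI : \bigcup_k I k = `]a, b]%classic.
  apply/seteqP; split => x.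
    by move=> [k _]; rewrite /I /= !in_itv/= => /andP[h ->]; rewrite (lt_le_trans (ea k) h).
  rewrite /= in_itv/= => /andP[ax xb]; exists (Num.truncn ((b - a) / (x - a))) => //.
  rewrite /I /= in_itv/= xb andbT /e -lerBrDl ler_pdivrMr// mulrC -ler_pdivrMr ?subr_gt0//.
  by rewrite ltW// -truncn_lt_nat ?divr_ge0// subr_ge0 ltW.
have mf k : measurable_fun (I k) (fun x => (f x)%:E).
  have cw : {within `[e k, b], continuous f}.
    apply: continuous_in_subspaceT => x /[!inE]; rewrite /= in_itv/= => /andP[h1 h2].
    by apply: cf; rewrite h2 (lt_le_trans (ea k)).
  by apply/measurable_EFinP; apply: (subspace_continuous_measurable_fun _ cw).
have E k : (\int[leb]_(x in I k) (f x)%:E = (F b - F (e k))%:E)%E.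
  apply: integral_itvcc_is_derive => // x /andP[h1 h2].
    by apply: dF; rewrite h2 (lt_le_trans (ea k)).
  by apply: cf; rewrite h2 (lt_le_trans (ea k)).
have mU : measurable_fun (`]a, b]%classic : set (measurableTypeR R)) (fun x => (f x)%:E).
  by rewrite -UI; apply/measurable_fun_bigcup.
rewrite -integral_itv_obnd_cbnd.
have f0I i x : I i x -> (0 <= (f x)%:E)%E.
  by rewrite /I /= in_itv/= => /andP[h1 h2]; rewrite lee_fin f0// h2 (lt_le_trans (ea i)).
have cv := @ge0_nondecreasing_set_cvg_integral _ _ _ I (fun x => (f x)%:E) leb ndI mI mf f0I.
have e_a : e k @[k --> \oo] --> a.
  rewrite -[X in _ --> X]addr0 /e; apply: cvgD; first exact: cvg_cst.
  rewrite -[X in _ --> X](mulr0 (b - a)); apply: cvgM; first exact: cvg_cst.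
  exact: cvg_harmonic.
have cv2 : (F b - F (e k))%:E @[k --> \oo] --> (F b - F a)%:E.
  apply: cvg_EFin; first by near=> k.
  apply: cvgB; first exact: cvg_cst.
  have e_ar : e k @[k --> \oo] --> a^'+.
    move=> A [d /= d0 dA].
    have /cvgrPdist_lt/(_ d d0)[N _ hN] := e_a.
    by exists N => // k /= /hN /= h; apply: dA => /=.
  exact: (cvg_comp _ _ e_ar Fa).
rewrite UI (_ : (fun i => _) = (fun k => (F b - F (e k))%:E)) in cv; last exact/funext.
exact: (cvg_unique _ cv cv2).
Unshelve. all: by end_near. Qed.
End ftc_left.

(** * The convex function Phi *)

Section profile.
Variable R : realType.
Implicit Types Phi dPhi : R -> R.

(** The assumptions on Phi in the form in which they act: strict convexity as a strict tangent
    inequality, valid also at x = 0, and growth from a positive threshold on. *)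
Record profile Phi dPhi : Prop := Profile {
  profile0 : Phi 0 = 0;
  profile_d0 : dPhi 0 = 0;
  profile_cont : {within `[0, +oo[, continuous Phi};
  profile_dcont : {within `[0, +oo[, continuous dPhi};
  profile_tangent : forall x y, 0 <= x -> 0 <= y -> x != y -> Phi x + dPhi x * (y - x) < Phi y;
  profile_growth : exists n C r0, [/\ 0 < n < 3, 0 < C, 0 < r0 &
    forall r, r0 <= r -> C * r `^ (1 + n^-1) <= Phi r] }.

(** The weak inequality is the limit of the chord slopes at x. Strictness comes from applying it at
    the midpoint [m], where Phi lies strictly below the chord. *)
Lemma strict_convex_tangent Phi dPhi :
  (fun h : R => h^-1 * (Phi h - Phi 0)) @ 0^'+ --> dPhi 0 ->
  (forall r : R, 0 < r -> is_derive r 1 Phi (dPhi r)) ->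
  (forall x y t : R, 0 <= x -> 0 <= y -> x != y -> 0 < t < 1 ->
      Phi (t * x + (1 - t) * y) < t * Phi x + (1 - t) * Phi y) ->
  forall x y, 0 <= x -> 0 <= y -> x != y -> Phi x + dPhi x * (y - x) < Phi y.
Proof.
move=> d0 d cvx.
have slope x y t : 0 <= x -> 0 <= y -> x != y -> 0 < t < 1 ->
    t^-1 * (Phi (t * (y - x) + x) - Phi x) <= Phi y - Phi x.
  move=> x0 y0 xy /andP[t0 t1].
  have := cvx y x t y0 x0; rewrite eq_sym xy t0 t1 => /(_ isT isT) h.
  rewrite ler_pdivrMl//; rewrite (_ : t * (y - x) + x = t * y + (1 - t) * x); last by ring.
  by lra.
have nt : \forall t \near (0:R)^'+, 0 < t < 1 by near=> t; apply/andP; split; near: t; [exact: nbhs_right_gt|exact: nbhs_right_lt].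
have weak x y : 0 <= x -> 0 <= y -> x != y -> dPhi x * (y - x) <= Phi y - Phi x.
  move=> x0 y0 xy.
  have [x0'|x0'] := eqVneq x 0; last first.
    have xp : 0 < x by rewrite lt_neqAle eq_sym x0'.
    have dl : is_derive (0 : R) 1 (fun t : R => t * (y - x) + x) (y - x).
      by apply: is_derive_eq; rewrite /GRing.scale/= mulr0 add0r addr0 mulr1.
    have df : is_derive (0 : R) 1 (Phi \o (fun t : R => t * (y - x) + x)) (dPhi x * (y - x)).
      by apply: is_derive1_comp; rewrite mul0r add0r; exact: d.
    have cv : (fun t => t^-1 * (Phi (t * (y - x) + x) - Phi x)) @ 0^'+ --> dPhi x * (y - x).
      apply: cvg_dnbhs_at_right.
      pose g := Phi \o (fun t : R => t * (y - x) + x).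
      have hl : (fun h : R => h^-1 *: ((g \o shift 0) (h *: (1 : R)) - g 0)) @ 0^' --> 'D_1 g 0.
        by have [] := df.
      rewrite (@derive_val _ _ _ _ _ _ _ df) in hl.
      apply: cvg_trans hl; apply: near_eq_cvg; near=> t.
      by rewrite /g /= [_%:A]mulr1 addr0 mul0r add0r.
    by apply: (cvgr_to_le cv); near=> t; apply: slope => //; near: t.
  (* At x = 0 only the right derivative is available; t is rescaled by y so that the quotient is the
     one in the hypothesis. *)
  rewrite x0' subr0 in y0 *.
  have yp : 0 < y by rewrite lt_neqAle y0 andbT -x0'.
  have cv : (fun t => t^-1 * (Phi t - Phi 0)) @ 0^'+ --> dPhi 0 by exact: d0.
  rewrite -ler_pdivlMr//; apply: (cvgr_to_le cv); near=> t.
  have t0 : 0 < t by near: t; exact: nbhs_right_gt.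
  have ty : t < y by near: t; exact: nbhs_right_lt.
  have := slope 0 y (t / y) (lexx _) (ltW yp); rewrite lt_eqF// => /(_ isT).
  rewrite divr_gt0//= ltr_pdivrMr// mul1r ty subr0 addr0 => /(_ isT).
  rewrite divfK ?gt_eqF// invf_div => h; rewrite ler_pdivlMr//.
  by apply: le_trans h; rewrite mulrC mulrA.
move=> x y x0 y0 xy.
pose m := 2^-1 * x + (1 - 2^-1) * y.
have := cvx x y 2^-1 x0 y0 xy; rewrite invr_gt0 ltr0n invf_lt1// ltr1n => /(_ isT) h.
have mx : m - x = (y - x) / 2 by rewrite /m; field.
have := weak x m x0; rewrite mx -/m in h *.
have m0 : 0 <= m by rewrite /m; lra.
have xm : x != m by apply: contra xy => /eqP; rewrite /m => e; apply/eqP; lra.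
by move=> /(_ m0 xm); lra.
Unshelve. all: by end_near. Qed.

Section theory.
Variables (Phi dPhi : R -> R) (H : profile Phi dPhi).

Lemma profile_ge0 r : 0 <= r -> 0 <= Phi r.
Proof.
move=> r0; have [->|rn] := eqVneq r 0; first by rewrite (profile0 H).
have := profile_tangent H (lexx _) r0; rewrite eq_sym rn => /(_ isT).
by rewrite (profile0 H) (profile_d0 H) mul0r addr0 => /ltW.
Qed.

Lemma profile_tangent_le x y : 0 <= x -> 0 <= y -> Phi x + dPhi x * (y - x) <= Phi y.
Proof.
move=> x0 y0; have [->|xy] := eqVneq x y; first by rewrite subrr mulr0 addr0.
exact/ltW/profile_tangent.
Qed.

(** Add the strict tangent inequalities at x and at y. *)
Lemma profile_dlt x y : 0 <= x -> x < y -> dPhi x < dPhi y.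
Proof.
move=> x0 xy; have y0 : 0 <= y by rewrite (le_trans x0)// ltW.
have h1 := profile_tangent H x0 y0; have h2 := profile_tangent H y0 x0.
have := h1 (negbT (lt_eqF xy)); have := h2 (negbT (gt_eqF xy)) => ? ?.
have : dPhi x * (y - x) < dPhi y * (y - x) by lra.
by rewrite ltr_pM2r// subr_gt0.
Qed.

Lemma profile_dle x y : 0 <= x -> x <= y -> dPhi x <= dPhi y.
Proof. by move=> x0; rewrite le_eqVlt => /orP[/eqP->//|/(profile_dlt x0)/ltW]. Qed.

Lemma profile_d_inj x y : 0 <= x -> 0 <= y -> dPhi x = dPhi y -> x = y.
Proof.
move=> x0 y0 e; case: (ltgtP x y) => // h.
- by have := profile_dlt x0 h; rewrite e ltxx.
- by have := profile_dlt y0 h; rewrite e ltxx.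
Qed.

Lemma profile_d_ge0 x : 0 <= x -> 0 <= dPhi x.
Proof. by move=> x0; rewrite -(profile_d0 H) profile_dle. Qed.

Lemma profile_d_ge_ratio r : 0 < r -> Phi r / r <= dPhi r.
Proof.
move=> r0; have := profile_tangent_le (ltW r0) (lexx 0).
by rewrite (profile0 H) ler_pdivrMr//; lra.
Qed.

Lemma profile_d_growth : exists n C r0, [/\ 0 < n < 3, 0 < C, 0 < r0 &
  forall r, r0 <= r -> C * r `^ n^-1 <= dPhi r].
Proof.
have [n [C [r0 [n3 C0 r00 h]]]] := profile_growth H.
exists n, C, r0; split => // r rr0; have rp : 0 < r by exact: lt_le_trans rr0.
apply: le_trans (profile_d_ge_ratio rp); rewrite ler_pdivlMr//.
apply: le_trans (h r rr0); rewrite powRD; last by rewrite (gt_eqF rp) implybT.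
by rewrite powRr1 ?(ltW rp)// [r * _]mulrC mulrA.
Qed.

Lemma profile_d_unbounded u : exists2 r, 0 < r & u < dPhi r.
Proof.
have [n [C [r0 [/andP[n0 _] C0 r00 h]]]] := profile_d_growth.
pose s := Num.max 1 ((`|u| + 1) / C).
have s0 : 0 < s by rewrite lt_max ltr01.
pose r := Num.max r0 (s `^ n).
exists r; first by rewrite lt_max r00.
apply: lt_le_trans (h r _); last by rewrite le_max lexx.
have : s <= r `^ n^-1.
  apply: (@le_trans _ _ ((s `^ n) `^ n^-1)).
    by rewrite -powRrM divff ?gt_eqF// powRr1// ltW.
  apply: ge0_ler_powR; rewrite ?nnegrE ?powR_ge0 ?invr_ge0 ?(ltW n0)//.
  - by rewrite le_max (ltW r00).
  - by rewrite le_max lexx orbT.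
move=> h1; apply: (@lt_le_trans _ _ (C * s)); last by rewrite ler_pM2l.
apply: (@lt_le_trans _ _ (`|u| + 1)); first by have := ler_norm u; lra.
by rewrite -ler_pdivrMl// mulrC le_max lexx orbT.
Qed.

Lemma profile_d_surj u : 0 <= u -> exists2 r, 0 <= r & dPhi r = u.
Proof.
move=> u0; have [b b0 ub] := profile_d_unbounded u.
have cw : {within `[0, b], continuous dPhi}.
  apply: continuous_subspaceW (profile_dcont H) => x /=.
  by rewrite !in_itv/= => /andP[->].
have [|c] := IVT (ltW b0) cw (v := u).
  by rewrite (profile_d0 H) ge_min u0/= le_max (ltW ub) orbT.
by rewrite in_itv/= => /andP[c0 _] <-; exists c.
Qed.

(** The inverse of Phi' extended by 0 to nonpositive arguments, so that both cases of the
    Euler-Lagrange relation become the single equation rho0 = ginv (E0 - V0). *)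
Definition ginv u := if 0 < u then inv_on `[0, +oo[ dPhi u else 0.

Lemma ginvP u : 0 <= ginv u /\ (0 <= u -> dPhi (ginv u) = u).
Proof.
rewrite /ginv; case: ltP => [u0|u0].
  rewrite /inv_on; case: xgetP => [r _ /=|]; first by rewrite in_itv/= andbT => -[-> ->].
  have [r r0 e] := profile_d_surj (ltW u0).
  by move=> /(_ r)[]; split => //=; rewrite in_itv/= r0.
split => // u0'; rewrite (profile_d0 H); apply/eqP; by rewrite eq_le u0 u0'.
Qed.

Lemma ginv_ge0 u : 0 <= ginv u. Proof. by have [] := ginvP u. Qed.

Lemma dPhi_ginv u : 0 <= u -> dPhi (ginv u) = u. Proof. by have [] := ginvP u. Qed.

Lemma ginv_dPhi r : 0 <= r -> ginv (dPhi r) = r.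
Proof.
move=> r0; apply: profile_d_inj => //; first exact: ginv_ge0.
by rewrite dPhi_ginv// profile_d_ge0.
Qed.

Lemma ginv_npos u : u <= 0 -> ginv u = 0.
Proof. by move=> u0; rewrite /ginv ltNge u0. Qed.

Lemma ginv_lt u r : 0 < r -> u < dPhi r -> ginv u < r.
Proof.
move=> r0 ur; have [u0|u0] := leP 0 u; last by rewrite ginv_npos// ltW.
rewrite ltNge; apply/negP => h; have := profile_dle (ltW r0) h.
by rewrite dPhi_ginv// leNgt ur.
Qed.

Lemma ginv_gt u r : 0 <= r -> dPhi r < u -> r < ginv u.
Proof.
move=> r0 ru; rewrite ltNge; apply/negP => h.
have u0 : 0 <= u by rewrite (le_trans (profile_d_ge0 r0))// ltW.
by have := profile_dle (ginv_ge0 u) h; rewrite dPhi_ginv// leNgt ru.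
Qed.

Lemma ginv_gt0 u : 0 < u -> 0 < ginv u.
Proof. by move=> u0; apply: ginv_gt => //; rewrite (profile_d0 H). Qed.

Lemma ginv_le u v : u <= v -> ginv u <= ginv v.
Proof.
move=> uv; have [u0|u0] := leP 0 u; last by rewrite ginv_npos ?ginv_ge0// ltW.
rewrite leNgt; apply/negP => /(profile_dlt (ginv_ge0 _)).
by rewrite !dPhi_ginv ?(le_trans u0)// ltNge uv.
Qed.

Lemma continuous_ginv : continuous ginv.
Proof.
move=> u; apply/cvgrPdist_lt => e e0.
have hi : \forall v \near u, ginv v < ginv u + e.
  have p : 0 < ginv u + e by rewrite ltr_wpDl// ginv_ge0.
  have q : u < dPhi (ginv u + e).
    have [u0|u0] := leP 0 u.
      by rewrite -{1}(dPhi_ginv u0) profile_dlt ?ginv_ge0// ltrDl.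
    by apply: lt_le_trans u0 _; rewrite profile_d_ge0// ltW.
  near=> v; apply: ginv_lt => //; near: v; exact: lt_nbhsl.
have lo : \forall v \near u, ginv u - e < ginv v.
  have [p|p] := ltP (ginv u - e) 0.
    by near=> v; rewrite (lt_le_trans p)// ginv_ge0.
  have u0 : 0 <= u.
    rewrite leNgt; apply/negP => /ltW /ginv_npos g; move: p; rewrite g; lra.
  have q : dPhi (ginv u - e) < u by rewrite -{2}(dPhi_ginv u0) profile_dlt// ltrBlDr ltrDl.
  near=> v; apply: ginv_gt => //; near: v; exact: lt_nbhsr.
near=> v; rewrite ltr_norml; apply/andP; split.
  rewrite ltrBrDl; suff : ginv v < ginv u + e by lra. by near: v.
suff : ginv u - e < ginv v by lra. by near: v.
Unshelve. all: by end_near. Qed.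

(** The Legendre transform of Phi over [0, oo[, whose supremum is attained at [ginv u]. It is the
    pressure as a function of u ([pressure_ginv]). *)
Definition legendre u := u * ginv u - Phi (ginv u).

Lemma legendre_ge u r : 0 <= r -> u * r - Phi r <= legendre u.
Proof.
move=> r0; rewrite /legendre; have [u0|u0] := leP 0 u.
  by have := profile_tangent_le (ginv_ge0 u) r0; rewrite dPhi_ginv//; lra.
rewrite ginv_npos ?(ltW u0)// mulr0 (profile0 H) subr0.
by have := profile_ge0 r0; nra.
Qed.
End theory.

(** The linearization error is controlled by the oscillation of the candidate derivative [a], which
    tends to 0 by continuity. This form suits functions given by monotone or variational bounds: the
    Legendre transform, the radial potential, and the potential and its gradient at the centre. *)
Lemma is_derive_sandwich (f a : R -> R) (x : R) : {for x, continuous a} ->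
  (\forall y \near x, `|f y - f x - (y - x) * a x| <= `|y - x| * `|a y - a x|) ->
  is_derive x 1 f (a x).
Proof.
move=> ca hs.
have cv : (fun h : R => h^-1 *: ((f \o shift x) (h *: (1 : R)) - f x)) @ 0^' --> a x.
  apply/cvgrPdist_le => e e0.
  have /cvgrPdist_le/(_ _ e0) ca' := ca.
  have h0 : \forall h \near (0 : R), `|f (h + x) - f x - (h + x - x) * a x| <= `|h + x - x| * `|a (h + x) - a x|
      /\ `|a x - a (h + x)| <= e.
    have cx : h + x @[h --> (0 : R)] --> x.
      by rewrite -[X in _ --> X]add0r; apply: cvgD; [exact: cvg_id|exact: cvg_cst].
    by near=> h; split; near: h; [exact: (cx _ hs)|exact: (cx _ ca')].
  near=> h.
  have hn : h != 0 by near: h; exact: nbhs_dnbhs_neq.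
  have [h1 h2] : `|f (h + x) - f x - (h + x - x) * a x| <= `|h + x - x| * `|a (h + x) - a x|
      /\ `|a x - a (h + x)| <= e by near: h; exact: nbhs_dnbhs.
  rewrite /= [_%:A]mulr1; rewrite addrK in h1.
  rewrite -(ler_pM2l (x := `|h|)) ?normr_gt0// -normrM.
  apply: (@le_trans _ _ (`|h| * `|a (h + x) - a x|)); last by rewrite ler_pM2l ?normr_gt0// distrC.
  apply: le_trans h1; rewrite -normrN le_eqVlt; apply/orP; left; apply/eqP; congr (`|_|).
  by rewrite /GRing.scale/=; field.
apply: DeriveDef; first exact: cvgP cv.
exact: cvg_lim cv.
Unshelve. all: by end_near. Qed.

(** Envelope argument: testing the supremum at u with the maximizer of v, and conversely, puts the
    linearization error between 0 and (v - u)(ginv v - ginv u). It covers u = 0, where [ginv] may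
    have a kink. *)
Lemma is_derive_legendre Phi dPhi (u : R) : profile Phi dPhi ->
  is_derive u 1 (legendre Phi dPhi) (ginv dPhi u).
Proof.
move=> H; apply: (@is_derive_sandwich _ (ginv dPhi)); first exact: (@continuous_ginv _ _ H).
near=> v.
have h1 := legendre_ge H v (ginv_ge0 H u).
have h2 := legendre_ge H u (ginv_ge0 H v).
have E w : legendre Phi dPhi w = w * ginv dPhi w - Phi (ginv dPhi w) by [].
set A := legendre Phi dPhi v - legendre Phi dPhi u - (v - u) * ginv dPhi u.
have p : 0 <= A by rewrite /A mulrBl; rewrite (E u) in h1 *; lra.
have q : A <= (v - u) * (ginv dPhi v - ginv dPhi u).
  by rewrite /A mulrBr !mulrBl; rewrite (E v) in h2 *; lra.
by rewrite -normrM (ger0_norm p); exact: le_trans q (ler_norm _).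
Unshelve. all: by end_near. Qed.

Lemma measurable_comp_ge0 d (T : measurableType d) (f : R -> R) (g : T -> R) :
  {within `[0, +oo[, continuous f} -> measurable_fun setT g -> (forall x, 0 <= g x) ->
  measurable_fun setT (fun x => f (g x)).
Proof.
move=> cf mg g0.
have mI : measurable (`[0, +oo[%classic : set R) by exact: measurable_itv.
apply: (measurable_comp (F := `[0, +oo[%classic : set R)) => //.
- by move=> _ [x _ <-]; rewrite /= in_itv/= andbT.
- exact: (subspace_continuous_measurable_fun mI cf).
Qed.

Lemma profile_intro Phi dPhi :
  {within `[0, +oo[, continuous Phi} ->
  (fun h : R => h^-1 * (Phi h - Phi 0)) @ 0^'+ --> dPhi 0 ->
  (forall r : R, 0 < r -> is_derive r 1 Phi (dPhi r)) ->
  {within `[0, +oo[, continuous dPhi} ->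
  Phi 0 = 0 -> dPhi 0 = 0 ->
  (forall x y t : R, 0 <= x -> 0 <= y -> x != y -> 0 < t < 1 ->
      Phi (t * x + (1 - t) * y) < t * Phi x + (1 - t) * Phi y) ->
  forall n, 0 < n < 3 ->
  (exists2 C : R, 0 < C & exists r0 : R, forall r : R, r0 <= r -> 0 <= r ->
      C * r `^ (1 + n^-1) <= Phi r) ->
  profile Phi dPhi.
Proof.
move=> cP d0 d cd P0 dP0 cvx n n3 [C C0 [r0 h]].
split => //; first exact: strict_convex_tangent.
exists n, C, (Num.max 1 r0); split => //; first by rewrite lt_max ltr01.
move=> r; rewrite ge_max => /andP[r1 r2]; apply: h => //; exact: le_trans r1.
Qed.

(** s Phi'(s) - Phi(s) is a primitive of s Phi''(s). Since Phi'' may be singular at 0, the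
    nonnegativity of s Phi''(s) is used at the left end. *)
Lemma pressureE Phi dPhi ddPhi r : profile Phi dPhi ->
  (forall r : R, 0 < r -> is_derive r 1 Phi (dPhi r)) ->
  (forall r : R, 0 < r -> is_derive r 1 dPhi (ddPhi r)) ->
  {within `]0, +oo[, continuous ddPhi} ->
  0 <= r -> pressure ddPhi r = r * dPhi r - Phi r.
Proof.
move=> H dP ddP cdd; rewrite le_eqVlt => /orP[/eqP <-|r0].
  by rewrite /pressure set_itv1 Rintegral_set1 (profile0 H) mul0r subrr.
have cd : {in `]0, +oo[%classic, continuous ddPhi}.
  by move: cdd; rewrite continuous_open_subspace//; exact: interval_open.
have dd0 x : 0 < x -> 0 <= ddPhi x.
  move=> x0; have [dv <-] := ddP x x0.
  have cv : (fun h : R => h^-1 *: ((dPhi \o shift x) (h *: (1 : R)) - dPhi x)) @ 0^'+ --> 'D_1 dPhi x.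
    by apply: cvg_dnbhs_at_right; exact: dv.
  apply: (cvgr_to_ge cv); near=> h.
  have h0 : 0 < h by near: h; exact: nbhs_right_gt.
  rewrite /= [_%:A]mulr1; apply: mulr_ge0; first by rewrite invr_ge0 ltW.
  by rewrite subr_ge0; apply: (profile_dle H) (ltW x0) _; rewrite lerDr ltW.
have E : (\int[@lebesgue_measure R]_(s in `[0%R, r]) (s * ddPhi s)%:E =
    ((r * dPhi r - Phi r) - (0 * dPhi 0 - Phi 0))%:E)%E.
  apply: (@integral_itvcc_is_derive_ge0 R _ (fun s => s * dPhi s - Phi s)) => //.
  - by move=> x /andP[x0 _]; rewrite mulr_ge0 ?dd0// ltW.
  - move=> x /andP[x0 _]; have h1 := dP _ x0; have h2 := ddP _ x0.
    by apply: is_derive_eq; rewrite /GRing.scale/= mulr1 addrK.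
  - move=> x /andP[x0 _]; apply: continuousM; first exact: cvg_id.
    by apply: cd; rewrite inE /= in_itv/= x0.
  - have /continuous_within_itvcyP[_ cP] := profile_cont H.
    have /continuous_within_itvcyP[_ cdP] := profile_dcont H.
    apply: cvgB => //; apply: cvgM => //.
    by apply: cvg_at_right_filter; exact: cvg_id.
by rewrite /pressure /Rintegral E /= (profile0 H) mul0r subrr subr0.
Unshelve. all: by end_near. Qed.
End profile.

(** * Variation of the energy *)

Section integration_helpers.
Context d (T : measurableType d) (R : realType) (mu : {measure set T -> \bar R}).

Lemma ge0_integral_lty (f g : T -> R) : measurable_fun setT f -> measurable_fun setT g ->
  (forall x, 0 <= f x <= g x) -> (\int[mu]_x (g x)%:E < +oo)%E -> (\int[mu]_x (f x)%:E < +oo)%E.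
Proof.
move=> mf mg fg; apply: le_lt_trans; apply: ge0_le_integral => //.
- by move=> x _; rewrite lee_fin; have /andP[] := fg x.
- exact/measurable_EFinP.
- exact/measurable_EFinP.
- by move=> x _; rewrite lee_fin; have /andP[] := fg x.
Qed.

Lemma ge0_integralD_EFin (f g : T -> R) : measurable_fun setT f -> measurable_fun setT g ->
  (forall x, 0 <= f x) -> (forall x, 0 <= g x) ->
  (\int[mu]_x (f x + g x)%:E = \int[mu]_x (f x)%:E + \int[mu]_x (g x)%:E)%E.
Proof.
move=> mf mg f0 g0; rewrite -ge0_integralD//.
- by move=> x _; rewrite lee_fin.
- exact/measurable_EFinP.
- by move=> x _; rewrite lee_fin.
- exact/measurable_EFinP.
Qed.

Lemma ge0_integralZl_real (c : R) (f : T -> R) : measurable_fun setT f ->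
  (forall x, 0 <= f x) -> 0 <= c ->
  (\int[mu]_x (c * f x)%:E = c%:E * \int[mu]_x (f x)%:E)%E.
Proof.
move=> mf f0 c0; rewrite -ge0_integralZl//.
- exact/measurable_EFinP.
- by move=> x _; rewrite lee_fin.
Qed.

Lemma integral_indic_scale (a : R) (A : set T) : 0 <= a -> measurable A ->
  (\int[mu]_x (a * \1_A x)%:E = a%:E * mu A)%E.
Proof.
move=> a0 mA; have mI : measurable_fun setT (\1_A : T -> R) by exact: measurable_indic.
have i0 x : 0 <= \1_A x :> R by [].
by rewrite (ge0_integralZl_real mI i0 a0) integral_indic// setIT.
Qed.

Lemma integral_ge0_fin_num (f : T -> R) : (forall x, 0 <= f x) ->
  (\int[mu]_x (f x)%:E < +oo)%E -> (\int[mu]_x (f x)%:E)%E \is a fin_num.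
Proof.
move=> f0 h; rewrite ge0_fin_numE//; apply: integral_ge0 => x _; by rewrite lee_fin.
Qed.
End integration_helpers.

Lemma add_norm_ge0 (R : realDomainType) (c d : R) : 0 <= c + (`|c| + `|d|).
Proof. by rewrite addrA addr_ge0// -lerBlDl sub0r -normrN ler_norm. Qed.

Lemma ltr_double_succ (R : realFieldType) (k : R) : 0 <= k -> k < 2 * (k + 1).
Proof. lra. Qed.

(** The bookkeeping of [mass_transfer]: p0, p1 are internal energies and d0, d1 self-interactions
    before and after; da, db are the interactions of the removed and the added piece with rho0, x
    that of the two pieces with each other, and t is the mass moved. The shift K cancels. *)
Lemma transfer_contradiction (R : realFieldType) (p0 p1 d0 d1 da db x t c d K : R) :
  p0 - 2^-1 * d0 <= p1 - 2^-1 * d1 -> 2 * (db - da) <= d1 - d0 + 2 * x ->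
  p1 + da + ((d + K) * t + K * t) <= p0 + db + (K * t + (c + K) * t) -> x < t * (d - c) -> False.
Proof. lra. Qed.

Section minimizer.
Variable R : realType.
Local Notation T1 := (measurableTypeR R).
Local Notation T2 := (T1 * T1)%type.
Local Notation T3 := (T2 * T1)%type.
Local Notation mu3 := (@mu3 R).
Implicit Types rho sigma : T3 -> R.

Lemma L43_le (f g : T3 -> R) : L43 g -> measurable_fun setT f -> (forall x, 0 <= f x <= g x) -> L43 f.
Proof.
move=> [mg g0 g1 g4] mf fg.
have f0 x : 0 <= f x by have /andP[] := fg x.
split; [exact: mf|exact: f0|exact: (ge0_integral_lty mf mg fg g1)|].
apply: ge0_integral_lty g4; [by meas|by meas|] => x.
rewrite powR_ge0/=; have /andP[h1 h2] := fg x.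
by apply: ge0_ler_powR => //; rewrite nnegrE.
Qed.

Lemma L43_indic (a : R) (A : set T3) : 0 <= a -> measurable A -> (mu3 A < +oo)%E ->
  L43 (fun x => a * \1_A x).
Proof.
move=> a0 mA Afin; have mI : measurable_fun setT (\1_A : T3 -> R) by exact: measurable_indic.
split.
- by apply: measurable_funM.
- by move=> x; rewrite mulr_ge0.
- by rewrite integral_indic_scale// lte_mul_pinfty// lee_fin.
- rewrite (_ : (\int[mu3]_x _) = \int[mu3]_x (a `^ (4 / 3) * \1_A x)%:E)%E.
    by rewrite integral_indic_scale ?powR_ge0// lte_mul_pinfty// lee_fin powR_ge0.
  apply: eq_integral => x _; rewrite indicE; case: (x \in A); first by rewrite !mulr1.
  by rewrite !mulr0 powR0// mulf_neq0// invr_neq0.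
Qed.

Lemma mutual_fineK (f g : T3 -> R) : L43 f -> L43 g -> mutual f g = (fine (mutual f g))%:E.
Proof.
move=> Lf Lg; have [_ f0 _ _] := Lf; have [_ g0 _ _] := Lg.
by rewrite fineK// ge0_fin_numE ?mutual_fin// mutual_ge0.
Qed.

Lemma fine_mutualC (f g : T3 -> R) : L43 f -> L43 g -> fine (mutual f g) = fine (mutual g f).
Proof. by move=> [mf f0 _ _] [mg g0 _ _]; congr fine; exact: mutualC. Qed.

Lemma fine_mutualDl (e f g : T3 -> R) : L43 e -> L43 f -> L43 g ->
  fine (mutual (fun x => f x + g x) e) = fine (mutual f e) + fine (mutual g e).
Proof.
move=> Le Lf Lg; have [me e0 _ _] := Le; have [mf f0 _ _] := Lf; have [mg g0 _ _] := Lg.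
have E := mutualDl me mf mg e0 f0 g0.
by apply: (etrans (f_equal fine E)); rewrite (mutual_fineK Lf Le) (mutual_fineK Lg Le).
Qed.

Lemma fine_mutualDr (e f g : T3 -> R) : L43 e -> L43 f -> L43 g ->
  fine (mutual e (fun x => f x + g x)) = fine (mutual e f) + fine (mutual e g).
Proof.
move=> Le Lf Lg; have [me e0 _ _] := Le; have [mf f0 _ _] := Lf; have [mg g0 _ _] := Lg.
have E := mutualDr me mf mg e0 f0 g0.
by apply: (etrans (f_equal fine E)); rewrite (mutual_fineK Le Lf) (mutual_fineK Le Lg).
Qed.

(* The interaction of rho0 with be - al, up to terms quadratic in al and be, in terms of energies. *)
Lemma mutual_exchange (r0 r1 al be si : T3 -> R) : L43 r0 -> L43 r1 -> L43 al -> L43 be -> L43 si ->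
  r0 = (fun x => r1 x + al x) -> si = (fun x => r1 x + be x) ->
  2 * (fine (mutual be r0) - fine (mutual al r0)) <=
  fine (mutual si si) - fine (mutual r0 r0) + 2 * fine (mutual al be).
Proof.
move=> L0 L1 La Lb Ls E0 Es.
have ss : fine (mutual si si) = fine (mutual r1 r1) + 2 * fine (mutual r1 be) + fine (mutual be be).
  have -> := etrans (f_equal (fun f => fine (mutual f si)) Es) (fine_mutualDl Ls L1 Lb).
  have -> := etrans (f_equal (fun f => fine (mutual r1 f)) Es) (fine_mutualDr L1 L1 Lb).
  have -> := etrans (f_equal (fun f => fine (mutual be f)) Es) (fine_mutualDr Lb L1 Lb).
  by rewrite (fine_mutualC Lb L1); ring.
have ar : fine (mutual al r0) = fine (mutual r1 al) + fine (mutual al al).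
  have -> := etrans (f_equal (fun f => fine (mutual al f)) E0) (fine_mutualDr La L1 La).
  by rewrite (fine_mutualC La L1).
have br : fine (mutual be r0) = fine (mutual r1 be) + fine (mutual al be).
  have -> := etrans (f_equal (fun f => fine (mutual be f)) E0) (fine_mutualDr Lb L1 La).
  by rewrite (fine_mutualC Lb L1) (fine_mutualC Lb La).
have rr : fine (mutual r0 r0) = fine (mutual r1 r1) + 2 * fine (mutual r1 al) + fine (mutual al al).
  have -> := etrans (f_equal (fun f => fine (mutual f r0)) E0) (fine_mutualDl L0 L1 La).
  have -> := etrans (f_equal (fun f => fine (mutual r1 f)) E0) (fine_mutualDr L1 L1 La).
  by rewrite ar; ring.
have [_ a0 _ _] := La; have [_ b0 _ _] := Lb.
have aa : 0 <= fine (mutual al al) by rewrite fine_ge0// mutual_ge0.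
have bb : 0 <= fine (mutual be be) by rewrite fine_ge0// mutual_ge0.
rewrite ss rr ar br; lra.
Qed.

Section FM.
Variables (Phi dPhi : R -> R) (H : profile Phi dPhi) (M : R).

Lemma measurable_Phi_comp rho : measurable_fun setT rho -> (forall x, 0 <= rho x) ->
  measurable_fun setT (fun x => Phi (rho x)).
Proof. exact: measurable_comp_ge0 (profile_cont H). Qed.

Lemma FMP rho : FM Phi M rho -> [/\ measurable_fun setT (rho : T3 -> R), forall x, 0 <= rho x,
  (\int[mu3]_x (Phi (rho x))%:E < +oo)%E & (\int[mu3]_x (rho x)%:E = M%:E)%E].
Proof.
move=> [/integrableP[ri _] [r0 [rp rM]]]; split; [|exact: r0|exact: rp|exact: rM].
by move/measurable_EFinP: ri.
Qed.

Lemma FM_intro rho : measurable_fun setT rho -> (forall x, 0 <= rho x) ->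
  (\int[mu3]_x (Phi (rho x))%:E < +oo)%E -> (\int[mu3]_x (rho x)%:E = M%:E)%E ->
  FM Phi M rho.
Proof.
move=> mr r0 rp rM; split => //; apply/integrableP; split; first exact/measurable_EFinP.
rewrite leb3E; under eq_integral do rewrite gee0_abs ?lee_fin//.
by rewrite rM ltry.
Qed.

(** Values of rho up to [s] are controlled by the mass, as rho^(4/3) <= s^(1/3) rho; larger ones by
    Phi, as 4/3 <= 1 + 1/n for n < 3. *)
Lemma FM_L43 rho : FM Phi M rho -> L43 rho.
Proof.
move=> /FMP[mr r0 rp rM]; split => //; first by rewrite rM ltry.
have [n [C [s0 [/andP[n0 n3] C0 s00 h]]]] := profile_growth H.
pose s := Num.max 1 s0.
have mP := measurable_Phi_comp mr r0.
apply: (@ge0_integral_lty _ _ _ mu3 _ (fun x => s `^ 3^-1 * rho x + C^-1 * Phi (rho x))).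
- by meas.
- by apply: measurable_funD; apply: measurable_funM.
- move=> x; rewrite powR_ge0/=.
  have p0 := profile_ge0 H (r0 x).
  have c0 : 0 <= C^-1 by rewrite invr_ge0 ltW.
  have [xs|xs] := leP (rho x) s.
    apply: (@le_trans _ _ (s `^ 3^-1 * rho x)); last by rewrite lerDl mulr_ge0.
    have [->|xn] := eqVneq (rho x) 0; first by rewrite mulr0 powR0.
    have xp : 0 < rho x by rewrite lt_neqAle eq_sym xn r0.
    rewrite (_ : 4 / 3 = 3^-1 + 1); last by field.
    rewrite powRD ?(gt_eqF xp) ?implybT// powRr1//.
    by rewrite ler_pM2r//; apply: ge0_ler_powR => //; rewrite nnegrE ?powR_ge0// le_max ler01.
  have x1 : 1 <= rho x by rewrite (le_trans _ (ltW xs))// le_max lexx.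
  apply: (@le_trans _ _ (C^-1 * Phi (rho x))); last by rewrite lerDr mulr_ge0 ?powR_ge0.
  rewrite ler_pdivlMl//; apply: le_trans (h _ _); last by rewrite (le_trans _ (ltW xs))// le_max lexx orbT.
  rewrite ler_pM2l//; apply: ler_powR => //.
  have : 3^-1 <= n^-1 by rewrite lef_pV2 ?posrE// ltW.
  by move=> ?; rewrite (_ : 4 / 3 = 1 + 3^-1); [rewrite lerD2l|field].
rewrite ge0_integralD_EFin; last first.
- by move=> x; rewrite mulr_ge0 ?invr_ge0 ?(ltW C0)// (profile_ge0 H).
- by move=> x; rewrite mulr_ge0 ?powR_ge0.
- exact: measurable_funM.
- exact: measurable_funM.
have P0 x : 0 <= Phi (rho x) by exact: (profile_ge0 H).
rewrite ge0_integralZl_real ?powR_ge0// ge0_integralZl_real// ?invr_ge0 ?(ltW C0)//.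
rewrite rM lte_add_pinfty// ?ltry// lte_mul_pinfty// lee_fin invr_ge0 ltW//.
Qed.

(** On F_M both parts of the energy are finite, by definition and by [mutual_fin], so minimality
    becomes an inequality between real numbers. *)
Lemma minimizer_le rho0 sigma : is_minimizer Phi M rho0 -> FM Phi M sigma ->
  fine (\int[mu3]_x (Phi (rho0 x))%:E)%E - 2^-1 * fine (mutual rho0 rho0) <=
  fine (\int[mu3]_x (Phi (sigma x))%:E)%E - 2^-1 * fine (mutual sigma sigma).
Proof.
move=> [Frho Hrho] Fs.
have E rho : FM Phi M rho -> Hr Phi rho =
    (fine (\int[mu3]_x (Phi (rho x))%:E)%E - 2^-1 * fine (mutual rho rho))%:E.
  move=> Fr; have Lr := FM_L43 Fr; have [mr r0 rp rM] := FMP Fr.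
  rewrite EFinB EFinM fineK; last first.
    by apply: integral_ge0_fin_num => // x; exact: (profile_ge0 H).
  rewrite fineK; last by rewrite ge0_fin_numE ?mutual_fin// mutual_ge0.
  by rewrite /Hr /Epot mutualEint -mulNe.
have e0 := E _ Frho; have e1 := E _ Fs.
have : (Hr Phi rho0 <= Hr Phi sigma)%E.
  by rewrite Hrho; apply: ereal_inf_lbound; exists sigma.
by rewrite e0 e1 lee_fin.
Qed.

Section euler_lagrange.
Variables (rho0 : T3 -> R) (minrho : is_minimizer Phi M rho0).
Let v := pot rho0.
Let Frho : FM Phi M rho0. Proof. by case: minrho. Qed.
Let mrho : measurable_fun setT rho0. Proof. by have [] := FMP Frho. Qed.
Let rho_ge0 x : 0 <= rho0 x. Proof. by have [] := FMP Frho. Qed.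
Let mv : measurable_fun setT v. Proof. exact: measurable_pot. Qed.
Let v_ge0 x : (0 <= v x)%E. Proof. exact: pot_ge0. Qed.
Let Lrho : L43 rho0. Proof. exact: FM_L43. Qed.

(* Moving mass tau from A to B changes the energy by at most (c - d) tau + O(tau^2). *)
Lemma mass_transfer (A B : set T3) (s c d : R) : 0 < s -> c < d ->
  measurable A -> measurable B -> (0 < mu3 A < +oo)%E -> (0 < mu3 B < +oo)%E ->
  (forall x, A x -> s <= rho0 x /\ (v x + d%:E <= (dPhi (rho0 x - s))%:E)%E) ->
  (forall x, B x -> ((dPhi (rho0 x + s))%:E <= v x + c%:E)%E) -> False.
Proof.
move=> s0 cd mA mB /andP[A0 Ai] /andP[B0 Bi] hA hB.
have mIA : measurable_fun setT (\1_A : T3 -> R) by exact: measurable_indic.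
have mIB : measurable_fun setT (\1_B : T3 -> R) by exact: measurable_indic.
have iA0 x : 0 <= \1_A x :> R by [].
have iB0 x : 0 <= \1_B x :> R by [].
pose fA := fine (mu3 A); pose fB := fine (mu3 B).
have fAE : mu3 A = fA%:E by rewrite fineK// ge0_fin_numE.
have fBE : mu3 B = fB%:E by rewrite fineK// ge0_fin_numE.
have fA0 : 0 < fA by rewrite -lte_fin -fAE.
have fB0 : 0 < fB by rewrite -lte_fin -fBE.
have LA1 : L43 (\1_A : T3 -> R).
  have := L43_indic ler01 mA Ai; congr L43; by apply/funext => x; rewrite mul1r.
have LB1 : L43 (\1_B : T3 -> R).
  have := L43_indic ler01 mB Bi; congr L43; by apply/funext => x; rewrite mul1r.
(* The interaction of two unit masses spread evenly over A and B; the quadratic error will be tau^2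
   k. *)
pose k := fine (mutual (\1_A) (\1_B)) / (fA * fB).
have k0 : 0 <= k by rewrite divr_ge0 ?fine_ge0 ?mutual_ge0// mulr_ge0// ltW.
(* Small enough that neither density changes by more than s and that tau k < d - c. *)
pose tau := Num.min (Num.min (s * fA) (s * fB)) ((d - c) / (2 * (k + 1))).
have k1 : 0 < 2 * (k + 1) by lra.
have tau0 : 0 < tau by rewrite !lt_min (mulr_gt0 s0 fA0) (mulr_gt0 s0 fB0)/= divr_gt0 ?subr_gt0.
have tauA : tau / fA <= s by rewrite ler_pdivrMr// !ge_min lexx.
have tauB : tau / fB <= s by rewrite ler_pdivrMr// !ge_min lexx orbT.
have tauk : tau * (2 * (k + 1)) <= d - c by rewrite -ler_pdivlMr// !ge_min lexx orbT.
pose a := tau / fA; pose b := tau / fB.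
have a0 : 0 < a by exact: divr_gt0.
have b0 : 0 < b by exact: divr_gt0.
pose al (x : T3) := a * \1_A x; pose be (x : T3) := b * \1_B x.
have mal : measurable_fun setT al by apply: measurable_funM.
have mbe : measurable_fun setT be by apply: measurable_funM.
have al0 x : 0 <= al x by rewrite mulr_ge0// ltW.
have be0 x : 0 <= be x by rewrite mulr_ge0// ltW.
have Lal : L43 al by exact: L43_indic (ltW a0) mA Ai.
have Lbe : L43 be by exact: L43_indic (ltW b0) mB Bi.
have ial : (\int[mu3]_x (al x)%:E = tau%:E)%E.
  apply: (etrans (integral_indic_scale mu3 (ltW a0) mA)).
  by rewrite [X in (_ * X)%E]fAE -EFinM divfK// gt_eqF.
have ibe : (\int[mu3]_x (be x)%:E = tau%:E)%E.
  apply: (etrans (integral_indic_scale mu3 (ltW b0) mB)).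
  by rewrite [X in (_ * X)%E]fBE -EFinM divfK// gt_eqF.
pose r1 (x : T3) := rho0 x - al x.
have r10 x : 0 <= r1 x.
  rewrite subr_ge0 /al indicE; case: (boolP (x \in A)) => xA; last by rewrite mulr0.
  rewrite mulr1; have [h _] := hA x (set_mem xA); exact: le_trans tauA h.
have mr1 : measurable_fun setT r1 by exact: measurable_funB.
have rhoE x : rho0 x = r1 x + al x by rewrite subrK.
have Lr1 : L43 r1.
  by apply: (L43_le Lrho mr1) => x; rewrite r10 /r1 gerBl al0.
pose si (x : T3) := r1 x + be x.
have msi : measurable_fun setT si by exact: measurable_funD.
have si0 x : 0 <= si x by rewrite addr_ge0.
have disj x : A x -> B x -> False.
  move=> /hA[h1 h2] /hB h3.
  have h4 : dPhi (rho0 x - s) <= dPhi (rho0 x + s).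
    by apply: (profile_dle H); rewrite ?subr_ge0// lerD2l (le_trans _ (ltW s0))// oppr_le0 ltW.
  have vf : v x \is a fin_num.
    by rewrite ge0_fin_numE// ltey; apply/eqP => e; move: h2; rewrite e addye// leye_eq.
  move: h2 h3; rewrite -(fineK vf) -!EFinD !lee_fin => h2 h3.
  have h5 : fine (v x) + c < fine (v x) + d by rewrite ltrD2l.
  by have := lt_le_trans (le_lt_trans (le_trans h4 h3) h5) h2; rewrite ltxx.
(* A shift that makes c + K and d + K nonnegative, so that only nonnegative functions are
   integrated; it cancels because [al] and [be] have the same mass. *)
pose K := `|c| + `|d|.
have cK : 0 <= c + K by exact: add_norm_ge0.
have dK : 0 <= d + K by rewrite /K [`|c| + _]addrC; exact: add_norm_ge0.
have K0 : 0 <= K by rewrite addr_ge0.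
(* The tangent of Phi at the new density [si x] bounds Phi (si x) - Phi (rho0 x). Terms are moved
   across so that v, which may be infinite on B, is never subtracted. *)
have pointwise x : ((Phi (si x))%:E + (al x)%:E * v x + ((d + K) * al x + K * be x)%:E <=
    (Phi (rho0 x))%:E + (be x)%:E * v x + ((c + K) * be x + K * al x)%:E)%E.
  have [xA|xA] := boolP (x \in A).
    have alx : al x = a by rewrite /al indicE xA mulr1.
    have bex : be x = 0.
      by rewrite /be indicE; case: (boolP (x \in B)) => [/set_mem/(disj x (set_mem xA))//|_]; rewrite mulr0.
    have [h1 h2] := hA x (set_mem xA).
    have vf : v x \is a fin_num.
      by rewrite ge0_fin_numE// ltey; apply/eqP => e; move: h2; rewrite e addye// leye_eq.
    rewrite /si bex /r1 alx addr0 mul0e adde0 !mulr0 addr0 add0r.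
    move: h2; rewrite -(fineK vf) -EFinD -EFinM -!EFinD !lee_fin => h2.
    have as' : a <= s := tauA.
    have h3 : 0 <= rho0 x - a by rewrite subr_ge0 (le_trans as').
    have h4 := profile_tangent_le H h3 (rho_ge0 x).
    have h5 : dPhi (rho0 x - s) <= dPhi (rho0 x - a).
      by apply: (profile_dle H); rewrite ?subr_ge0// lerD2l lerN2.
    have h6 : a * (fine (v x) + d) <= a * dPhi (rho0 x - a).
      by rewrite ler_pM2l// (le_trans h2 h5).
    move: h4 h6; rewrite opprB addrCA subrr addr0; lra.
  have alx : al x = 0 by rewrite /al indicE (negbTE xA) mulr0.
  rewrite /si /r1 alx subr0 mul0e adde0 !mulr0 addr0 add0r.
  have [xB|xB] := boolP (x \in B); last first.
    have -> : be x = 0 by rewrite /be indicE (negbTE xB) mulr0.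
    by rewrite mul0e addr0 adde0 !mulr0.
  have -> : be x = b by rewrite /be indicE xB mulr1.
  have h2 := hB x (set_mem xB).
  have [vy|vy] := eqVneq (v x) +oo%E.
    by rewrite vy gt0_muley// addey// addye// leey.
  have vf : v x \is a fin_num by rewrite ge0_fin_numE// ltey.
  move: h2; rewrite -(fineK vf) -EFinM -!EFinD !lee_fin => h2.
  have bs : b <= s := tauB.
  have h3 : 0 <= rho0 x + b by rewrite addr_ge0// ltW.
  have h4 := profile_tangent_le H h3 (rho_ge0 x).
  have h5 : dPhi (rho0 x + b) <= dPhi (rho0 x + s) by apply: (profile_dle H) h3 _; rewrite lerD2l.
  have h6 : b * dPhi (rho0 x + b) <= b * (fine (v x) + c).
    by rewrite ler_pM2l// (le_trans h5 h2).
  move: h4 h6; rewrite opprD addrA subrr add0r; lra.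
have mPsi : measurable_fun setT (fun x => Phi (si x)) by exact: measurable_Phi_comp.
have mPrho : measurable_fun setT (fun x => Phi (rho0 x)) by exact: measurable_Phi_comp.
have Psi0 x : 0 <= Phi (si x) by exact: (profile_ge0 H).
have Prho0 x : 0 <= Phi (rho0 x) by exact: (profile_ge0 H).
have intE (f g h : T3 -> R) : measurable_fun setT f -> measurable_fun setT g -> measurable_fun setT h ->
    (forall x, 0 <= f x) -> (forall x, 0 <= g x) -> (forall x, 0 <= h x) ->
    (\int[mu3]_x ((f x)%:E + (g x)%:E * v x + (h x)%:E) =
     \int[mu3]_x (f x)%:E + mutual g rho0 + \int[mu3]_x (h x)%:E)%E.
  move=> mf mg mh f0 g0 h0; rewrite (mutualE mrho g0 rho_ge0).
  have mgv : measurable_fun setT (fun x => ((g x)%:E * v x)%E).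
    by apply: emeasurable_funM => //; exact/measurable_EFinP.
  have gv0 x : (0 <= (g x)%:E * v x)%E by rewrite mule_ge0// lee_fin.
  have mEf : measurable_fun setT (fun x => (f x)%:E) by exact/measurable_EFinP.
  have mEh : measurable_fun setT (fun x => (h x)%:E) by exact/measurable_EFinP.
  rewrite ge0_integralD//; last 3 first.
  - by move=> x _; rewrite adde_ge0// lee_fin.
  - exact: emeasurable_funD.
  - by move=> x _; rewrite lee_fin.
  by congr (_ + _)%E; rewrite ge0_integralD// => x _; rewrite lee_fin.
have intlin p q : 0 <= p -> 0 <= q -> (\int[mu3]_x (p * al x + q * be x)%:E = (p * tau + q * tau)%:E)%E.
  move=> p0 q0; rewrite (@ge0_integralD_EFin _ _ _ mu3 (fun x => p * al x) (fun x => q * be x)).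
  - rewrite EFinD (ge0_integralZl_real mu3 mal al0 p0) (ge0_integralZl_real mu3 mbe be0 q0).
    by rewrite ial ibe -!EFinM.
  - exact: measurable_funM.
  - exact: measurable_funM.
  - by move=> x; rewrite mulr_ge0.
  - by move=> x; rewrite mulr_ge0.
have mlin p q : measurable_fun setT (fun x => p * al x + q * be x).
  by apply: measurable_funD; exact: measurable_funM.
have step : (\int[mu3]_x (Phi (si x))%:E + mutual al rho0 + ((d + K) * tau + K * tau)%:E <=
    \int[mu3]_x (Phi (rho0 x))%:E + mutual be rho0 + (K * tau + (c + K) * tau)%:E)%E.
  rewrite -(intlin _ _ dK K0) -(intlin _ _ K0 cK).
  have l0 p q : 0 <= p -> 0 <= q -> forall x, 0 <= p * al x + q * be x.
    by move=> p0 q0 x; rewrite addr_ge0// mulr_ge0.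
  have eL := intE _ _ _ mPsi mal (mlin (d + K) K) Psi0 al0 (l0 _ _ dK K0).
  have eR := intE _ _ _ mPrho mbe (mlin K (c + K)) Prho0 be0 (l0 _ _ K0 cK).
  apply: (eq_ind _ (fun z => z <= _)%E _ _ eL); apply: (eq_ind _ (fun z => _ <= z)%E _ _ eR).
  have mside (f g h : T3 -> R) : measurable_fun setT f -> measurable_fun setT g -> measurable_fun setT h ->
      measurable_fun setT (fun x => (f x)%:E + (g x)%:E * v x + (h x)%:E)%E.
    move=> mf mg mh; apply: emeasurable_funD; last exact/measurable_EFinP.
    apply: emeasurable_funD; first exact/measurable_EFinP.
    by apply: emeasurable_funM => //; exact/measurable_EFinP.
  apply: ge0_le_integral.
  - by [].
  - move=> x _; rewrite !adde_ge0 ?mule_ge0 ?lee_fin ?Psi0 ?al0 ?v_ge0//; exact: l0.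
  - exact: mside.
  - exact: mside.
  - by move=> x _; apply: (le_trans (pointwise x)); rewrite [(c + K) * _ + _]addrC.
have rho0E : rho0 = (fun x => r1 x + al x) by apply/funext => x.
have Ear := mutual_fineK Lal Lrho.
have Ebr := mutual_fineK Lbe Lrho.
have [_ _ Prfin rM] := FMP Frho.
have Prf : (\int[mu3]_x (Phi (rho0 x))%:E)%E = (fine (\int[mu3]_x (Phi (rho0 x))%:E)%E)%:E.
  by rewrite fineK// integral_ge0_fin_num.
(* That the competitor has finite internal energy is read off from [step], whose right-hand side is
   finite. *)
have Psfin : (\int[mu3]_x (Phi (si x))%:E < +oo)%E.
  move: step; rewrite Ear Ebr Prf -!EFinD => h.
  rewrite ltey; apply/eqP => e; move: h; rewrite e; rewrite !addye//= leye_eq//.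
have Psf : (\int[mu3]_x (Phi (si x))%:E)%E = (fine (\int[mu3]_x (Phi (si x))%:E)%E)%:E.
  by rewrite fineK// integral_ge0_fin_num.
have Fs : FM Phi M si.
  apply: FM_intro => //; rewrite (ge0_integralD_EFin mu3 mr1 mbe r10 be0) ibe -ial.
  rewrite -(ge0_integralD_EFin mu3 mr1 mal r10 al0) -rM.
  by apply: eq_integral => x _; rewrite -rhoE.
have Ls := FM_L43 Fs.
have min := minimizer_le minrho Fs.
have exch := mutual_exchange Lrho Lr1 Lal Lbe Ls rho0E erefl.
have step' : fine (\int[mu3]_x (Phi (si x))%:E)%E + fine (mutual al rho0) + ((d + K) * tau + K * tau) <=
    fine (\int[mu3]_x (Phi (rho0 x))%:E)%E + fine (mutual be rho0) + (K * tau + (c + K) * tau).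
  by move: step; rewrite Ear Ebr Prf Psf -!EFinD lee_fin.
have Dabk : fine (mutual al be) = tau * (tau * k).
  apply: (etrans (f_equal fine (mutualZ mIA mIB iA0 iB0 (ltW a0) (ltW b0)))).
  rewrite (mutual_fineK LA1 LB1) -EFinM /=.
  by rewrite /a /b /k; field; rewrite !gt_eqF.
have : tau * (tau * k) < tau * (d - c).
  rewrite ltr_pM2l//; apply: lt_le_trans tauk.
  by rewrite ltr_pM2l//; exact: ltr_double_succ.
by rewrite -Dabk; exact: (transfer_contradiction min exch step').
Qed.

End euler_lagrange.
End FM.
End minimizer.

Section measurable_order_sets.
Context d (T : measurableType d) (R : realType) (f g : T -> \bar R).
Hypotheses (mf : measurable_fun setT f) (mg : measurable_fun setT g).

Lemma measurable_set_lte : measurable [set x | (f x < g x)%E].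
Proof. by rewrite -[X in measurable X]setTI; apply: measurable_lte. Qed.

Lemma measurable_set_lee : measurable [set x | (f x <= g x)%E].
Proof. by rewrite -[X in measurable X]setTI; apply: measurable_lee. Qed.
End measurable_order_sets.

(** * The Euler-Lagrange relation *)

Section euler_lagrange.
Variable R : realType.
Local Notation T1 := (measurableTypeR R).
Local Notation T2 := (T1 * T1)%type.
Local Notation T3 := (T2 * T1)%type.
Local Notation mu3 := (@mu3 R).
Variables (Phi dPhi : R -> R) (H : profile Phi dPhi) (M : R).
Variables (rho0 : T3 -> R) (minrho : is_minimizer Phi M rho0).
Let v := pot rho0.
Let Frho : FM Phi M rho0. Proof. by case: minrho. Qed.
Let mrho : measurable_fun setT rho0. Proof. by have [] := FMP Frho. Qed.
Let rho_ge0 x : 0 <= rho0 x. Proof. by have [] := FMP Frho. Qed.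
Let mv : measurable_fun (setT : set T3) v. Proof. exact: measurable_pot. Qed.
Let v_ge0 x : (0 <= v x)%E. Proof. exact: pot_ge0. Qed.
Let Lrho : L43 rho0. Proof. exact: (FM_L43 H Frho). Qed.

(** The interaction of rho0 with the indicator of a set of finite measure is finite, so v is
    integrable on that set. *)
Lemma pot_finite_ae : {ae mu3, forall x, v x \is a fin_num}.
Proof.
have /sigma_finiteP[F [TF ndF Foo]] := sigma_finiteT mu3.
suff h k : {ae mu3, forall x, F k x -> v x \is a fin_num}.
  apply: filterS (ae_foralln h) => x hx.
  have : (\bigcup_i F i) x by rewrite -TF.
  by move=> [k _]; exact: hx.
have [mF Ff] := Foo k.
apply: integrable_ae => //; apply/integrableP; split; first exact: measurable_funTS.
have LF := L43_indic ler01 mF Ff.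
apply: le_lt_trans (mutual_fin LF Lrho); rewrite mutualE//.
rewrite [leLHS]integral_mkcond; apply: ge0_le_integral => //.
- by move=> x _; apply: erestrict_ge0 => y _; exact: abse_ge0.
- by apply/(measurable_restrictT _ mF)/measurable_funTS/measurableT_comp.
- by apply: emeasurable_funM => //; apply/measurable_EFinP; have [] := LF.
- move=> x _; rewrite /patch /= indicE mul1r; case: ifP => xF; last by rewrite mul0e.
  by rewrite mul1e gee0_abs.
Qed.

(* below c and above d are the level sets of h = dPhi rho0 - v, written without subtraction. *)
Let below c := [set x : T3 | ((dPhi (rho0 x))%:E < v x + c%:E)%E].
Let above d := [set x : T3 | 0 < rho0 x /\ (v x + d%:E < (dPhi (rho0 x))%:E)%E].

Let mdrho : measurable_fun setT (fun x => (dPhi (rho0 x))%:E).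
Proof. by apply/measurable_EFinP; exact: (measurable_comp_ge0 (profile_dcont H)). Qed.

Let mvc c : measurable_fun (setT : set T3) (fun x => (v x + c%:E)%E).
Proof. by apply: emeasurable_funD => //; exact: measurable_cst. Qed.

Let measurable_below c : measurable (below c).
Proof. exact: (measurable_set_lte mdrho (mvc c)). Qed.

Let measurable_above d : measurable (above d).
Proof.
have -> : above d = [set x | 0 < rho0 x] `&` [set x | (v x + d%:E < (dPhi (rho0 x))%:E)%E].
  by [].
apply: measurableI; last exact: (measurable_set_lte (mvc d) mdrho).
have m1 : measurable_fun setT (fun x => (rho0 x)%:E) by exact/measurable_EFinP.
exact: (measurable_set_lte (measurable_cst 0%E) m1).
Qed.

Let aeS2 (P Q S : T3 -> Prop) : {ae mu3, forall x, P x} -> {ae mu3, forall x, Q x} ->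
  (forall x, P x -> Q x -> S x) -> {ae mu3, forall x, S x}.
Proof.
move=> hP hQ h; have F := ae_filter_ringOfSetsType mu3.
exact: (@filterS2 _ _ F P Q S h hP hQ).
Qed.

Let pos_piece (E : set T3) (G : nat -> set T3) : measurable E -> (forall k, measurable (G k)) ->
  E `<=` \bigcup_k G k -> mu3 E != 0 -> exists k, mu3 (G k) != 0.
Proof.
move=> mE mG EG /eqP E0; apply: contrapT => h; apply: E0.
apply/(negligibleP mu3 mE); apply: negligibleS EG _; apply: negligible_bigcup => k.
by apply/(negligibleP mu3 (mG k))/eqP; apply: contra_notT h => hk; exists k.
Qed.

(** If neither set were null, both would contain sets of positive finite measure on which the strict
    inequalities hold with a uniform margin in the density, and [mass_transfer] would apply to
    these. *)
Let level_dichotomy c d : c < d -> mu3 (below c) = 0 \/ mu3 (above d) = 0.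
Proof.
move=> cd; apply: contrapT => /not_orP[/eqP Bc /eqP Ad].
have /sigma_finiteP[F [TF ndF Foo]] := sigma_finiteT mu3.
pose s (k : nat) : R := k.+1%:R^-1.
have s0 k : 0 < s k by rewrite invr_gt0.
have mEF (f : T3 -> R) : measurable_fun setT f -> measurable_fun setT (fun x => (f x)%:E).
  by move=> mf; exact/measurable_EFinP.
have mle (f g : T3 -> \bar R) := @measurable_set_lee _ T3 R f g.
have mmax a : measurable_fun setT (fun x => (dPhi (Num.max 0 (rho0 x + a)))%:E).
  apply: mEF; apply: (measurable_comp_ge0 (profile_dcont H)); first by meas.
  by move=> x; rewrite le_max lexx.
(* The versions of [above d] and [below c] with room t in the density. The maximum with 0 keeps the
   argument of [dPhi] in its domain, also where the first condition of [GA] fails. *)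
pose GA t := [set x : T3 | ((t)%:E <= (rho0 x)%:E)%E] `&`
  [set x | (v x + d%:E <= (dPhi (Num.max 0 (rho0 x + - t)))%:E)%E].
pose GB t := [set x : T3 | ((dPhi (Num.max 0 (rho0 x + t)))%:E <= v x + c%:E)%E].
have mGA t : measurable (GA t).
  apply: measurableI; last exact: (mle _ _ (mvc d) (mmax (- t))).
  exact: (mle _ _ (measurable_cst t%:E) (mEF _ mrho)).
have mGB t : measurable (GB t) by exact: (mle _ _ (mmax t) (mvc c)).
have nat_lt (e : R) : 0 < e -> exists k, s k <= e.
  move=> e0; exists (Num.truncn e^-1); rewrite /s invf_ple ?posrE// ltW//.
  by rewrite -truncn_lt_nat ?invr_ge0 ?ltW.
have Fcov x (P : nat -> Prop) : (exists k, forall j, (k <= j)%N -> P j) -> exists2 k, P k & F k x.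
  move=> [k hk]; have : (\bigcup_i F i) x by rewrite -TF.
  move=> [j _ Fj]; exists (maxn k j); first by apply: hk; exact: leq_maxl.
  by move: x Fj; exact/subsetPset/ndF/leq_maxr.
have s_le k j : (k <= j)%N -> s j <= s k by move=> kj; rewrite /s lef_pV2 ?posrE// ler_nat.
have [kA hkA] : exists k, mu3 (GA (s k) `&` F k) != 0.
  apply: (pos_piece (measurable_above d)) => //; first by move=> k; apply: measurableI => //; have [] := Foo k.
  move=> x [r0 hx].
  have vf : v x \is a fin_num.
    by rewrite ge0_fin_numE// ltey; apply/eqP => e; move: hx; rewrite e addye.
  have u : ginv dPhi (fine (v x) + d) < rho0 x.
    by apply: (ginv_lt H) => //; move: hx; rewrite -{1}(fineK vf) -EFinD lte_fin.
  have [k hk] : exists k, s k <= rho0 x - ginv dPhi (fine (v x) + d).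
    by apply: nat_lt; rewrite subr_gt0.
  have [|j hj Fj] := Fcov x (fun j => GA (s j) x).
    exists k => j kj; have sj := le_trans (s_le _ _ kj) hk.
    have g0 := ginv_ge0 H (fine (v x) + d).
    have sr : s j <= rho0 x by apply: (le_trans sj); rewrite gerBl.
    split; rewrite /= ?lee_fin// max_r ?subr_ge0// -{1}(fineK vf) -EFinD lee_fin.
    have : ginv dPhi (fine (v x) + d) <= rho0 x - s j by rewrite lerBrDr -lerBrDl.
    move=> /(profile_dle H g0); apply: le_trans.
    have [p|p] := leP 0 (fine (v x) + d); first by rewrite (dPhi_ginv H).
    by apply: (le_trans (ltW p)); exact: (profile_d_ge0 H).
  by exists j.
have [kB hkB] : exists k, mu3 (GB (s k) `&` F k) != 0.
  apply: (pos_piece (measurable_below c)) => //; first by move=> k; apply: measurableI => //; have [] := Foo k.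
  move=> x hx; have [|j hj Fj] := Fcov x (fun j => GB (s j) x); last by exists j.
  have [vy|vy] := eqVneq (v x) +oo%E.
    by exists 0%N => j _; rewrite /GB /= vy addye// leey.
  have vf : v x \is a fin_num by rewrite ge0_fin_numE// ltey.
  have u : rho0 x < ginv dPhi (fine (v x) + c).
    by apply: (ginv_gt H) => //; move: hx; rewrite /below /= -{1}(fineK vf) -EFinD lte_fin.
  have [k hk] : exists k, s k <= ginv dPhi (fine (v x) + c) - rho0 x.
    by apply: nat_lt; rewrite subr_gt0.
  exists k => j kj; have sj := le_trans (s_le _ _ kj) hk.
  have rs : 0 <= rho0 x + s j by rewrite addr_ge0// ltW.
  rewrite /GB /= max_r// -(fineK vf) -EFinD lee_fin.
  have gp : 0 < fine (v x) + c.
    rewrite ltNge; apply/negP => /(ginv_npos dPhi) e; move: u; rewrite e => /lt_le_trans/(_ (rho_ge0 x)).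
    by rewrite ltxx.
  rewrite -(dPhi_ginv H (ltW gp)); apply: (profile_dle H) => //.
  by rewrite -lerBrDl.
have pos (G : set T3) k : measurable G -> mu3 (G `&` F k) != 0 -> (0 < mu3 (G `&` F k) < +oo)%E.
  have [mF Ff] := Foo k.
  move=> mG h; rewrite lt_neqAle eq_sym h measure_ge0/=.
  apply: le_lt_trans Ff; apply: le_measure; rewrite ?inE//; exact: measurableI.
pose t := Num.min (s kA) (s kB).
have t0 : 0 < t by rewrite lt_min !s0.
apply: (mass_transfer H minrho (A := GA (s kA) `&` F kA) (B := GB (s kB) `&` F kB) t0 cd).
- by apply: measurableI => //; have [] := Foo kA.
- by apply: measurableI => //; have [] := Foo kB.
- exact: pos.
- exact: pos.
- move=> x [[/=]]; rewrite lee_fin => h1 h2 _.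
  have th : t <= s kA by rewrite /t ge_min lexx.
  split; first exact: le_trans th h1.
  apply: (le_trans h2); rewrite max_r ?subr_ge0// lee_fin; apply: (profile_dle H).
    by rewrite subr_ge0.
  by rewrite lerD2l lerN2.
- move=> x [/= h1 _]; apply: le_trans h1; rewrite max_r ?addr_ge0// ?(ltW (s0 _))// lee_fin.
  apply: (profile_dle H); first by rewrite addr_ge0// ltW.
  by rewrite lerD2l /t ge_min lexx orbT.
Qed.

Let pos_mass_infinite (e : R) : 0 < e -> {ae mu3, forall x, e <= rho0 x} -> False.
Proof.
move=> e0 h; have [_ _ _ rM] := FMP Frho.
have : (\int[mu3]_x (cst e%:E x) <= \int[mu3]_x (rho0 x)%:E)%E.
  apply: ae_ge0_le_integral => //.
  - by move=> x _; rewrite lee_fin ltW.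
  - by move=> x _; rewrite lee_fin.
  - exact/measurable_EFinP.
  - by apply: filterS h => x hx _; rewrite lee_fin.
have -> : (\int[mu3]_x (cst e%:E x) = +oo)%E.
  apply: (etrans (integral_cst mu3 measurableT _)).
  by apply: (etrans (f_equal (mule _) (mu3_setT R))); rewrite gt0_muley.
by rewrite rM.
Qed.

(** E0 is the essential infimum of Phi'(rho0) - v, that is, the supremum of the c for which
    [below c] is null; [level_dichotomy] then makes every [above (E0 + eps)] null. *)
Lemma euler_lagrange : 0 < M ->
  exists2 E0 : R, E0 <= 0 & {ae mu3, forall x, rho0 x = ginv dPhi (E0 + fine (v x))}.
Proof.
move=> M0.
pose S := [set c | mu3 (below c) = 0].
have vfin := pot_finite_ae.
have neg (A : set T3) : measurable A -> mu3 A = 0 -> {ae mu3, forall x, ~ A x}.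
  by move=> mA A0; exists A; split => // x /= /contrapT.
have down c d : c <= d -> S d -> S c.
  move=> cd; rewrite /S /= => hd; apply/eqP; rewrite eq_le measure_ge0 andbT -hd.
  apply: le_measure; rewrite ?inE// => x; rewrite /below /= => /lt_le_trans; apply.
  by rewrite leeD2l// lee_fin.
have Sub c : S c -> c <= 0.
  move=> /(neg _ (measurable_below c)) hc; rewrite leNgt; apply/negP => c0.
  apply: (@pos_mass_infinite (ginv dPhi c)); first exact: (ginv_gt0 H).
  apply: (aeS2 vfin hc) => x vf; rewrite /below /= => /negP; rewrite -leNgt.
  rewrite -(fineK vf) -EFinD lee_fin => h; rewrite -(ginv_dPhi H (rho_ge0 x)).
  apply: (ginv_le H); apply: le_trans h; rewrite lerDr fine_ge0//.
(* Otherwise rho0 would vanish almost everywhere, against M > 0. By the dichotomy this makes S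
   nonempty. *)
have [k hk] : exists k : nat, mu3 (above (- k%:R)) != 0.
  apply: contrapT => hk; have {}hk k : mu3 (above (- k%:R)) = 0.
    by apply/eqP; apply: contra_notT hk => hk; exists k.
  have ha : {ae mu3, forall x k, ~ above (- k%:R) x} by apply: ae_foralln => k; exact: neg.
  have r0 : {ae mu3, forall x, setT x -> (rho0 x)%:E = cst 0%E x}.
    apply: (aeS2 vfin ha) => x vf hx _; congr EFin; apply/eqP; rewrite eq_le rho_ge0 andbT leNgt.
    apply/negP => r0; apply: (hx (Num.truncn (fine (v x))).+1); split => //.
    rewrite -(fineK vf) -EFinD lte_fin.
    apply: (@lt_le_trans _ _ 0); last exact: (profile_d_ge0 H).
    by rewrite subr_lt0 -truncn_lt_nat ?fine_ge0.
  have [_ _ _ rM] := FMP Frho.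
  move: M0; rewrite -lte_fin -rM (ae_eq_integral (cst 0%E))// ?integral0 ?ltxx//.
  exact/measurable_EFinP.
have S0 : S !=set0.
  exists (- k%:R - 1); have cd : - k%:R - 1 < - k%:R :> R by rewrite ltrBlDr ltrDl.
  by have [//|h] := level_dichotomy cd; rewrite h eqxx in hk.
have hS : has_sup S by split => //; exists 0 => c /Sub.
pose E0 := sup S; exists E0; first exact: ge_sup.
pose s (k : nat) : R := k.+1%:R^-1.
have s0 j : 0 < s j by rewrite invr_gt0.
have nat_lt (e : R) : 0 < e -> exists k, s k < e.
  move=> e0; exists (Num.truncn e^-1); rewrite /s invf_plt ?posrE//.
  by rewrite -truncn_lt_nat ?invr_ge0 ?ltW.
have b0 j : mu3 (below (E0 - s j)) = 0.
  have [c Sc] := sup_adherent (s0 j) hS; move=> /ltW h; exact: down h Sc.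
(* The intermediate level E0 + s j / 2 exceeds the supremum, so the first alternative of the
   dichotomy is excluded. *)
have a0 j : mu3 (above (E0 + s j)) = 0.
  have [] := @level_dichotomy (E0 + s j / 2) (E0 + s j); last by [].
    by rewrite ltrD2l ltr_pdivrMr// ltr_pMr// ltr1n.
  move=> h; have : E0 + s j / 2 <= E0 by apply: sup_upper_bound.
  by rewrite gerDl leNgt divr_gt0.
have hb : {ae mu3, forall x j, ~ below (E0 - s j) x} by apply: ae_foralln => j; exact: neg.
have ha : {ae mu3, forall x j, ~ above (E0 + s j) x} by apply: ae_foralln => j; exact: neg.
apply: (aeS2 (aeS2 hb ha (fun x => @conj _ _)) vfin) => x [hbx hax] vf.
have lo : fine (v x) + E0 <= dPhi (rho0 x).
  rewrite leNgt; apply/negP; rewrite -subr_gt0 => /nat_lt[j hj]; apply: (hbx j).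
  by rewrite /below /= -(fineK vf) -EFinD lte_fin; lra.
have [r0|rp] := eqVneq (rho0 x) 0.
  rewrite r0 ginv_npos// addrC; apply: le_trans lo _; by rewrite r0 (profile_d0 H).
have rp' : 0 < rho0 x by rewrite lt_neqAle eq_sym rp rho_ge0.
have hi : dPhi (rho0 x) <= fine (v x) + E0.
  rewrite leNgt; apply/negP; rewrite -subr_gt0 => /nat_lt[j hj]; apply: (hax j).
  by split => //; rewrite -(fineK vf) -EFinD lte_fin; lra.
by rewrite [E0 + _]addrC (_ : _ + E0 = dPhi (rho0 x)) ?(ginv_dPhi H)//; apply/eqP; rewrite eq_le lo hi.
Qed.
End euler_lagrange.

(** * Polarization and spherical symmetry *)

Section iterated.
Variable R : realType.
Local Notation T1 := (measurableTypeR R).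
Local Notation T2 := (T1 * T1)%type.
Local Notation T3 := (T2 * T1)%type.
Local Notation mu3 := (@mu3 R).
Implicit Types u v : T3 * T3 -> R.

Lemma measurable_iterated u : measurable_fun setT u -> (forall q, 0 <= u q) ->
  measurable_fun setT (fun x => \int[mu3]_y (u (x, y))%:E)%E.
Proof.
move=> mu u0; apply: (measurable_fun_fubini_tonelli_F (m2 := mu3) (fun q => (u q)%:E)).
  exact/measurable_EFinP.
by move=> q; rewrite lee_fin.
Qed.

Lemma measurable_section1 u x : measurable_fun setT u -> measurable_fun setT (fun y => u (x, y)).
Proof. by move=> mu; exact: (measurable_fun_pair2 x mu). Qed.

Lemma measurable_section2 u y : measurable_fun setT u -> measurable_fun setT (fun x => u (x, y)).
Proof. by move=> mu; exact: (measurable_fun_pair1 y mu). Qed.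

Lemma iterated_integralD u v : measurable_fun setT u -> measurable_fun setT v ->
  (forall q, 0 <= u q) -> (forall q, 0 <= v q) ->
  (\int[mu3]_x \int[mu3]_y (u (x, y) + v (x, y))%:E =
   \int[mu3]_x \int[mu3]_y (u (x, y))%:E + \int[mu3]_x \int[mu3]_y (v (x, y))%:E)%E.
Proof.
move=> mu mv u0 v0; rewrite -ge0_integralD//.
- apply: eq_integral => x _.
  exact: (ge0_integralD_EFin mu3 (measurable_section1 x mu) (measurable_section1 x mv)).
- by move=> x _; apply: integral_ge0 => y _; rewrite lee_fin.
- exact: measurable_iterated.
- by move=> x _; apply: integral_ge0 => y _; rewrite lee_fin.
- exact: measurable_iterated.
Qed.

Lemma iterated_integralZ (c : R) u : measurable_fun setT u -> (forall q, 0 <= u q) -> 0 <= c ->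
  (\int[mu3]_x (c%:E * \int[mu3]_y (u (x, y))%:E) =
   c%:E * \int[mu3]_x \int[mu3]_y (u (x, y))%:E)%E.
Proof.
move=> mu u0 c0; rewrite ge0_integralZl//; first exact: measurable_iterated.
by move=> x _; apply: integral_ge0 => y _; rewrite lee_fin.
Qed.

Lemma iterated_integralC u : measurable_fun setT u -> (forall q, 0 <= u q) ->
  (\int[mu3]_x \int[mu3]_y (u (x, y))%:E = \int[mu3]_y \int[mu3]_x (u (x, y))%:E)%E.
Proof.
move=> mu u0; apply: (@tonelli6 R (fun q => (u q)%:E)); first exact/measurable_EFinP.
by move=> q; rewrite lee_fin.
Qed.

Lemma ge0_integral0_ae (f : T3 -> \bar R) : measurable_fun setT f -> (forall x, 0 <= f x)%E ->
  (\int[mu3]_x f x = 0)%E -> {ae mu3, forall x, f x = 0%E}.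
Proof.
move=> mf f0 e.
have e' : (\int[mu3]_(x in setT) `|f x| = 0)%E.
  by rewrite -[RHS]e; apply: eq_integral => x _; rewrite gee0_abs.
have [N [mN N0 h]] := (ae_eq_integral_abs mu3 measurableT mf).1 e'.
by exists N; split => // x /= hx; apply: h => /=; apply: contra_not hx => /(_ I).
Qed.
End iterated.

Section reflection.
Variable R : realType.
Local Notation T1 := (measurableTypeR R).
Local Notation T2 := (T1 * T1)%type.
Local Notation T3 := (T2 * T1)%type.
Local Notation leb := (@lebesgue_measure R).
Local Notation mu3 := (@mu3 R).

Lemma sqn_eq0 (x : T3) : (sqn x == 0) = (x == 0).
Proof.
case: x => -[a b] c; rewrite /sqn /=; apply/eqP/eqP => [h|[-> -> ->]]; last by rewrite expr0n !addr0.
have [a0 b0 c0] : [/\ a ^+ 2 = 0, b ^+ 2 = 0 & c ^+ 2 = 0].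
  by have := sqr_ge0 a; have := sqr_ge0 b; have := sqr_ge0 c; split; lra.
by congr (_, _, _); apply/eqP; rewrite -sqrf_eq0 ?a0 ?b0 ?c0.
Qed.

Lemma enormB_eq0 (x y : T3) : (enorm (x - y) == 0) = (x == y).
Proof. by rewrite -sqrf_eq0 enorm_sqr sqn_eq0 subr_eq0. Qed.

(* T is the orthogonal reflection in the plane l = 0, for an affine function l. *)
Record reflection (T : T3 -> T3) (l : T3 -> R) : Prop := Reflection {
  reflection_mpres : mpres T;
  reflection_meas : measurable_fun setT l;
  reflectionN : forall x, l (T x) = - l x;
  reflectionK : forall x, T (T x) = x;
  reflection_iso : forall x y, sqn (T x - T y) = sqn (x - y);
  reflection_cross : exists2 k, 0 < k &
    forall x y, sqn (x - T y) = sqn (x - y) + k * (l x * l y) }.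

Section polarization.
Variables (T : T3 -> T3) (l : T3 -> R) (HT : reflection T l).

(** [reflection_cross] at y = x reads |x - T x|^2 = k l(x)^2. *)
Lemma reflection_fix x : l x = 0 -> T x = x.
Proof.
move=> lx; have [k _ h] := reflection_cross HT.
by apply/esym/eqP; rewrite -subr_eq0 -sqn_eq0 h lx !mul0r mulr0 addr0 sqn_eq0 subrr.
Qed.

Lemma reflection_ker x y : ker (T x) (T y) = ker x y.
Proof. by rewrite !kerE (reflection_iso HT). Qed.

Lemma reflection_kerC x y : ker (T x) y = ker x (T y).
Proof. by rewrite -reflection_ker (reflectionK HT). Qed.

Lemma integral_reflection (f : T3 -> \bar R) : measurable_fun setT f -> (forall x, 0 <= f x)%E ->
  (\int[mu3]_x f (T x) = \int[mu3]_x f x)%E.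
Proof. by have [_ h] := reflection_mpres HT; exact: h. Qed.

Let mT : measurable_fun setT T. Proof. by case: (reflection_mpres HT). Qed.

Lemma integral_reflectionD (f : T3 -> R) : measurable_fun setT f -> (forall x, 0 <= f x) ->
  (\int[mu3]_x (f x + f (T x))%:E = 2%:E * \int[mu3]_x (f x)%:E)%E.
Proof.
move=> mf f0; have mfT : measurable_fun setT (fun x => f (T x)) by exact: (measurableT_comp mf mT).
have fT0 x : 0 <= f (T x) by [].
have E : (\int[mu3]_x (f (T x))%:E = \int[mu3]_x (f x)%:E)%E.
  apply: (integral_reflection (f := fun x => (f x)%:E)); first exact/measurable_EFinP.
  by move=> x; rewrite lee_fin.
by rewrite (ge0_integralD_EFin mu3 mf mfT f0 fT0) E -mule2n -mule_natl.
Qed.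

Definition polarize (rho : T3 -> R) (x : T3) : R :=
  if 0 <= l x then Num.max (rho x) (rho (T x)) else Num.min (rho x) (rho (T x)).

Section density.
Variable rho : T3 -> R.
Hypotheses (mrho : measurable_fun setT rho) (rho_ge0 : forall x, 0 <= rho x).
Local Notation sig := (polarize rho).

Lemma polarize_cases x : (sig x = rho x /\ sig (T x) = rho (T x)) \/
  (sig x = rho (T x) /\ sig (T x) = rho x).
Proof.
rewrite /polarize (reflectionK HT) (reflectionN HT) oppr_ge0.
case: (ltgtP (l x) 0) => [_|_|/reflection_fix ->]; last by left; rewrite maxxx.
  by case: (leP (rho x) (rho (T x))) => h; [left|right].
by case: (leP (rho x) (rho (T x))) => h; [right|left].
Qed.

Lemma polarize_ge0 x : 0 <= sig x.
Proof. by case: (polarize_cases x) => -[-> _]. Qed.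

Lemma measurable_polarize : measurable_fun setT sig.
Proof.
have ml := reflection_meas HT.
rewrite /polarize; apply: measurable_fun_ifT.
- by meas.
- by meas.
- by meas.
Qed.

(** Polarization only permutes the two values on each mirror pair, so the sum of g over the pair is
    unchanged; T preserves the measure. *)
Lemma integral_polarize (g : R -> R) : measurable_fun setT (fun x => g (rho x)) ->
  measurable_fun setT (fun x => g (sig x)) -> (forall r, 0 <= r -> 0 <= g r) ->
  (\int[mu3]_x (g (sig x))%:E = \int[mu3]_x (g (rho x))%:E)%E.
Proof.
move=> m1 m2 g0.
have h1 := integral_reflectionD m1 (fun x => g0 _ (rho_ge0 x)).
have h2 := integral_reflectionD m2 (fun x => g0 _ (polarize_ge0 x)).
have e : (2%:E * \int[mu3]_x (g (sig x))%:E = 2%:E * \int[mu3]_x (g (rho x))%:E)%E.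
  rewrite -h1 -h2; apply: eq_integral => x _.
  by case: (polarize_cases x) => -[-> ->]; rewrite // addrC.
have := congr1 (fun z => ((2^-1)%:E * z)%E) e.
by rewrite !muleA -EFinM mulVf ?mul1e// pnatr_eq0.
Qed.

Let d x := rho x - rho (T x).
Let eps x : R := if 0 <= l x then 1 else - 1.

Let polarizeB x : sig x - sig (T x) = eps x * `|d x|.
Proof.
rewrite /polarize (reflectionK HT) (reflectionN HT) oppr_ge0 /eps /d.
case: (ltgtP (l x) 0) => [_|_|/reflection_fix ->]; last by rewrite maxxx subrr normr0 mulr0.
  by case: (leP (rho x) (rho (T x))) => h; [rewrite ler0_norm ?subr_le0//|rewrite gtr0_norm ?subr_gt0//]; lra.
by case: (leP (rho x) (rho (T x))) => h; [rewrite ler0_norm ?subr_le0//|rewrite gtr0_norm ?subr_gt0//]; lra.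
Qed.

Let polarizeD x : sig x + sig (T x) = rho x + rho (T x).
Proof. by case: (polarize_cases x) => -[-> ->] //; rewrite addrC. Qed.

Let D1 (x y : T3) : R := enorm (x - y).
Let D2 (x y : T3) : R := enorm (x - T y).
(* Q f sums the interaction of f over the four images of (x, y) under T x id and id x T;
   polarization increases it pointwise by W >= 0. *)
Let Q (f : T3 -> R) (x y : T3) : R := (f x * f y + f (T x) * f (T y)) * ker x y +
  (f (T x) * f y + f x * f (T y)) * ker x (T y).
Let W (x y : T3) : R := ker x y * ker x (T y) / 2 *
  (`|D2 x y - D1 x y| * (`|d x| * `|d y|) - (D2 x y - D1 x y) * (d x * d y)).

(** By [reflection_cross], the squared distances from x to y and to its mirror image differ by a
    positive multiple of l x * l y. *)
Let D_le x y : (D1 x y <= D2 x y) = (0 <= l x * l y).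
Proof.
have [k k0 h] := reflection_cross HT.
rewrite -(ler_pXn2r (n := 2)) ?nnegrE ?enorm_ge0// !enorm_sqr h.
by rewrite lerDl pmulr_rge0.
Qed.

(** Off the plane, D2 - D1 is nonnegative or negative according to the sign of l x * l y, which is
    that of eps x * eps y; on the plane d vanishes. *)
Let sign_eps x y : (D2 x y - D1 x y) * (eps x * eps y * (`|d x| * `|d y|)) =
  `|D2 x y - D1 x y| * (`|d x| * `|d y|).
Proof.
have [l0|l0] := eqVneq (l x) 0.
  by rewrite (_ : d x = 0) ?normr0 ?mul0r ?mulr0// /d (reflection_fix l0) subrr.
have [l0'|l0'] := eqVneq (l y) 0.
  by rewrite (_ : d y = 0) ?normr0 ?mulr0// /d (reflection_fix l0') subrr.
have := D_le x y; rewrite /eps.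
case: (ltgtP (l x) 0) l0 => // hx _; case: (ltgtP (l y) 0) l0' => // hy _.
- have -> : 0 <= l x * l y by rewrite ltW// nmulr_lgt0.
  by rewrite -subr_ge0 => /ger0_norm ->; rewrite mulrNN !mul1r.
- have -> : (0 <= l x * l y) = false by apply/negbTE; rewrite -ltNge nmulr_rlt0.
  by move=> /negbT; rewrite -ltNge -subr_lt0 => /ltr0_norm ->; ring.
- have -> : (0 <= l x * l y) = false by apply/negbTE; rewrite -ltNge pmulr_rlt0.
  by move=> /negbT; rewrite -ltNge -subr_lt0 => /ltr0_norm ->; ring.
- have -> : 0 <= l x * l y by rewrite ltW// mulr_gt0.
  by rewrite -subr_ge0 => /ger0_norm ->; rewrite !mul1r.
Qed.

(** Split f into its even and odd parts under T: the even parts interact through the sum of the two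
    kernels, the odd parts through their difference. Polarization keeps the even part and turns the
    odd part d into eps |d|; the difference of the kernels is their product times D2 - D1. *)
Let Q_polarize x y : Q sig x y = Q rho x y + W x y.
Proof.
have E f : Q f x y = ((f x + f (T x)) * (f y + f (T y)) * (ker x y + ker x (T y)) +
   (f x - f (T x)) * (f y - f (T y)) * (ker x y - ker x (T y))) / 2.
  by rewrite /Q; field.
rewrite !E !polarizeD !polarizeB -!/(d _) /W mulrBr -sign_eps.
suff : (eps x * eps y * (`|d x| * `|d y|) - d x * d y) * (ker x y - ker x (T y)) =
   ker x y * ker x (T y) * (D2 x y - D1 x y) * (eps x * eps y * (`|d x| * `|d y|) - d x * d y).
  move=> h; apply/eqP; rewrite -subr_eq0; apply/eqP.
  apply: (@eq_trans _ _ (((eps x * eps y * (`|d x| * `|d y|) - d x * d y) * (ker x y - ker x (T y)) -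
   ker x y * ker x (T y) * (D2 x y - D1 x y) * (eps x * eps y * (`|d x| * `|d y|) - d x * d y)) / 2)).
    by field.
  by rewrite h subrr mul0r.
have nn z : `|d z| * `|d z| = d z * d z by rewrite -!expr2 real_normK ?num_real.
have kE z z' : ker z z' = (enorm (z - z'))^-1 by [].
(* For x = y or x = T y one of the kernels takes the default value 0 and the identity for their
   difference may fail, but then the other factor vanishes. *)
have [xy|xy] := eqVneq x y.
  rewrite {}xy; have -> : eps y * eps y * (`|d y| * `|d y|) - d y * d y = 0.
    by rewrite nn /eps; case: ifP => _; ring.
  by rewrite mul0r mulr0.
have [xy'|xy'] := eqVneq x (T y).
  have -> : eps x * eps y * (`|d x| * `|d y|) - d x * d y = 0.
    have dd : d x = - d y by rewrite xy' /d (reflectionK HT) opprB.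
    rewrite dd normrN nn.
    have [l0|l0] := eqVneq (l y) 0.
      by rewrite /d (reflection_fix l0) subrr; ring.
    rewrite /eps xy' (reflectionN HT) oppr_ge0; case: ltgtP l0 => // _ _; ring.
  by rewrite mul0r mulr0.
rewrite !kE /D1 /D2; field.
by rewrite !enormB_eq0 xy xy'.
Qed.

Let mT2 : measurable_fun setT (fun q : T3 * T3 => (q.1, T q.2)).
Proof. by apply: measurable_fun_pair => //; exact: (measurableT_comp mT). Qed.

Let mF (f : T3 -> R) : measurable_fun setT f ->
  measurable_fun setT (fun q : T3 * T3 => f q.1 * f q.2 * ker q.1 q.2).
Proof. by move=> mf; apply/measurable_EFinP; exact: measurable_mutual. Qed.

Let mQ (f : T3 -> R) : measurable_fun setT f -> measurable_fun setT (fun q : T3 * T3 => Q f q.1 q.2).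
Proof.
move=> mf; have mfT : measurable_fun setT (f \o T) by exact: (measurableT_comp mf mT).
have m1 : measurable_fun setT (fun q : T3 * T3 => ker q.1 q.2) by exact: measurable_ker.
have m2 : measurable_fun setT (fun q : T3 * T3 => ker q.1 (T q.2)).
  exact: (measurableT_comp (@measurable_ker R) mT2).
have ma : measurable_fun setT (fun q : T3 * T3 => f q.1) by exact: (measurableT_comp mf).
have mb : measurable_fun setT (fun q : T3 * T3 => f q.2) by exact: (measurableT_comp mf).
have ma' : measurable_fun setT (fun q : T3 * T3 => f (T q.1)) by exact: (measurableT_comp mfT).
have mb' : measurable_fun setT (fun q : T3 * T3 => f (T q.2)) by exact: (measurableT_comp mfT).
by rewrite /Q; meas.
Qed.

Let Q_ge0 (f : T3 -> R) x y : (forall x, 0 <= f x) -> 0 <= Q f x y.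
Proof. by move=> f0; rewrite /Q addr_ge0// mulr_ge0 ?ker_ge0// addr_ge0// mulr_ge0. Qed.

(** T preserves the measure in each variable separately, so the four terms of Q have the same
    integral. *)
Let mutual_Q (f : T3 -> R) : measurable_fun setT f -> (forall x, 0 <= f x) ->
  (\int[mu3]_x \int[mu3]_y (Q f x y)%:E = 4%:E * mutual f f)%E.
Proof.
move=> mf f0.
pose F (q : T3 * T3) := f q.1 * f q.2 * ker q.1 q.2.
have F0 q : 0 <= F q by rewrite /F !mulr_ge0// ker_ge0.
pose G (q : T3 * T3) := F q + F (q.1, T q.2).
have mG : measurable_fun setT G.
  by apply: measurable_funD; [exact: mF|exact: (measurableT_comp (mF mf) mT2)].
have G0 q : 0 <= G q by rewrite addr_ge0.
transitivity (\int[mu3]_y \int[mu3]_x (G (x, y) + G (T x, y))%:E)%E.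
  rewrite (iterated_integralC (u := fun q => Q f q.1 q.2) (mQ mf) (fun q => Q_ge0 _ _ f0)).
  apply: eq_integral => y _; apply: eq_integral => x _; congr EFin.
  by rewrite /Q /G /F /= !(reflection_kerC x) (reflectionK HT); ring.
transitivity (\int[mu3]_y (2%:E * \int[mu3]_x (G (x, y))%:E))%E.
  apply: eq_integral => y _.
  exact: (integral_reflectionD (f := fun x => G (x, y)) (measurable_section2 y mG)).
have mGs : measurable_fun setT (fun q : T3 * T3 => G (q.2, q.1)).
  by apply: (measurableT_comp mG); apply: measurable_fun_pair.
rewrite (iterated_integralZ (u := fun q => G (q.2, q.1)) mGs)//.
rewrite -(iterated_integralC mG G0).
have -> : (\int[mu3]_x \int[mu3]_y (G (x, y))%:E = 2%:E * mutual f f)%E.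
  rewrite mutualEint -(iterated_integralZ (u := F) (mF mf))//.
  apply: eq_integral => x _.
  exact: (integral_reflectionD (f := fun y => F (x, y)) (measurable_section1 x (mF mf))).
by rewrite muleA -EFinM -natrM.
Qed.

Let W_ge0 x y : 0 <= W x y.
Proof.
apply: mulr_ge0; first by rewrite divr_ge0// mulr_ge0// ker_ge0.
by rewrite subr_ge0 -!normrM ler_norm.
Qed.

Let mW : measurable_fun setT (fun q : T3 * T3 => W q.1 q.2).
Proof.
have -> : (fun q : T3 * T3 => W q.1 q.2) = (fun q => Q sig q.1 q.2 - Q rho q.1 q.2).
  by apply/funext => q; rewrite Q_polarize addrC addKr.
by apply: measurable_funB; apply: mQ => //; exact: measurable_polarize.
Qed.

(** If polarization does not raise the interaction energy, the nonnegative gain W vanishes almost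
    everywhere. A single point x where rho is below its mirror value then decides the sign of d y
    for almost every y on the same side. *)
Lemma polarize_sign : (mutual rho rho < +oo)%E -> (mutual sig sig <= mutual rho rho)%E ->
  {ae mu3, forall x, 0 <= l x -> rho (T x) <= rho x} \/
  {ae mu3, forall x, 0 <= l x -> rho x <= rho (T x)}.
Proof.
move=> fin le.
have W0 : (\int[mu3]_x \int[mu3]_y (W x y)%:E = 0)%E.
  have := iterated_integralD (mQ mrho) mW (fun q => Q_ge0 q.1 q.2 rho_ge0) (fun q => W_ge0 q.1 q.2).
  have -> : (\int[mu3]_x \int[mu3]_y (Q rho (x, y).1 (x, y).2 + W (x, y).1 (x, y).2)%:E =
      4%:E * mutual sig sig)%E.
    rewrite -(mutual_Q measurable_polarize polarize_ge0).
    by apply: eq_integral => x _; apply: eq_integral => y _; rewrite Q_polarize.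
  rewrite (mutual_Q mrho rho_ge0) /=.
  have p0 := mutual_ge0 rho_ge0 rho_ge0.
  set w := (X in (_ + X)%E) => e.
  have w0 : (0 <= w)%E by apply: integral_ge0 => x _; apply: integral_ge0 => y _; rewrite lee_fin.
  have f : (4%:E * mutual rho rho)%E \is a fin_num.
    by rewrite fin_numM// ge0_fin_numE.
  apply/eqP; rewrite eq_le w0 andbT -(leeD2lE _ _ f) -e adde0.
  by rewrite lee_pmul2l.
have iW0 x : (0 <= \int[mu3]_y (W x y)%:E)%E by apply: integral_ge0 => y _; rewrite lee_fin.
have [N [mN N0 hN]] := ge0_integral0_ae (measurable_iterated mW (fun q => W_ge0 q.1 q.2)) iW0 W0.
(* The deciding point is taken outside N, so that W x vanishes for almost every y. *)
have [h|h] := pselect (exists x, [/\ (0 <= l x)%R, (rho x < rho (T x))%R & ~ N x]); last first.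
  left; exists N; split => // x /= hx; apply: contrapT => Nx; apply: h; exists x.
  move: hx => /not_implyP[lx /negP]; rewrite -ltNge => r.
  by split.
right; have [x [lx rx Nx]] := h.
have Wx : (\int[mu3]_y (W x y)%:E = 0)%E by apply: contrapT => hx; apply: Nx; exact: hN.
have mWx : measurable_fun setT (fun y => (W x y)%:E).
  by apply/measurable_EFinP; exact: (measurable_section1 x mW).
have W0x y : (0 <= (W x y)%:E)%E by rewrite lee_fin.
have := ge0_integral0_ae mWx W0x Wx; apply: filterS => y [Wy] ly.
have dx : d x < 0 by rewrite subr_lt0.
suff : d y <= 0 by rewrite subr_le0.
rewrite leNgt; apply/negP => dy.
have lx0 : 0 < l x.
  rewrite lt_neqAle lx andbT; apply/eqP => l0.
  by move: dx; rewrite /d (reflection_fix (esym l0)) subrr ltxx.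
have ly0 : 0 < l y.
  rewrite lt_neqAle ly andbT; apply/eqP => l0.
  by move: dy; rewrite /d (reflection_fix (esym l0)) subrr ltxx.
have [k k0 cross] := reflection_cross HT.
have D12 : D1 x y < D2 x y.
  rewrite -(ltr_pXn2r (n := 2)) ?nnegrE ?enorm_ge0// !enorm_sqr cross.
  by rewrite ltrDl mulr_gt0// mulr_gt0.
have D10 : 0 < D1 x y.
  rewrite lt_neqAle eq_sym enormB_eq0 enorm_ge0 andbT; apply/eqP => xy.
  by move: dx; rewrite xy ltNge ltW.
have : 0 < W x y.
  rewrite /W; apply: mulr_gt0.
    by rewrite divr_gt0// mulr_gt0// invr_gt0// (lt_trans D10).
  rewrite subr_gt0; apply: (@lt_le_trans _ _ 0).
    by rewrite pmulr_rlt0 ?subr_gt0// nmulr_rlt0.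
  by rewrite !mulr_ge0.
by rewrite Wy ltxx.
Qed.
End density.
End polarization.
End reflection.

Section measurable_real_sets.
Context d (T : measurableType d) (R : realType) (f g : T -> R).
Hypotheses (mf : measurable_fun setT f) (mg : measurable_fun setT g).

Lemma measurable_set_ltr : measurable [set x | f x < g x].
Proof.
by rewrite -[X in measurable X]setTI; apply: (measurable_fun_ltr mf mg) => //; exact: (_ : measurable [set true]).
Qed.

Lemma measurable_set_ler : measurable [set x | f x <= g x].
Proof.
by rewrite -[X in measurable X]setTI; apply: (measurable_fun_ler mf mg) => //; exact: (_ : measurable [set true]).
Qed.
End measurable_real_sets.

Lemma sprodE d1 d2 (T1 : measurableType d1) (T2 : measurableType d2) (R : realType)
  (m1 : {sigma_finite_measure set T1 -> \bar R}) (m2 : {sigma_finite_measure set T2 -> \bar R}) A B :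
  measurable A -> measurable B -> sprod m1 m2 (A `*` B) = (m1 A * m2 B)%E.
Proof. by move=> mA mB; rewrite /sprod product_measure1E. Qed.

(** * Reflections, mass-halving planes and the centre of symmetry *)

Section symmetry.
Variable R : realType.
Local Notation T1 := (measurableTypeR R).
Local Notation T2 := (T1 * T1)%type.
Local Notation T3 := (T2 * T1)%type.
Local Notation mu3 := (@mu3 R).

Lemma mpres_ae (T : T3 -> T3) (P : T3 -> Prop) : mpres T ->
  {ae mu3, forall x, P x} -> {ae mu3, forall x, P (T x)}.
Proof.
move=> [mT h] [N [mN N0 NP]].
have mTN : measurable (T @^-1` N) by rewrite -[X in measurable X]setTI; exact: mT.
exists (T @^-1` N); split => //; last by move=> x /=; exact: (NP (T x)).
have mI : measurable_fun setT (\1_N : T3 -> R) by exact: measurable_indic.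
have E : (\int[mu3]_x (\1_N (T x))%:E = \int[mu3]_x (\1_N x)%:E)%E.
  by apply: (h (fun x => (\1_N x)%:E)); [exact/measurable_EFinP|move=> x; rewrite lee_fin].
apply: (@eq_trans _ _ (\int[mu3]_x (\1_(T @^-1` N) x)%:E)%E).
  by rewrite integral_indic// setIT.
by apply: (etrans E); rewrite integral_indic// setIT.
Qed.

Lemma reflection_conj (x0 : T3) T l : reflection T l ->
  reflection (fun x => T (x - x0) + x0) (fun x => l (x - x0)).
Proof.
move=> [mp ml lN TK iso [k k0 cr]].
have mB := mpres_shift (- x0).
split.
- exact: (mpres_comp (mpres_shift x0) (mpres_comp mp mB)).
- exact: (measurableT_comp ml mB.1).
- by move=> x; rewrite addrK lN.
- by move=> x; rewrite addrK TK subrK.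
- by move=> x y; rewrite opprD addrACA subrr addr0 iso opprB addrA subrK.
- exists k => // x y; have -> : x - (T (y - x0) + x0) = (x - x0) - T (y - x0).
    by rewrite opprD [- T _ - _]addrC addrA.
  by rewrite cr opprB addrA subrK.
Qed.

Lemma sqnE (x y : T3) : sqn (x - y) = (x.1.1 - y.1.1) ^+ 2 + (x.1.2 - y.1.2) ^+ 2 + (x.2 - y.2) ^+ 2.
Proof. by []. Qed.

Definition coord1 (x : T3) : R := x.1.1.
Definition coord2 (x : T3) : R := x.1.2.
Definition coord3 (x : T3) : R := x.2.

Definition flip1 (x : T3) : T3 := ((- x.1.1, x.1.2), x.2).
Definition flip2 (x : T3) : T3 := ((x.1.1, - x.1.2), x.2).
Definition flip3 (x : T3) : T3 := ((x.1.1, x.1.2), - x.2).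

Lemma reflection_flip1 : reflection flip1 coord1.
Proof.
split.
- have := mpres_coord1 (sqrr_sign R 1) (@measurable_cst _ _ T2 R setT 0).
  by congr mpres; apply/funext => -[[a b] c]; rewrite addr0 mulN1r.
- by rewrite /coord1; meas.
- by [].
- by move=> -[[a b] c]; rewrite /flip1 /= opprK.
- by move=> x y; rewrite !sqnE /=; ring.
- by exists 4 => // x y; rewrite !sqnE /coord1 /=; ring.
Qed.

Lemma reflection_flip2 : reflection flip2 coord2.
Proof.
split.
- have := mpres_coord2 (sqrr_sign R 1) (@measurable_cst _ _ T2 R setT 0).
  by congr mpres; apply/funext => -[[a b] c]; rewrite addr0 mulN1r.
- by rewrite /coord2; meas.
- by [].
- by move=> -[[a b] c]; rewrite /flip2 /= opprK.
- by move=> x y; rewrite !sqnE /=; ring.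
- by exists 4 => // x y; rewrite !sqnE /coord2 /=; ring.
Qed.

Lemma reflection_flip3 : reflection flip3 coord3.
Proof.
split.
- have := mpres_coord3 (sqrr_sign R 1) (@measurable_cst _ _ T2 R setT 0).
  by congr mpres; apply/funext => -[[a b] c]; rewrite addr0 mulN1r.
- by rewrite /coord3; meas.
- by [].
- by move=> -[[a b] c]; rewrite /flip3 /= opprK.
- by move=> x y; rewrite !sqnE /=; ring.
- by exists 4 => // x y; rewrite !sqnE /coord3 /=; ring.
Qed.

Lemma mirror_coef (p q : R) : p ^+ 2 + q ^+ 2 = 1 -> q != 0 -> 0 < 1 - p.
Proof.
move=> pq q0; have : 0 < q ^+ 2 by rewrite lt_neqAle sqr_ge0 andbT eq_sym sqrf_eq0.
by nra.
Qed.

(** With p = cos t and q = sin t, this reflects the first two coordinates in the line at angle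
    t/2. *)
Definition mirror12 (p q : R) (x : T3) : T3 := ((p * x.1.1 + q * x.1.2, q * x.1.1 - p * x.1.2), x.2).
Definition mirror23 (p q : R) (x : T3) : T3 := ((x.1.1, p * x.1.2 + q * x.2), q * x.1.2 - p * x.2).

(* A rotation by an angle other than pi is a product of three shears. *)
Lemma reflection_mirror12 (p q : R) : p ^+ 2 + q ^+ 2 = 1 -> q != 0 ->
  reflection (mirror12 p q) (fun x => (1 - p) * x.1.1 - q * x.1.2).
Proof.
move=> pq q0; have p1 := mirror_coef pq q0.
have q2 : q ^+ 2 = 1 - p ^+ 2 by rewrite -pq addrC addKr.
(* This is -tan (t/2) for p = cos t and q = sin t, the coefficient of the two outer shears. *)
pose k := (p - 1) / q.
have mk : measurable_fun setT (fun z : T2 => k * z.1) by meas.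
have mq : measurable_fun setT (fun z : T2 => q * z.1) by meas.
split.
- have h1 := mpres_coord1 (expr1n _ 2) mk.
  have h2 := mpres_coord2 (expr1n _ 2) mq.
  have h0 := mpres_coord2 (sqrr_sign R 1) (@measurable_cst _ _ T2 R setT 0).
  have := mpres_comp h1 (mpres_comp h2 (mpres_comp h1 h0)); congr mpres.
  apply/funext => -[[a b] c]; rewrite /mirror12 /=; congr (_, _, _); rewrite /k.
  + rewrite (_ : q * b = - (k * (p + 1)) * b); last first.
      by rewrite /k; congr (_ * _); apply: (mulIf q0); rewrite -expr2 q2; field.
    by rewrite /k; field.
  + by field.
- by meas.
- by move=> x /=; transitivity ((p - (p ^+ 2 + q ^+ 2)) * x.1.1 + q * x.1.2); [ring|rewrite pq; ring].
- move=> -[[a b] c]; rewrite /mirror12 /=; congr (_, _, _).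
  + by transitivity ((p ^+ 2 + q ^+ 2) * a); [ring|rewrite pq mul1r].
  + by transitivity ((p ^+ 2 + q ^+ 2) * b); [ring|rewrite pq mul1r].
- move=> x y; rewrite !sqnE /=.
  transitivity ((p ^+ 2 + q ^+ 2) * ((x.1.1 - y.1.1) ^+ 2 + (x.1.2 - y.1.2) ^+ 2) + (x.2 - y.2) ^+ 2); first by ring.
  by rewrite pq mul1r.
(* It is 4 over the squared length of the normal (1 - p, - q), which equals 2 (1 - p). *)
- exists (2 / (1 - p)); first by rewrite divr_gt0.
  move=> x y; rewrite !sqnE /mirror12 /=.
  have e : q ^+ 2 / (1 - p) = 1 + p by rewrite q2; field; rewrite gt_eqF.
  case: x => -[a b] c; case: y => -[a' b'] c' /=.
  transitivity (a ^+ 2 + b ^+ 2 + (p ^+ 2 + q ^+ 2) * (a' ^+ 2 + b' ^+ 2)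
     - 2 * a * (p * a' + q * b') - 2 * b * (q * a' - p * b') + (c - c') ^+ 2); first by ring.
  rewrite pq; transitivity ((a - a') ^+ 2 + (b - b') ^+ 2 + (c - c') ^+ 2 +
     2 * ((1 - p) * (a * a') - q * (a * b' + b * a') + q ^+ 2 / (1 - p) * (b * b'))).
    by rewrite e; ring.
  by field; rewrite gt_eqF.
Qed.

Lemma reflection_mirror23 (p q : R) : p ^+ 2 + q ^+ 2 = 1 -> q != 0 ->
  reflection (mirror23 p q) (fun x => (1 - p) * x.1.2 - q * x.2).
Proof.
move=> pq q0; have p1 := mirror_coef pq q0.
have q2 : q ^+ 2 = 1 - p ^+ 2 by rewrite -pq addrC addKr.
pose k := (p - 1) / q.
have mk : measurable_fun setT (fun z : T2 => k * z.2) by meas.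
have mq : measurable_fun setT (fun z : T2 => q * z.2) by meas.
split.
- have h1 := mpres_coord2 (expr1n _ 2) mk.
  have h2 := mpres_coord3 (expr1n _ 2) mq.
  have h0 := mpres_coord3 (sqrr_sign R 1) (@measurable_cst _ _ T2 R setT 0).
  have := mpres_comp h1 (mpres_comp h2 (mpres_comp h1 h0)); congr mpres.
  apply/funext => -[[a b] c]; rewrite /mirror23 /=; congr (_, _, _); rewrite /k.
  + rewrite (_ : q * c = - (k * (p + 1)) * c); last first.
      by rewrite /k; congr (_ * _); apply: (mulIf q0); rewrite -expr2 q2; field.
    by rewrite /k; field.
  + by field.
- by meas.
- by move=> x /=; transitivity ((p - (p ^+ 2 + q ^+ 2)) * x.1.2 + q * x.2); [ring|rewrite pq; ring].
- move=> -[[a b] c]; rewrite /mirror23 /=; congr (_, _, _).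
  + by transitivity ((p ^+ 2 + q ^+ 2) * b); [ring|rewrite pq mul1r].
  + by transitivity ((p ^+ 2 + q ^+ 2) * c); [ring|rewrite pq mul1r].
- move=> x y; rewrite !sqnE /=.
  transitivity ((p ^+ 2 + q ^+ 2) * ((x.1.2 - y.1.2) ^+ 2 + (x.2 - y.2) ^+ 2) + (x.1.1 - y.1.1) ^+ 2); first by ring.
  by rewrite pq mul1r; ring.
- exists (2 / (1 - p)); first by rewrite divr_gt0.
  move=> x y; rewrite !sqnE /mirror23 /=.
  have e : q ^+ 2 / (1 - p) = 1 + p by rewrite q2; field; rewrite gt_eqF.
  case: x => -[c a] b; case: y => -[c' a'] b' /=.
  transitivity (a ^+ 2 + b ^+ 2 + (p ^+ 2 + q ^+ 2) * (a' ^+ 2 + b' ^+ 2)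
     - 2 * a * (p * a' + q * b') - 2 * b * (q * a' - p * b') + (c - c') ^+ 2); first by ring.
  rewrite pq; transitivity ((a - a') ^+ 2 + (b - b') ^+ 2 + (c - c') ^+ 2 +
     2 * ((1 - p) * (a * a') - q * (a * b' + b * a') + q ^+ 2 / (1 - p) * (b * b'))).
    by rewrite e; ring.
  by field; rewrite gt_eqF.
Qed.

Section mass.
Variable rho : T3 -> R.
Hypotheses (mrho : measurable_fun setT rho) (rho_ge0 : forall x, 0 <= rho x).
Variable M : R.
Hypothesis rhoM : (\int[mu3]_x (rho x)%:E = M%:E)%E.

Definition mass (A : set T3) : \bar R := (\int[mu3]_(x in A) (rho x)%:E)%E.

Let mErho (A : set T3) : measurable_fun A (fun x => (rho x)%:E).
Proof. by apply: measurable_funTS; exact/measurable_EFinP. Qed.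

Lemma mass_ge0 A : (0 <= mass A)%E.
Proof. by apply: integral_ge0 => x _; rewrite lee_fin. Qed.

Lemma massU A B : measurable A -> measurable B -> A `&` B = set0 ->
  mass (A `|` B) = (mass A + mass B)%E.
Proof.
move=> mA mB AB; rewrite /mass ge0_integral_setU//.
- by move=> x _; rewrite lee_fin.
- by rewrite disj_set2E AB.
Qed.

Lemma mass_le A B : measurable A -> measurable B -> A `<=` B -> (mass A <= mass B)%E.
Proof.
by move=> mA mB AB; apply: ge0_subset_integral => // x _; rewrite lee_fin.
Qed.

Lemma massT : mass setT = M%:E. Proof. exact: rhoM. Qed.

Lemma mass_fin A : measurable A -> mass A \is a fin_num.
Proof.
move=> mA; rewrite ge0_fin_numE ?mass_ge0//.
by apply: (@le_lt_trans _ _ (mass setT)); [exact: mass_le|rewrite massT ltry].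
Qed.

Lemma mass_bigcup_le (F : nat -> set T3) (b : \bar R) : (forall k, measurable (F k)) ->
  (forall k, F k `<=` F k.+1) -> (forall k, mass (F k) <= b)%E -> (mass (\bigcup_k F k) <= b)%E.
Proof.
move=> mF ndF hb.
have nd : nondecreasing_seq F by apply/nondecreasing_seqP => k; rewrite subsetEset.
have mEF k : measurable_fun (F k) (fun x => (rho x)%:E) by exact: mErho.
have r0 k x : F k x -> (0 <= (rho x)%:E)%E by rewrite lee_fin.
have cv := @ge0_nondecreasing_set_cvg_integral _ _ _ F (fun x => (rho x)%:E) mu3 nd mF mEF r0.
rewrite /mass -(cvg_lim _ cv)//; apply: lime_le; first exact: cvgP cv.
by near=> k; exact: hb.
Unshelve. all: by end_near. Qed.

Section half.
Hypothesis M0 : 0 < M.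
Variable X : T3 -> R.
Hypotheses (mX : measurable_fun setT X) (X0 : forall c, mu3 [set x | X x = c] = 0).

Let mlt c : measurable [set x : T3 | X x < c].
Proof. exact: (@measurable_set_ltr _ T3 _ _ _ mX (measurable_cst c)). Qed.

Let mgt c : measurable [set x : T3 | c < X x].
Proof. exact: (@measurable_set_ltr _ T3 _ _ _ (measurable_cst c) mX). Qed.

Let mle c : measurable [set x : T3 | X x <= c].
Proof. exact: (@measurable_set_ler _ T3 _ _ _ mX (measurable_cst c)). Qed.

Let split_le c : (fine (mass [set x | (X x <= c)%R]) + fine (mass [set x | (c < X x)%R]) = M)%R.
Proof.
apply: EFin_inj; rewrite EFinD !fineK ?mass_fin// -massU//.
- by rewrite -massT; congr mass; apply/seteqP; split => // x _; case: (leP (X x) c); [left|right].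
- by apply/seteqP; split => // x [] /= h; rewrite ltNge h.
Qed.

Let mono c d : c <= d -> fine (mass [set x | (X x <= c)%R]) <= fine (mass [set x | (X x <= d)%R]).
Proof.
move=> cd; rewrite -lee_fin !fineK ?mass_fin//; apply: mass_le => // x /= h; exact: le_trans cd.
Qed.

Let nat_lt (e : R) : 0 < e -> exists k : nat, k.+1%:R^-1 < e.
Proof.
move=> e0; exists (Num.truncn e^-1); rewrite invf_plt ?posrE//.
by rewrite -truncn_lt_nat ?invr_ge0 ?ltW.
Qed.

(** A median of X under the density rho: c is the supremum of the t for which {X <= t} carries at
    most half of the mass. The level set {X = c} is null, so both open sides carry exactly half. *)
Lemma exists_half : exists c, mass [set x | X x < c] = mass [set x | c < X x].
Proof.
pose S := [set t : R | fine (mass [set x | (X x <= t)%R]) <= M / 2].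
have S0 : S !=set0.
  apply: contrapT => h.
  have hk k : (mass [set x | (- k%:R < X x)%R] <= (M / 2)%:E)%E.
    rewrite -(fineK (mass_fin (mgt _))) lee_fin.
    have := split_le (- k%:R); have : ~ S (- k%:R) by move=> hS; apply: h; exists (- k%:R).
    by move=> /negP; rewrite -ltNge; lra.
  have := mass_bigcup_le (fun k => mgt (- k%:R)) _ hk.
  have -> : \bigcup_k [set x | - k%:R < X x] = setT.
    apply/seteqP; split => // x _; exists (Num.truncn `|X x|).+1 => //=.
    rewrite ltrNl; apply: (@le_lt_trans _ _ `|X x|); first by rewrite -normrN ler_norm.
    by rewrite -truncn_lt_nat.
  rewrite massT lee_fin => hM; have : M <= M / 2.
    apply: hM => k x /=; apply: le_lt_trans; by rewrite lerN2 ler_nat.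
  by move=> hM2; move: M0 hM2; lra.
have Sb : has_ubound S.
  apply: contrapT => h.
  have hk k : (mass [set x | (X x <= k%:R)%R] <= (M / 2)%:E)%E.
    rewrite -(fineK (mass_fin (mle _))) lee_fin.
    have [t St kt] : exists2 t, S t & k%:R <= t.
      apply: contrapT => h2; apply: h; exists k%:R => t St; rewrite leNgt; apply/negP => kt.
      by apply: h2; exists t => //; exact: ltW.
    exact: le_trans (mono kt) St.
  have := mass_bigcup_le (fun k => mle k%:R) _ hk.
  have -> : \bigcup_k [set x | X x <= k%:R] = setT.
    apply/seteqP; split => // x _; exists (Num.truncn `|X x|).+1 => //=.
    rewrite ltW// (le_lt_trans (ler_norm _))//.
    by rewrite -truncn_lt_nat.
  rewrite massT lee_fin => hM; have : M <= M / 2.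
    apply: hM => k x /= hx; apply: (le_trans hx); by rewrite ler_nat.
  by move=> hM2; move: M0 hM2; lra.
have hS : has_sup S by [].
pose c := sup S; exists c.
have lo : (mass [set x | (X x < c)%R] <= (M / 2)%:E)%E.
  have -> : [set x | X x < c] = \bigcup_k [set x | X x <= c - k.+1%:R^-1].
    apply/seteqP; split => x /=.
      move=> h; have [k hk] := nat_lt (e := c - X x) (ltac:(by rewrite subr_gt0)).
      by exists k => //=; rewrite lerBrDr -lerBrDl ltW.
    by move=> [k _] /= /le_lt_trans; apply; rewrite ltrBlDr ltrDl invr_gt0.
  apply: mass_bigcup_le => [k//|k x /= hx|k].
    by apply: (le_trans hx); rewrite lerD2l lerN2 lef_pV2 ?posrE// ler_nat.
  rewrite -(fineK (mass_fin (mle _))) lee_fin.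
  have e0 : 0 < k.+1%:R^-1 :> R by rewrite invr_gt0.
  have [t St /ltW ht] := sup_adherent e0 hS; exact: le_trans (mono ht) St.
have hi : (mass [set x | (c < X x)%R] <= (M / 2)%:E)%E.
  have -> : [set x | c < X x] = \bigcup_k [set x | c + k.+1%:R^-1 < X x].
    apply/seteqP; split => x /=.
      move=> h; have [k hk] := nat_lt (e := X x - c) (ltac:(by rewrite subr_gt0)).
      by exists k => //=; rewrite -ltrBrDl.
    by move=> [k _] /=; apply: lt_trans; rewrite ltrDl invr_gt0.
  apply: mass_bigcup_le => [k//|k x /=|k].
    by apply: le_lt_trans; rewrite lerD2l lef_pV2 ?posrE// ler_nat.
  rewrite -(fineK (mass_fin (mgt _))) lee_fin.
  have e0 : 0 < k.+1%:R^-1 :> R by rewrite invr_gt0.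
  have : ~ S (c + k.+1%:R^-1).
    move=> /(sup_upper_bound hS); by rewrite gerDl leNgt e0.
  by move=> /negP; rewrite -ltNge; have := split_le (c + k.+1%:R^-1); lra.
have me : measurable [set x : T3 | X x = c].
  by rewrite -[in measurable _](setTI [set x : T3 | X x = c]); exact: (mX measurableT (measurable_set1 c)).
have mid : mass [set x | X x = c] = 0%E.
  have mE := mErho (A := [set x : T3 | X x = c]).
  exact: (@null_set_integral _ T3 R mu3 _ _ me mE (X0 c)).
have full : (fine (mass [set x | (X x < c)%R]) + fine (mass [set x | (c < X x)%R]) = M)%R.
  rewrite -(split_le c); congr (fine _ + _).
  have -> : [set x | X x <= c] = [set x | X x < c] `|` [set x | X x = c].
    apply/seteqP; split => x /=; rewrite le_eqVlt; first by move=> /orP[/eqP|]; [right|left].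
    by move=> [->|->]; rewrite ?eqxx ?orbT.
  rewrite massU ?mid ?adde0//; apply/seteqP; split => x //= -[h1 h2]; by rewrite h2 ltxx in h1.
have h1 : fine (mass [set x | (X x < c)%R]) <= M / 2 by rewrite -lee_fin fineK// mass_fin.
have h2 : fine (mass [set x | (c < X x)%R]) <= M / 2 by rewrite -lee_fin fineK// mass_fin.
rewrite -(fineK (mass_fin (mlt c))) -(fineK (mass_fin (mgt c))); congr EFin.
by move: full h1 h2; lra.
Qed.
End half.

Lemma massE (P : T3 -> bool) : measurable_fun setT P ->
  mass [set x | P x] = (\int[mu3]_x (rho x * (P x)%:R)%:E)%E.
Proof.
move=> mP; rewrite /mass [LHS]integral_mkcond; apply: eq_integral => x _.
have -> : patch (fun=> 0%E) [set x | P x] (fun x => (rho x)%:E) x = if P x then (rho x)%:E else 0%E.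
  by rewrite /patch; congr (if _ then _ else _); apply/idP/idP => [/set_mem|/mem_set].
by case: (P x); rewrite ?mulr1 ?mulr0.
Qed.

Lemma ae_eq_of_le (f g : T3 -> R) : measurable_fun setT f -> measurable_fun setT g ->
  (forall x, 0 <= f x) -> (forall x, 0 <= g x) -> {ae mu3, forall x, f x <= g x} ->
  (\int[mu3]_x (f x)%:E < +oo)%E -> (\int[mu3]_x (f x)%:E = \int[mu3]_x (g x)%:E)%E ->
  {ae mu3, forall x, f x = g x}.
Proof.
move=> mf mg f0 g0 fg ffin e.
pose h x := Num.max (f x) (g x) - f x.
have mh : measurable_fun setT h by rewrite /h; meas.
have h0 x : 0 <= h x by rewrite subr_ge0 le_max lexx.
have eh : (\int[mu3]_x (f x)%:E + \int[mu3]_x (h x)%:E = \int[mu3]_x (g x)%:E)%E.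
  rewrite -(ge0_integralD_EFin mu3 mf mh f0 h0); apply: ge0_ae_eq_integral => //.
  - by apply/measurable_EFinP; apply: measurable_funD.
  - exact/measurable_EFinP.
  - by move=> x _; rewrite lee_fin addr_ge0.
  - by move=> x _; rewrite lee_fin.
  - by apply: filterS fg => x fgx _; rewrite /h addrC subrK max_r.
have ff := integral_ge0_fin_num f0 ffin.
have h00 : (\int[mu3]_x (h x)%:E = 0)%E.
  apply/eqP; rewrite eq_le integral_ge0 ?andbT; last by move=> x _; rewrite lee_fin.
  by rewrite -(leeD2lE _ _ ff) eh -e adde0.
have mEh : measurable_fun setT (fun x => (h x)%:E) by exact/measurable_EFinP.
have hE0 x : (0 <= (h x)%:E)%E by rewrite lee_fin.
have F := ae_filter_ringOfSetsType mu3.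
apply: (@filterS2 _ _ F _ _ _ _ fg (ge0_integral0_ae mEh hE0 h00)) => x fgx [].
by rewrite /h max_r// => /eqP; rewrite subr_eq0 => /eqP.
Qed.

(** On the side l > 0, rho and its mirror image are ordered and have the same integral because the
    plane halves the mass; hence they agree there, and T carries the equality to the other side. *)
Lemma reflection_symmetric T l : reflection T l ->
  {ae mu3, forall x, 0 <= l x -> rho (T x) <= rho x} \/
  {ae mu3, forall x, 0 <= l x -> rho x <= rho (T x)} ->
  mass [set x | l x < 0] = mass [set x | 0 < l x] ->
  {ae mu3, forall x, rho (T x) = rho x}.
Proof.
move=> HT sign half.
have ml := reflection_meas HT; have [mT _] := reflection_mpres HT.
have mrT : measurable_fun setT (fun x => rho (T x)) by exact: (measurableT_comp mrho mT).
pose g x := rho x * (0 < l x)%R%:R; pose f x := rho (T x) * (0 < l x)%R%:R.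
have mf : measurable_fun setT f by rewrite /f; meas.
have mg : measurable_fun setT g by rewrite /g; meas.
have f0 x : 0 <= f x by rewrite mulr_ge0.
have g0 x : 0 <= g x by rewrite mulr_ge0.
have gE : mass [set x | 0 < l x] = (\int[mu3]_x (g x)%:E)%E by apply: massE; meas.
have fE : mass [set x | l x < 0] = (\int[mu3]_x (f x)%:E)%E.
  rewrite massE; last by meas.
  have mn : measurable_fun setT (fun x => (rho x * (l x < 0)%R%:R)%:E) by meas.
  have n0 x : (0 <= (rho x * (l x < 0)%R%:R)%:E)%E by rewrite lee_fin mulr_ge0.
  rewrite -(integral_reflection HT mn n0).
  by apply: eq_integral => x _; rewrite (reflectionN HT) oppr_lt0.
have fin : (\int[mu3]_x (g x)%:E < +oo)%E.
  have mpos : measurable [set x : T3 | 0 < l x].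
    exact: (@measurable_set_ltr _ T3 _ _ _ (@measurable_cst _ _ T3 R setT 0) ml).
  by rewrite -gE ltey_eq mass_fin.
have fg : (\int[mu3]_x (f x)%:E = \int[mu3]_x (g x)%:E)%E by rewrite -fE -gE.
have main : {ae mu3, forall x, 0 < l x -> rho (T x) = rho x}.
  case: sign => sign.
  - have le : {ae mu3, forall x, f x <= g x}.
      apply: filterS sign => x; rewrite /f /g; case: ltP => [l0 h|_ _]; last by rewrite !mulr0.
      by rewrite !mulr1 h// ltW.
    have := ae_eq_of_le mf mg f0 g0 le; rewrite fg => /(_ fin erefl).
    by apply: filterS => x; rewrite /f /g => h l0; move: h; rewrite l0 !mulr1.
  - have le : {ae mu3, forall x, g x <= f x}.
      apply: filterS sign => x; rewrite /f /g; case: ltP => [l0 h|_ _]; last by rewrite !mulr0.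
      by rewrite !mulr1 h// ltW.
    have := ae_eq_of_le mg mf g0 f0 le fin (esym fg).
    by apply: filterS => x; rewrite /f /g => h l0; move: h; rewrite l0 !mulr1.
have F := ae_filter_ringOfSetsType mu3.
apply: (@filterS2 _ _ F _ _ _ _ main (mpres_ae (reflection_mpres HT) main)) => x h1 h2.
case: (ltgtP (l x) 0) => l0; last by rewrite (reflection_fix HT l0).
- by move: h2; rewrite (reflectionN HT) oppr_gt0 (reflectionK HT) => /(_ l0).
- exact: h1.
Qed.

(** The density is invariant only almost everywhere, but its potential at every point. From here on
    symmetry is used through the potential. *)
Lemma pot_invariant T x : mpres T -> (forall x y, ker (T x) (T y) = ker x y) ->
  {ae mu3, forall x, rho (T x) = rho x} -> pot rho (T x) = pot rho x.
Proof.
move=> mp kT inv; have [mT _] := mp; rewrite !potEint.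
have mk z : measurable_fun setT (fun y => (rho y * ker z y)%:E).
  by apply/measurable_EFinP; apply: measurable_funM => //; apply: measurable_ker_comp => //; exact: measurable_cst.
have k0 z y : (0 <= (rho y * ker z y)%:E)%E by rewrite lee_fin mulr_ge0// ker_ge0.
rewrite -(mp.2 _ (mk (T x)) (k0 (T x))); apply: ge0_ae_eq_integral => //.
- exact: (measurableT_comp (mk (T x)) mT).
- by apply: filterS inv => y hy _; rewrite hy kT.
Qed.
End mass.

Lemma mu3_product (A B C : set T1) : measurable A -> measurable B -> measurable C ->
  mu3 ((A `*` B) `*` C) = (@lebesgue_measure R A * @lebesgue_measure R B * @lebesgue_measure R C)%E.
Proof.
move=> mA mB mC; rewrite -leb3E.
apply: (etrans (sprodE (sprod (@lebesgue_measure R) (@lebesgue_measure R)) _ (measurableX mA mB) mC)).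
exact: (congr1 (fun z => z * _)%E (sprodE _ _ mA mB)).
Qed.

Lemma coord1_null c : mu3 [set x | coord1 x = c] = 0%E.
Proof.
have -> : [set x | coord1 x = c] = (([set c] `*` setT) `*` setT).
  by apply/seteqP; split => -[[a b] d] //= [[]].
rewrite mu3_product// lebesgue_measure_set1 mul0e mul0e//.
Qed.

Lemma coord2_null c : mu3 [set x | coord2 x = c] = 0%E.
Proof.
have -> : [set x | coord2 x = c] = ((setT `*` [set c]) `*` setT).
  by apply/seteqP; split => -[[a b] d] //= [[]].
rewrite mu3_product// lebesgue_measure_set1 mule0 mul0e//.
Qed.

Lemma coord3_null c : mu3 [set x | coord3 x = c] = 0%E.
Proof.
have -> : [set x | coord3 x = c] = ((setT `*` setT) `*` [set c]).
  by apply/seteqP; split => -[[a b] d] //= [].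
rewrite mu3_product// lebesgue_measure_set1 mule0//.
Qed.

Section minimizer_symmetry.
Variables (Phi dPhi : R -> R) (H : profile Phi dPhi) (M : R) (M0 : 0 < M).
Variables (rho : T3 -> R) (minrho : is_minimizer Phi M rho).
Let Frho : FM Phi M rho. Proof. by case: minrho. Qed.
Let mrho : measurable_fun setT rho. Proof. by have [] := FMP Frho. Qed.
Let rho_ge0 x : 0 <= rho x. Proof. by have [] := FMP Frho. Qed.
Let rhoM : (\int[mu3]_x (rho x)%:E = M%:E)%E. Proof. by have [] := FMP Frho. Qed.

Let minimizer_sign T l : reflection T l ->
  {ae mu3, forall x, 0 <= l x -> rho (T x) <= rho x} \/
  {ae mu3, forall x, 0 <= l x -> rho x <= rho (T x)}.
Proof.
move=> HT; have Lrho := FM_L43 H Frho.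
apply: (polarize_sign HT mrho rho_ge0); first exact: mutual_fin.
set s := polarize T l rho.
have ms : measurable_fun setT s by exact: (measurable_polarize HT).
have s0 x : 0 <= s x by exact: (polarize_ge0 HT).
have PhiE : (\int[mu3]_x (Phi (s x))%:E = \int[mu3]_x (Phi (rho x))%:E)%E.
  apply: (integral_polarize HT rho_ge0 (g := Phi)).
  - exact: (measurable_Phi_comp H mrho rho_ge0).
  - exact: (measurable_Phi_comp H ms s0).
  - by move=> r; exact: (profile_ge0 H).
have Fs : FM Phi M s.
  have [_ _ pf rM] := FMP Frho.
  apply: FM_intro => //; first by rewrite PhiE.
  by rewrite -rM; apply: (integral_polarize HT rho_ge0 (g := id)).
have Ls := FM_L43 H Fs.
have := minimizer_le H minrho Fs; rewrite PhiE => h.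
rewrite (mutual_fineK Ls Ls) (mutual_fineK Lrho Lrho) lee_fin; lra.
Qed.

(** Oddness of l makes the conjugated plane pass through x0 and makes point reflection at x0
    exchange its two sides. *)
Lemma minimizer_center : exists x0 : T3, forall T l, reflection T l ->
  (forall x, l (- x) = - l x) -> {ae mu3, forall x, rho (T (x - x0) + x0) = rho x}.
Proof.
have [c1 h1] := exists_half mrho rho_ge0 rhoM M0 (reflection_meas reflection_flip1) coord1_null.
have [c2 h2] := exists_half mrho rho_ge0 rhoM M0 (reflection_meas reflection_flip2) coord2_null.
have [c3 h3] := exists_half mrho rho_ge0 rhoM M0 (reflection_meas reflection_flip3) coord3_null.
pose x0 : T3 := ((c1, c2), c3); exists x0.
have sym T l : reflection T l -> mass rho [set x | l x < 0] = mass rho [set x | 0 < l x] ->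
    {ae mu3, forall x, rho (T x) = rho x}.
  by move=> HT; apply: (reflection_symmetric mrho rho_ge0 rhoM HT); exact: minimizer_sign.
pose cj (T : T3 -> T3) := fun x => T (x - x0) + x0.
have s1 : {ae mu3, forall x, rho (cj flip1 x) = rho x}.
  apply: (sym _ _ (reflection_conj x0 reflection_flip1)).
  move: h1; congr (mass _ _ = mass _ _); apply/seteqP; split => x /=;
  by rewrite /coord1 /= ?subr_lt0 ?subr_gt0.
have s2 : {ae mu3, forall x, rho (cj flip2 x) = rho x}.
  apply: (sym _ _ (reflection_conj x0 reflection_flip2)).
  move: h2; congr (mass _ _ = mass _ _); apply/seteqP; split => x /=;
  by rewrite /coord2 /= ?subr_lt0 ?subr_gt0.
have s3 : {ae mu3, forall x, rho (cj flip3 x) = rho x}.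
  apply: (sym _ _ (reflection_conj x0 reflection_flip3)).
  move: h3; congr (mass _ _ = mass _ _); apply/seteqP; split => x /=;
  by rewrite /coord3 /= ?subr_lt0 ?subr_gt0.
have p1 := reflection_mpres (reflection_conj x0 reflection_flip1).
have p2 := reflection_mpres (reflection_conj x0 reflection_flip2).
have p3 := reflection_mpres (reflection_conj x0 reflection_flip3).
pose N := cj flip1 \o (cj flip2 \o cj flip3).
have pN : mpres N by exact: (mpres_comp p1 (mpres_comp p2 p3)).
have NE x : N x - x0 = - (x - x0).
  by rewrite /N /cj /= !addrK; case: x => -[a b] c.
have F := ae_filter_ringOfSetsType mu3.
have sN : {ae mu3, forall x, rho (N x) = rho x}.
  have t1 := mpres_ae (mpres_comp p2 p3) s1.
  have t2 := mpres_ae p3 s2.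
  apply: (@filterS2 _ _ F _ _ _ _ t1 (@filterS2 _ _ F _ _ _ (fun x => @conj _ _) t2 s3)) => x e1 [e2 e3].
  by rewrite /N /= e1 /= e2.
move=> T l HT lN; apply: (sym _ _ (reflection_conj x0 HT)).
have ml := reflection_meas (reflection_conj x0 HT).
set l' := (fun x => l (x - x0)) in ml *.
have mn : measurable_fun setT (fun x => (rho x * (l' x < 0)%R%:R)%:E) by meas.
have n0 x : (0 <= (rho x * (l' x < 0)%R%:R)%:E)%E by rewrite lee_fin mulr_ge0.
rewrite (@massE _ (fun x => l' x < 0)); last by meas.
rewrite (@massE _ (fun x => 0 < l' x)); last by meas.
rewrite -(pN.2 _ mn n0); apply: ge0_ae_eq_integral => //.
- exact: (measurableT_comp mn pN.1).
- by meas.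
- by move=> x _; rewrite lee_fin mulr_ge0.
- apply: filterS sN => x hx _; by rewrite hx /l' NE lN oppr_lt0.
Qed.

(** Two mirrors through the centre take any point to the nonnegative third axis: one in the first
    two coordinates annihilates the first, one in the last two the second. The choice p = - b/r, q =
    a/r sends (a, b) to (0, r). *)
Lemma minimizer_pot_radial : exists x0 : T3, forall x, pot rho x = pot rho ((0, 0, enorm (x - x0)) + x0).
Proof.
have [x0 h] := minimizer_center; exists x0.
pose v (z : T3) := pot rho (z + x0).
have inv T l z : reflection T l -> (forall x, l (- x) = - l x) -> v (T z) = v z.
  move=> HT lN; have HT' := reflection_conj x0 HT.
  have := pot_invariant mrho rho_ge0 (z + x0) (reflection_mpres HT') (reflection_ker HT') (h _ _ HT lN).
  by rewrite addrK.
have unit (a b : R) : a != 0 -> let r := Num.sqrt (a ^+ 2 + b ^+ 2) in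
    [/\ r != 0, r ^+ 2 = a ^+ 2 + b ^+ 2, (- b / r) ^+ 2 + (a / r) ^+ 2 = 1 & a / r != 0].
  move=> a0 r; have s0 : 0 < a ^+ 2 + b ^+ 2.
    by rewrite ltr_wpDr ?sqr_ge0// lt_neqAle sqr_ge0 andbT eq_sym sqrf_eq0.
  have r0 : r != 0 by rewrite gt_eqF// sqrtr_gt0.
  have r2 : r ^+ 2 = a ^+ 2 + b ^+ 2 by rewrite sqr_sqrtr// ltW.
  split => //; last by rewrite mulf_neq0// invr_eq0.
  by rewrite !expr_div_n sqrrN -mulrDl addrC r2 divff// gt_eqF.
have v2 (b c : R) : v (0, b, c) = v (0, 0, Num.sqrt (b ^+ 2 + c ^+ 2)).
  have [->|b0] := eqVneq b 0.
    rewrite expr0n add0r sqrtr_sqr; case: (leP 0 c) => c0; first by rewrite ger0_norm.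
    by rewrite ltr0_norm// -(inv _ _ (0, 0, c) reflection_flip3).
  have [r0 r2 pq q0] := unit b c b0.
  set r := Num.sqrt _ in r0 r2 pq q0 *.
  rewrite -(inv _ _ _ (reflection_mirror23 pq q0)); last by move=> x /=; ring.
  congr v; rewrite /mirror23 /=; congr (_, _, _); first by field.
  transitivity ((b ^+ 2 + c ^+ 2) / r); first by field.
  by rewrite -r2 expr2 mulfK.
have v3 (a b c : R) : v (a, b, c) = v (0, 0, Num.sqrt (a ^+ 2 + b ^+ 2 + c ^+ 2)).
  have [->|a0] := eqVneq a 0; first by rewrite expr0n add0r v2.
  have [r0 r2 pq q0] := unit a b a0.
  set r := Num.sqrt _ in r0 r2 pq q0 *.
  rewrite -(inv _ _ _ (reflection_mirror12 pq q0)); last by move=> x /=; ring.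
  rewrite (_ : mirror12 _ _ _ = (0, r, c)); first by rewrite v2 r2.
  rewrite /mirror12 /=; congr (_, _, _); first by field.
  transitivity ((a ^+ 2 + b ^+ 2) / r); first by field.
  by rewrite -r2 expr2 mulfK.
move=> x; rewrite enormE -[in LHS](subrK x0 x) -/(v _) -/(v (0, 0, _)).
by case: (x - x0) => -[a b] c; rewrite v3.
Qed.
End minimizer_symmetry.
End symmetry.

(** * The radial potential *)

Section radial.
Variable R : realType.
Local Notation T1 := (measurableTypeR R).
Local Notation leb := (@lebesgue_measure R).
Variables (Phi dPhi : R -> R) (H : profile Phi dPhi).

(** Phi' grows at least like r^(1/n), so its inverse at most like u^n; n < 3 then turns an argument
    of order w^(-1/4) into a density of order at most w^(-3/4), which is integrable at 0. *)
Lemma ginv_growth : exists2 C, 0 < C & forall b w, 0 <= b -> 0 < w < 1 ->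
  ginv dPhi (b * w `^ (- 4^-1)) <= C * (1 + b) ^+ 3 * w `^ (- (3 / 4)).
Proof.
have [n [C [r0 [/andP[n0 n3] C0 r00 h]]]] := profile_d_growth H.
pose A := Num.max 1 C^-1.
have A1 : 1 <= A by rewrite le_max lexx.
have A0 : 0 < A := lt_le_trans ltr01 A1.
exists (r0 + A ^+ 3); first by rewrite addr_gt0// exprn_gt0.
move=> b w b0 /andP[w0 w1].
set t := w `^ (- 4^-1).
have t1 : 1 <= t by rewrite -[leLHS](powRr0 w); apply: ger_powR; [rewrite w0 ltW|rewrite oppr_le0].
have t3 : w `^ (- (3 / 4)) = t ^+ 3.
  by rewrite -powR_mulrn ?powR_ge0// -powRrM; congr (_ `^ _); field.
rewrite t3; set r := ginv dPhi (b * t).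
have r_ge0 : 0 <= r by exact: (ginv_ge0 H).
have U0 : 0 <= b * t by rewrite mulr_ge0// powR_ge0.
have base : 1 <= (1 + b) * t by nra.
have base3 : 1 <= ((1 + b) * t) ^+ 3 by exact: exprn_ege1.
rewrite -mulrA -exprMn; move: base base3; set X := (1 + b) * t => base base3.
have X0 : 0 <= X ^+ 3 := le_trans ler01 base3.
have [rr|rr] := ltP r r0.
  apply: (@le_trans _ _ (r0 * 1)); first by rewrite mulr1 ltW.
  by rewrite mulrDl ler_wpDr ?ler_pM2l// mulr_ge0// exprn_ge0 ?(ltW A0).
apply: (@le_trans _ _ (A ^+ 3 * X ^+ 3)); last first.
  by rewrite mulrDl lerDr mulr_ge0// ltW.
rewrite -exprMn.
have h1 : C * r `^ n^-1 <= b * t by have := h _ rr; rewrite (dPhi_ginv H U0).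
have h2 : r `^ n^-1 <= A * X.
  apply: (@le_trans _ _ (C^-1 * (b * t))); first by rewrite -ler_pdivrMl ?invr_gt0// invrK.
  apply: ler_pM => //; first by rewrite invr_ge0 ltW.
    by rewrite le_max lexx orbT.
  by rewrite /X mulrDl lerDr mul1r (le_trans ler01).
have -> : r = (r `^ n^-1) `^ n by rewrite -powRrM mulVf ?gt_eqF// powRr1.
have A2 : 1 <= A * X by rewrite -[leLHS]mulr1; apply: ler_pM.
apply: (@le_trans _ _ ((A * X) `^ n)).
  by apply: ge0_ler_powR; rewrite ?nnegrE ?powR_ge0 ?(ltW n0)// (le_trans ler01).
rewrite -powR_mulrn ?(le_trans ler01)//; apply: ler_powR => //; exact: ltW.
Qed.

Variables (M E0 : R) (M0 : 0 < M) (E00 : E0 <= 0).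
(** u is the possibly infinite potential as a function of the radius, h the density as a function of
    the squared radius. The hypotheses are those delivered by [minimizer_radial]. *)
Variables (u : R -> \bar R) (h : R -> R).
Hypothesis mh : measurable_fun setT h.
Hypothesis h0 : forall w, 0 <= h w.
Hypothesis hM : (\int[leb]_w (h w * shell w)%:E = M%:E)%E.
Hypothesis h43 : (\int[leb]_w (h w `^ (4 / 3) * shell w)%:E < +oo)%E.
Hypothesis uE : forall r, 0 <= r ->
  (u r = \int[leb]_w (h w * (shell w / Num.max r (Num.sqrt w)))%:E)%E.
Hypothesis hE : forall w, h w = ginv dPhi (E0 + fine (u (Num.sqrt w))).

Let msh : measurable_fun setT (@shell R). Proof. exact: measurable_shell. Qed.

Let integrand_ge0 r w : 0 <= r -> 0 <= h w * (shell w / Num.max r (Num.sqrt w)).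
Proof. by move=> r0; rewrite mulr_ge0// divr_ge0 ?shell_ge0// le_max r0. Qed.

Let m_integrand r : measurable_fun setT (fun w => h w * (shell w / Num.max r (Num.sqrt w))).
Proof. by meas. Qed.

Lemma radial_pot_le_mass r : 0 < r -> (u r <= (M / r)%:E)%E.
Proof.
move=> r0; rewrite uE ?(ltW r0)// mulrC EFinM -hM.
rewrite -(ge0_integralZl_real leb _ _ (ltW (_ : 0 < r^-1))); last 3 first.
- by meas.
- by move=> w; rewrite mulr_ge0// shell_ge0.
- by rewrite invr_gt0.
apply: ge0_le_integral => //.
- by move=> w _; rewrite lee_fin integrand_ge0// ltW.
- by meas.
- by meas.
- move=> w _; rewrite lee_fin [leRHS]mulrCA; apply: ler_wpM2l => //.
  rewrite [leRHS]mulrC; apply: ler_wpM2l; first exact: shell_ge0.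
  by rewrite lef_pV2 ?posrE ?lt_max ?r0// le_max lexx.
Qed.

Lemma radial_pot_ge0 r : 0 <= r -> (0 <= u r)%E.
Proof. by move=> r0; rewrite uE//; apply: integral_ge0 => w _; rewrite lee_fin integrand_ge0. Qed.

(* Young's inequality with exponents 4/3 and 4; it bounds V (sqrt w) by a multiple of w^(-1/4), so
   that h is at most of order w^(-3/4) near the origin and V 0 is finite. *)
Let young (a w : R) : 0 <= a -> 0 < w < 1 -> a * w `^ 4^-1 <= a `^ (4 / 3) * w `^ 2^-1 + w `^ (- 2^-1).
Proof.
move=> a0 /andP[w0 w1].
have pw (x y : R) : w `^ (x + y) = w `^ x * w `^ y by rewrite powRD// (gt_eqF w0) implybT.
have := powR_ge0 w 4^-1; have := powR_ge0 w 2^-1; have := powR_ge0 w (- 2^-1) => p1 p2 p3.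
have [aw|aw] := leP a (w `^ (- (3 / 4))).
  rewrite ler_wpDl ?mulr_ge0 ?powR_ge0//.
  apply: (@le_trans _ _ (w `^ (- (3 / 4)) * w `^ 4^-1)); first exact: ler_wpM2r.
  by rewrite -pw le_eqVlt; apply/orP; left; apply/eqP; congr (_ `^ _); field.
have ap : 0 < a := le_lt_trans (powR_ge0 _ _) aw.
rewrite ler_wpDr//.
have -> : a `^ (4 / 3) = a * a `^ 3^-1.
  rewrite (_ : 4 / 3 = 1 + 3^-1); last by field.
  by rewrite powRD ?(gt_eqF ap) ?implybT// powRr1// ltW.
rewrite -mulrA ler_pM2l//.
have h1 : w `^ (- 4^-1) <= a `^ 3^-1.
  rewrite (_ : - 4^-1 = - (3 / 4) * 3^-1); last by field.
  by rewrite powRrM; apply: ge0_ler_powR; rewrite ?nnegrE ?powR_ge0// ltW.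
apply: (@le_trans _ _ (w `^ (- 4^-1) * w `^ 2^-1)); last exact: ler_wpM2r.
by rewrite -pw le_eqVlt; apply/orP; left; apply/eqP; congr (_ `^ _); field.
Qed.

(** An integrable majorant of 2 pi h(w) w^(1/4): the L^(4/3) term and the pure power come from
    [young] for w < 1, the mass term covers w >= 1. *)
Let G (w : R) : R := h w * shell w + h w `^ (4 / 3) * shell w + 2 * pi * (w `^ (- 2^-1) * (0 < w < 1)%R%:R).

Let G_ge0 w : 0 <= G w.
Proof.
have p0 := pi_ge0 R.
by rewrite /G !addr_ge0// !mulr_ge0// ?shell_ge0 ?powR_ge0.
Qed.

Let mG : measurable_fun setT G.
Proof. by rewrite /G; meas. Qed.

Let G_fin : (\int[leb]_w (G w)%:E < +oo)%E.
Proof.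
have p0 := pi_ge0 R.
have pw (w : R) : 0 <= w `^ (- 2^-1) * (0 < w < 1)%R%:R by rewrite mulr_ge0// powR_ge0.
have mpw : measurable_fun setT (fun w : R => w `^ (- 2^-1) * (0 < w < 1)%R%:R) by meas.
rewrite /G ge0_integralD_EFin; first last.
- by move=> w; rewrite mulr_ge0 ?pw// mulr_ge0.
- by move=> w; rewrite addr_ge0// mulr_ge0 ?shell_ge0// powR_ge0.
- exact: measurable_funM.
- by meas.
rewrite ge0_integralD_EFin; first last.
- by move=> w; rewrite mulr_ge0 ?shell_ge0// powR_ge0.
- by move=> w; rewrite mulr_ge0 ?shell_ge0.
- by meas.
- by meas.
have c0 : 0 <= 2 * pi :> R by rewrite mulr_ge0.
rewrite hM (ge0_integralZl_real leb mpw pw c0) lte_add_pinfty//.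
  by rewrite lte_add_pinfty// ltry.
by rewrite lte_mul_pinfty// ?lee_fin//; apply: integral_powR_fin; lra.
Qed.

(** The maximum of two numbers is at least their geometric mean, so 1/max(sqrt w, sqrt s) <=
    w^(-1/4) s^(-1/4). What remains is the integral of 2 pi h(s) s^(1/4), bounded by that of G. *)
Lemma radial_pot_le_powR : exists2 K, 0 <= K & forall w, 0 < w -> (u (Num.sqrt w) <= (K * w `^ (- 4^-1))%:E)%E.
Proof.
have p0 := pi_ge0 R.
have GK : (\int[leb]_w (G w)%:E)%E = (fine (\int[leb]_w (G w)%:E)%E)%:E.
  by rewrite fineK// ge0_fin_numE// integral_ge0// => w _; rewrite lee_fin.
exists (fine (\int[leb]_w (G w)%:E)%E).
  by rewrite fine_ge0// integral_ge0// => w _; rewrite lee_fin.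
move=> w w0; rewrite mulrC EFinM -GK uE ?sqrtr_ge0//.
rewrite -(ge0_integralZl_real leb mG G_ge0 (powR_ge0 w _)).
apply: ge0_le_integral => //.
- by move=> s _; rewrite lee_fin integrand_ge0// sqrtr_ge0.
- by apply/measurable_EFinP; exact: m_integrand.
- by apply/measurable_EFinP; exact: measurable_funM.
move=> s _; rewrite lee_fin.
have [s0|s0] := leP s 0.
  by rewrite /shell (ler0_sqrtr s0) mulr0 mul0r mulr0 mulr_ge0// powR_ge0.
have m1 : (Num.max (Num.sqrt w) (Num.sqrt s))^-1 <= w `^ (- 4^-1) * s `^ (- 4^-1).
  rewrite !powRN -invfM.
  have a0 := powR_gt0 4^-1 w0; have b0 := powR_gt0 4^-1 s0.
  have sq (x : R) : 0 < x -> Num.sqrt x = x `^ 4^-1 * x `^ 4^-1.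
    by move=> x0; rewrite -(powR12_sqrt (ltW x0)) -powRD ?(gt_eqF x0) ?implybT//; congr (_ `^ _); field.
  rewrite lef_pV2 ?posrE ?mulr_gt0// ?lt_max ?sqrtr_gt0 ?w0// le_max (sq _ w0) (sq _ s0).
  by rewrite (ler_pM2l a0) (ler_pM2r b0); case: leP => //= /ltW.
apply: (@le_trans _ _ (h s * (shell s * (w `^ (- 4^-1) * s `^ (- 4^-1))))).
  by rewrite ler_wpM2l// ler_wpM2l ?shell_ge0.
have -> : h s * (shell s * (w `^ (- 4^-1) * s `^ (- 4^-1))) = w `^ (- 4^-1) * (2 * pi * (h s * s `^ 4^-1)).
  rewrite /shell -(powR12_sqrt (ltW s0)).
  have -> : s `^ 2^-1 = s `^ 4^-1 * s `^ 4^-1 by rewrite -powRD ?(gt_eqF s0) ?implybT//; congr (_ `^ _); field.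
  have := mulVf (x := s `^ 4^-1); rewrite -powRN => /(_ (lt0r_neq0 (powR_gt0 _ s0))) e.
  by transitivity (2 * pi * h s * s `^ 4^-1 * w `^ (- 4^-1) * (s `^ (- 4^-1) * s `^ 4^-1)); [ring|rewrite e; ring].
apply: ler_wpM2l; first exact: powR_ge0.
have a0 : 0 <= h s `^ (4 / 3) by exact: powR_ge0.
rewrite /G /shell -(powR12_sqrt (ltW s0)) s0 /=.
have [s1|s1] := ltP s 1.
  have := young (h0 s) (w := s); rewrite s0 s1 => /(_ isT) y.
  rewrite mulr1; have : 0 <= h s * (2 * pi * s `^ 2^-1) by rewrite !mulr_ge0 ?powR_ge0.
  have : 2 * pi * (h s * s `^ 4^-1) <= 2 * pi * (h s `^ (4 / 3) * s `^ 2^-1 + s `^ (- 2^-1)).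
    by apply: ler_wpM2l => //; rewrite mulr_ge0.
  by lra.
rewrite mulr0 mulr0 addr0 ler_wpDr ?mulr_ge0 ?powR_ge0//.
rewrite mulrCA; apply: ler_wpM2l => //; apply: ler_wpM2l; first by rewrite mulr_ge0.
by apply: ler_powR => //; rewrite lef_pV2 ?posrE// ler_nat.
Qed.

(** At r = 0 the weight shell w / sqrt w is the constant 2 pi. For w < 1, [ginv_growth] bounds h by
    a multiple of w^(-3/4); for w >= 1 the mass density dominates. *)
Let pot0_bound K : 0 <= K -> (forall w, 0 < w -> (u (Num.sqrt w) <= (K * w `^ (- 4^-1))%:E)%E) ->
  exists2 C, 0 <= C & forall w, h w * (shell w / Num.max 0 (Num.sqrt w)) <=
    h w * shell w + C * (w `^ (- (3 / 4)) * (0 < w < 1)%R%:R).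
Proof.
move=> K0 hK; have [C C0 hC] := ginv_growth; have p0 := pi_ge0 R.
have D0 : 0 <= C * (1 + K) ^+ 3 by rewrite mulr_ge0 ?ltW// exprn_gt0//; lra.
exists (2 * pi * (C * (1 + K) ^+ 3)); first by rewrite mulr_ge0 ?D0// mulr_ge0.
move=> w; have [w0|w0] := leP w 0.
  by rewrite /shell ler0_sqrtr// !(mulr0, mul0r, add0r).
have s0 : 0 < Num.sqrt w by rewrite sqrtr_gt0.
rewrite /= max_r ?(ltW s0)//; have [w1|w1] := ltP w 1; last first.
  rewrite !mulr0 addr0; apply: ler_wpM2l => //; apply: ler_piMr; first exact: shell_ge0.
  by rewrite invf_le1// -[leLHS]sqrtr1 ler_sqrt// ltW.
rewrite mulr1 ler_wpDl ?mulr_ge0 ?shell_ge0//.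
rewrite /shell mulfK ?gt_eqF// [leLHS]mulrC -[leRHS]mulrA; apply: ler_wpM2l; first by rewrite mulr_ge0.
rewrite hE; apply: le_trans (hC _ _ K0 _); last by rewrite w0 w1.
apply: (ginv_le H); have := hK _ w0; have := radial_pot_ge0 (sqrtr_ge0 w).
by case: (u _) => [x||] //; rewrite ?lee_fin /= => x0 h1; move: E00 h1; lra.
Qed.

Lemma radial_pot0_lty : (u 0 < +oo)%E.
Proof.
have [K K0 hK] := radial_pot_le_powR; have [C C0 hC] := pot0_bound K0 hK.
have pw (w : R) : 0 <= w `^ (- (3 / 4)) * (0 < w < 1)%R%:R by rewrite mulr_ge0// powR_ge0.
have mpw : measurable_fun setT (fun w : R => w `^ (- (3 / 4)) * (0 < w < 1)%R%:R) by meas.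
have hs w : 0 <= h w * shell w by rewrite mulr_ge0// shell_ge0.
have mhs : measurable_fun setT (fun w => h w * shell w) by meas.
rewrite uE//.
apply: (@ge0_integral_lty _ _ _ leb _ (fun w => h w * shell w + C * (w `^ (- (3 / 4)) * (0 < w < 1)%R%:R))).
- exact: m_integrand.
- by apply: measurable_funD => //; exact: measurable_funM.
- by move=> w; rewrite hC integrand_ge0.
rewrite ge0_integralD_EFin//; last 2 first.
- exact: measurable_funM.
- by move=> w; rewrite mulr_ge0.
rewrite hM (ge0_integralZl_real leb mpw pw C0) lte_add_pinfty ?ltry//.
by rewrite lte_mul_pinfty// ?lee_fin//; apply: integral_powR_fin; lra.
Qed.

Definition radial_integrand r w : R := h w * (shell w / Num.max r (Num.sqrt w)).
(** The radial form of -V0. For r < 0 it keeps its value at 0, so continuity and monotonicity hold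
    on the whole line. *)
Definition radial_pot r : R := Rintegral leb setT (radial_integrand r).
Local Notation V := radial_pot.

Let max0_pos (r w : R) : 0 < w -> 0 < Num.max r (Num.sqrt w).
Proof. by move=> w0; rewrite lt_max sqrtr_gt0 w0 orbT. Qed.

Let integrand_neg r w : w <= 0 -> radial_integrand r w = 0.
Proof. by move=> w0; rewrite /radial_integrand /shell ler0_sqrtr// mulr0 mul0r mulr0. Qed.

Let integrand_pos r w : 0 <= radial_integrand r w.
Proof.
have [w0|w0] := leP w 0; first by rewrite integrand_neg.
by rewrite mulr_ge0// divr_ge0 ?shell_ge0// ltW// max0_pos.
Qed.

Lemma radial_integrand_anti r s w : r <= s -> radial_integrand s w <= radial_integrand r w.
Proof.
move=> rs; have [w0|w0] := leP w 0; first by rewrite !integrand_neg.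
apply: ler_wpM2l => //; apply: ler_wpM2l; first exact: shell_ge0.
by rewrite lef_pV2 ?posrE ?max0_pos// ge_max !le_max rs lexx orbT.
Qed.

Let integrand_le0 r w : radial_integrand r w <= radial_integrand 0 w.
Proof.
have [r0|r0] := leP 0 r; first exact: radial_integrand_anti.
have [w0|w0] := leP w 0; first by rewrite !integrand_neg.
by rewrite /radial_integrand (max_r (x := r)) ?(le_trans (ltW r0))// max_r.
Qed.

Lemma integrable_radial r : leb.-integrable setT (EFin \o radial_integrand r).
Proof.
apply/integrableP; split; first by apply/measurable_EFinP; exact: m_integrand.
apply: (@le_lt_trans _ _ (\int[leb]_w (radial_integrand r w)%:E)%E).
  rewrite le_eqVlt; apply/orP; left; apply/eqP; apply: eq_integral => w _ /=.
  by rewrite ger0_norm.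
apply: (@ge0_integral_lty _ _ _ leb (radial_integrand r) (radial_integrand 0)).
- exact: m_integrand.
- exact: m_integrand.
- by move=> w; rewrite integrand_pos integrand_le0.
- by have := radial_pot0_lty; rewrite uE.
Qed.

Lemma radial_potE r : 0 <= r -> u r = (V r)%:E.
Proof.
move=> r0; rewrite uE// /radial_pot /Rintegral fineK//.
by apply: integrable_fin_num => //; exact: integrable_radial.
Qed.

(** Dominated convergence; the majorant is the integrand at r = 0, integrable by the finiteness at
    the centre. *)
Lemma continuous_radial_pot : continuous V.
Proof.
move=> r.
have := @continuity_under_integral R _ _ leb radial_integrand setT measurableT (r - 1) (r + 1).
move=> /(_ (fun x _ => integrable_radial x)) /(_ _ (radial_integrand 0) (integrable_radial 0)); apply.
- apply/aeW => w _ x _.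
  have [w0|w0] := leP w 0.
    have -> : radial_integrand ^~ w = cst 0 by apply/funext => y; exact: integrand_neg.
    exact: cst_continuous.
  have cm : Num.max z (Num.sqrt w) @[z --> x] --> Num.max x (Num.sqrt w).
    by apply: (@continuous_max R R id (cst (Num.sqrt w)) x); [exact: cvg_id|exact: cvg_cst].
  rewrite /continuous_at /radial_integrand; apply: cvgM; first exact: cvg_cst.
  apply: cvgM; first exact: cvg_cst.
  by apply: cvgV; first by rewrite gt_eqF// max0_pos.
- by move=> x _; apply/aeW => w _; rewrite ger0_norm.
- by rewrite inE /= in_itv/= ltrBlDr ltrDl ltr01.
Qed.

Lemma radial_pot_nonneg r : 0 <= V r.
Proof. by apply: Rintegral_ge0 => w _; exact: integrand_pos. Qed.

Lemma radial_pot_mono r s : r <= s -> V s <= V r.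
Proof.
by move=> rs; apply: le_Rintegral => //; first exact: integrable_radial;
  [exact: integrable_radial|move=> w _; exact: radial_integrand_anti].
Qed.

Lemma radial_pot_mass r : 0 < r -> V r <= M / r.
Proof. by move=> r0; rewrite -lee_fin -(radial_potE (ltW r0)); exact: radial_pot_le_mass. Qed.

Lemma densityE w : h w = ginv dPhi (E0 + V (Num.sqrt w)).
Proof. by rewrite hE radial_potE ?sqrtr_ge0. Qed.

Lemma continuous_density : continuous h.
Proof.
move=> w; rewrite (_ : h = (ginv dPhi) \o (fun w => E0 + V (Num.sqrt w))); last first.
  by apply/funext => x; exact: densityE.
apply: continuous_comp; last exact: (continuous_ginv H).
apply: continuousD; first exact: cst_continuous.
apply: continuous_comp; [exact: sqrt_continuous|exact: continuous_radial_pot].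
Qed.

Lemma density_anti w w' : w <= w' -> h w' <= h w.
Proof.
by move=> ww; rewrite !densityE (ginv_le H)// lerD2l radial_pot_mono// ler_wsqrtr.
Qed.

(** The mass enclosed in the ball of radius sqrt W. *)
Definition flux W : R := Rintegral leb setT (fun w => h w * shell w * (w <= W)%R%:R).
Local Notation N := flux.

Let f w := h w * shell w.
Let f_ge0 w : 0 <= f w. Proof. by rewrite mulr_ge0// shell_ge0. Qed.
Let mf : measurable_fun setT f. Proof. by rewrite /f; meas. Qed.

Let integrable_ge0 (g : R -> R) : measurable_fun setT g -> (forall w, 0 <= g w) ->
  (\int[leb]_w (g w)%:E < +oo)%E -> leb.-integrable setT (EFin \o g).
Proof.
move=> mg g0 gfin; apply/integrableP; split; first exact/measurable_EFinP.
apply: le_lt_trans gfin; rewrite le_eqVlt; apply/orP; left; apply/eqP.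
by apply: eq_integral => w _ /=; rewrite ger0_norm.
Qed.

Let integrable_le (g k : R -> R) : measurable_fun setT g -> (forall w, 0 <= g w <= k w) ->
  leb.-integrable setT (EFin \o k) -> leb.-integrable setT (EFin \o g).
Proof.
move=> mg gk ik; apply: (le_integrable measurableT _ _ ik); first exact/measurable_EFinP.
move=> w _ /=; have /andP[g0 gkw] := gk w.
by rewrite !ger0_norm ?lee_fin// (le_trans g0).
Qed.

Let integrable_f : leb.-integrable setT (EFin \o f).
Proof. by apply: integrable_ge0 => //; rewrite hM ltry. Qed.

Let mcut W : measurable_fun setT (fun w : R => (w <= W)%R%:R : R).
Proof. by meas. Qed.

Let cut_le W w : 0 <= f w * (w <= W)%R%:R <= f w.
Proof. by rewrite mulr_ge0//= ler_piMr//; case: (w <= W). Qed.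

Let integrable_cut W : leb.-integrable setT (EFin \o (fun w => f w * (w <= W)%R%:R)).
Proof. by apply: (integrable_le _ (cut_le W)) => //; exact: measurable_funM. Qed.

Lemma flux_ge0 W : 0 <= N W.
Proof. by apply: Rintegral_ge0 => w _; have /andP[] := cut_le W w. Qed.

Lemma flux_mono W W' : W <= W' -> N W <= N W'.
Proof.
move=> WW; apply: le_Rintegral => // w _.
apply: ler_wpM2l; first exact: f_ge0.
by case: (leP w W) => // h1; rewrite (le_trans h1 WW).
Qed.

Lemma flux_neg W : W <= 0 -> N W = 0.
Proof.
move=> W0; rewrite /flux (_ : (fun w => _) = cst 0).
  by rewrite Rintegral_cst// mul0r.
apply/funext => w; case: leP => wW; last by rewrite mulr0.
by rewrite /shell ler0_sqrtr ?(le_trans wW)// !(mulr0, mul0r).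
Qed.

Let continuous_f : continuous f.
Proof.
move=> w; apply: continuousM; first exact: continuous_density.
apply: continuousM; [exact: cst_continuous|exact: sqrt_continuous].
Qed.

Lemma is_derive_flux (W : R) : is_derive W 1 N (h W * shell W).
Proof.
have E : N = fun y => Rintegral leb `]-oo, y] f.
  apply/funext => y; rewrite /flux [RHS]Rintegral_mkcond; congr (Rintegral _ _ _); apply/funext => w.
  by rewrite /patch mem_setE in_itv/=; case: ifP; rewrite ?mulr1 ?mulr0.
have [|||d1 d2] := @continuous_FTC1 R f -oo%O W (W + 1) _ _ _ (@continuous_f W).
- by rewrite ltrDl.
- by apply: (integrableS measurableT) => //; exact: measurable_itv.
- by rewrite ltNyr.
rewrite E; apply: DeriveDef; first exact: d1.
by rewrite -derive1E; exact: d2.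
Qed.

Lemma continuous_flux : continuous N.
Proof.
by move=> W; have [d _] := is_derive_flux W; exact/differentiable_continuous/derivable1_diffP.
Qed.

(** A unit of mass inside radius s contributes exactly 1/s - 1/t, outside radius t it contributes
    nothing, and in between something in between. This replaces differentiation under the
    integral. *)
Lemma radial_pot_flux s t : 0 < s -> s < t ->
  (s^-1 - t^-1) * N (s ^+ 2) <= V s - V t <= (s^-1 - t^-1) * N (t ^+ 2).
Proof.
move=> s0 st; have t0 := lt_trans s0 st.
have d0 : 0 <= s^-1 - t^-1 by rewrite subr_ge0 lef_pV2 ?posrE// ltW.
rewrite /radial_pot -RintegralB//; [|exact: integrable_radial|exact: integrable_radial].
have scale W : (s^-1 - t^-1) * N W = Rintegral leb setT (fun w => (s^-1 - t^-1) * (f w * (w <= W)%R%:R)).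
  by rewrite RintegralZl.
have iB : leb.-integrable setT (EFin \o (fun w => radial_integrand s w - radial_integrand t w)).
  have := integrableB measurableT (integrable_radial s) (integrable_radial t).
  by congr (integrable _ _ _); apply/funext.
have iS W : leb.-integrable setT (EFin \o (fun w => (s^-1 - t^-1) * (f w * (w <= W)%R%:R))).
  by have := integrableZl measurableT (s^-1 - t^-1) (integrable_cut W); congr (integrable _ _ _).
have sqrt_le r w : 0 < r -> 0 < w -> (Num.sqrt w <= r) = (w <= r ^+ 2).
  by move=> r0 w0; rewrite -(ler_pXn2r (n := 2)) ?nnegrE ?sqrtr_ge0 ?(ltW r0)// sqr_sqrtr// ltW.
have Eint w : 0 < w -> radial_integrand s w - radial_integrand t w =
    ((Num.max s (Num.sqrt w))^-1 - (Num.max t (Num.sqrt w))^-1) * f w.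
  by move=> w0; rewrite /radial_integrand /f; ring.
rewrite !scale; apply/andP; split; apply: le_Rintegral => // w _; rewrite -!/(radial_integrand _ _).
- have [w0|w0] := leP w 0.
    by rewrite !integrand_neg// subrr /f /shell ler0_sqrtr// !(mulr0, mul0r).
  rewrite Eint//; case: (leP w (s ^+ 2)) => ws; last first.
    rewrite !mulr0 mulr_ge0// subr_ge0 lef_pV2 ?posrE ?max0_pos//.
    by rewrite ge_max !le_max (ltW st) lexx orbT.
  rewrite mulr1; rewrite -sqrt_le// in ws.
  by rewrite !max_l// (le_trans ws)// ltW.
- have [w0|w0] := leP w 0.
    by rewrite !integrand_neg// subrr /f /shell ler0_sqrtr// !(mulr0, mul0r).
  rewrite Eint//; case: (leP w (t ^+ 2)) => wt; last first.
    rewrite !max_r ?subrr ?mul0r ?mulr0//.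
      by rewrite ltW// ltNge sqrt_le// -ltNge.
    by rewrite ltW// (lt_trans st)// ltNge sqrt_le// -ltNge.
  rewrite mulr1; apply: ler_wpM2r; first exact: f_ge0.
  rewrite -sqrt_le// in wt; rewrite (max_l wt) lerD2r lef_pV2 ?posrE ?max0_pos//.
  by rewrite le_max lexx.
Qed.

Let sq_inv_flux_continuous (p : R) : 0 < p -> {for p, continuous (fun p : R => N (p^-1 ^+ 2))}.
Proof.
move=> p0; apply: (@continuous_comp _ _ _ (fun p : R => p^-1 ^+ 2) N); last exact: continuous_flux.
apply: (@continuous_comp _ _ _ (fun p : R => p^-1) (fun x => x ^+ 2)).
  by apply: inv_continuous; rewrite gt_eqF.
exact: exprn_continuous.
Qed.

(** In the variable p = 1/r the derivative of the potential is the enclosed mass, and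
    [radial_pot_flux] is exactly the bound asked for by [is_derive_sandwich]. *)
Lemma is_derive_pot_inv (p : R) : 0 < p -> is_derive p 1 (fun p : R => V p^-1) (N (p^-1 ^+ 2)).
Proof.
move=> p0; apply: (@is_derive_sandwich _ _ (fun p : R => N (p^-1 ^+ 2))); first exact: sq_inv_flux_continuous.
near=> q.
have q0 : 0 < q by near: q; exact: lt_nbhsr.
rewrite /=; case: (ltgtP p q) => [pq|qp|->]; last by rewrite !subrr mul0r subr0 !normr0 mul0r.
- have /andP[l1 l2] := radial_pot_flux (s := q^-1) (t := p^-1) ltac:(by rewrite invr_gt0)
    ltac:(by rewrite ltf_pV2).
  rewrite !invrK in l1 l2.
  rewrite ler0_norm; last by lra.
  rewrite -normrM ler0_norm; rewrite mulrBr; lra.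
- have /andP[l1 l2] := radial_pot_flux (s := p^-1) (t := q^-1) ltac:(by rewrite invr_gt0)
    ltac:(by rewrite ltf_pV2).
  rewrite !invrK in l1 l2.
  rewrite ler0_norm; last by lra.
  rewrite -normrM ler0_norm; rewrite mulrBr; lra.
Unshelve. all: by end_near. Qed.

Lemma is_derive_radial_pot (W : R) : 0 < W ->
  is_derive W 1 (fun w : R => - V (Num.sqrt w)) (2^-1 * (N W / (W * Num.sqrt W))).
Proof.
move=> W0; have s0 : 0 < Num.sqrt W by rewrite sqrtr_gt0.
have sn : Num.sqrt W != 0 by rewrite gt_eqF.
have pW : 0 < (Num.sqrt W)^-1 by rewrite invr_gt0.
have h1 := is_derive1_sqrt W0.
have h1' : is_derive W 1 (fun w : R => (Num.sqrt w)^-1) (- (Num.sqrt W) ^- 2 *: (2 * Num.sqrt W)^-1).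
  exact: is_deriveV.
have h2 := is_derive_pot_inv pW.
have h3 : is_derive W 1 ((fun p : R => V p^-1) \o (fun w : R => (Num.sqrt w)^-1))
   (N ((Num.sqrt W)^-1^-1 ^+ 2) * (- (Num.sqrt W) ^- 2 *: (2 * Num.sqrt W)^-1)).
  exact: is_derive1_comp.
have -> : (fun w : R => - V (Num.sqrt w)) = - ((fun p : R => V p^-1) \o (fun w : R => (Num.sqrt w)^-1)).
  by apply/funext => w; rewrite /= /GRing.opp /= invrK.
apply: is_derive_eq; rewrite /GRing.scale /= invrK.
have e : Num.sqrt W ^+ 2 = W by rewrite sqr_sqrtr// ltW.
have -> : N (Num.sqrt W ^+ 2) = N W by rewrite e.
transitivity (2^-1 * (N W / (Num.sqrt W ^+ 2 * Num.sqrt W))); last by rewrite e.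
by field.
Qed.

Lemma integral_shell_cut W : 0 < W ->
  (\int[leb]_w (shell w * (w <= W)%R%:R)%:E = (4 / 3 * pi * (W * Num.sqrt W))%:E)%E.
Proof.
move=> W0.
pose F w : R := 4 / 3 * pi * (w * Num.sqrt w).
transitivity (F W - F 0)%:E; last by rewrite /F mul0r mulr0 subr0.
transitivity (\int[leb]_(x in `[0%R, W]) (shell x)%:E)%E.
  rewrite [RHS]integral_mkcond; apply: eq_integral => w _.
  rewrite /patch mem_setE in_itv/=; have [w0|w0] := leP 0 w; first by case: (w <= W); rewrite ?mulr1 ?mulr0.
  by rewrite /shell ltr0_sqrtr// !(mulr0, mul0r).
apply: (@integral_itvcc_is_derive_ge0 R (@shell R) F 0 W W0).
- by move=> x _; exact: shell_ge0.
- move=> x /andP[x0 _]; have h1 := is_derive1_sqrt x0.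
  rewrite /F; apply: is_derive_eq; rewrite /GRing.scale /= /shell mulr1.
  have s0 : Num.sqrt x != 0 by rewrite gt_eqF// sqrtr_gt0.
  have e : x = Num.sqrt x * Num.sqrt x by rewrite -expr2 sqr_sqrtr// ltW.
  rewrite {1}e; field.
  by [].
- move=> x _; apply: continuousM; [exact: cst_continuous|exact: sqrt_continuous].
- apply: cvg_at_right_filter; apply: cvgM; first exact: cvg_cst.
  apply: cvgM; [exact: cvg_id|exact: sqrt_continuous].
Qed.

Let integrable_shell_cut W : 0 < W -> leb.-integrable setT (EFin \o (fun w => shell w * (w <= W)%R%:R)).
Proof.
move=> W0; apply: integrable_ge0.
- exact: measurable_funM.
- by move=> w; rewrite mulr_ge0// shell_ge0.
- by rewrite integral_shell_cut// ltry.
Qed.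

(** The density decreases, so its mean over the ball of radius sqrt W, of volume 4/3 pi W sqrt W,
    lies between the boundary and the central value. *)
Lemma flux_bounds W : 0 < W ->
  h W * (4 / 3 * pi * (W * Num.sqrt W)) <= N W <= h 0 * (4 / 3 * pi * (W * Num.sqrt W)).
Proof.
move=> W0; have iS := integrable_shell_cut W0.
have E : 4 / 3 * pi * (W * Num.sqrt W) = Rintegral leb setT (fun w => shell w * (w <= W)%R%:R).
  by rewrite /Rintegral integral_shell_cut.
have iZ c : leb.-integrable setT (EFin \o (fun w => c * (shell w * (w <= W)%R%:R))).
  by have := integrableZl measurableT c iS; congr (integrable _ _ _).
rewrite E -!RintegralZl//; apply/andP; split; apply: le_Rintegral => // w _.
- rewrite mulrA; case: (leP w W) => wW; last by rewrite !mulr0.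
  by rewrite !mulr1 ler_wpM2r ?shell_ge0// density_anti.
- rewrite mulrA; case: (leP w W) => wW; last by rewrite !mulr0.
  rewrite !mulr1; have [w0|w0] := leP w 0; first by rewrite /shell ler0_sqrtr// !mulr0.
  by rewrite ler_wpM2r ?shell_ge0// density_anti// ltW.
Qed.

Lemma flux_le_mass W : N W <= M.
Proof.
have -> : M = Rintegral leb setT f by rewrite /Rintegral hM.
by apply: le_Rintegral => // w _; have /andP[] := cut_le W w.
Qed.

Lemma density_le_mass W : 0 < W -> h W * (4 / 3 * pi * (W * Num.sqrt W)) <= M.
Proof. by move=> W0; have /andP[h1 _] := flux_bounds W0; apply: le_trans h1 (flux_le_mass W). Qed.

Lemma flux_pos : exists2 W, 0 < W & 0 < N W.
Proof.
apply: contrapT => hN.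
have N0 W : N W = 0.
  have [W0|W0] := leP W 0; first exact: flux_neg.
  by apply/eqP; rewrite eq_le flux_ge0 andbT leNgt; apply/negP => NW; apply: hN; exists W.
have f0 w : f w = 0.
  have dN := is_derive_flux w; have NE : N = cst 0 by apply/funext.
  rewrite NE in dN; by rewrite /f -(@derive_val _ _ _ _ _ _ _ dN) derive_cst.
move: M0; rewrite -lte_fin -hM integral0_eq ?ltxx// => w _.
by rewrite -/(f w) f0.
Qed.

(** From r to 2 r the potential drops by at least N(r^2)/(2 r), and it is nonnegative at 2 r. *)
Lemma radial_pot_lower : exists2 c, 0 < c & exists2 r0, 0 < r0 & forall r, r0 <= r -> c / r <= V r.
Proof.
have [W W0 NW] := flux_pos.
exists (N W / 2); first exact: divr_gt0.
exists (Num.sqrt W); first by rewrite sqrtr_gt0.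
move=> r rW; have s0 : 0 < Num.sqrt W by rewrite sqrtr_gt0.
have r0 : 0 < r := lt_le_trans s0 rW.
have /andP[h1 _] := radial_pot_flux (s := r) (t := 2 * r) r0 ltac:(lra).
have h2 := radial_pot_nonneg (2 * r).
have h3 : N W <= N (r ^+ 2).
  by apply: flux_mono; rewrite -[leLHS](sqr_sqrtr (ltW W0)) ler_pXn2r ?nnegrE ?(ltW s0)// ltW.
have e : r^-1 - (2 * r)^-1 = 2^-1 / r by field; rewrite gt_eqF.
rewrite e in h1.
have h4 : 2^-1 / r * N W <= 2^-1 / r * N (r ^+ 2).
  by apply: ler_wpM2l => //; rewrite mulr_ge0// invr_ge0 ltW.
rewrite (_ : N W / 2 / r = 2^-1 / r * N W); [lra|ring].
Qed.

(* slope (r^2) is (- V)'(r) / r, extended continuously to r = 0. *)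
Definition slope (W : R) : R := if 0 < W then N W / (W * Num.sqrt W) else 4 / 3 * pi * h 0.

Let density_neg w : w <= 0 -> h w = h 0.
Proof. by move=> w0; rewrite !densityE sqrtr0 ler0_sqrtr. Qed.

Lemma slope_bounds (w : R) : 4 / 3 * pi * h w <= slope w <= 4 / 3 * pi * h 0.
Proof.
rewrite /slope; case: ltP => w0; last by rewrite density_neg// lexx.
have v0 : 0 < w * Num.sqrt w by rewrite mulr_gt0// sqrtr_gt0.
have /andP[l1 l2] := flux_bounds w0.
by rewrite ler_pdivrMr// ler_pdivlMr//; apply/andP; split; lra.
Qed.

Lemma is_derive_slope (W : R) : 0 < W -> is_derive W 1 slope ((2 * pi * h W - 3 / 2 * slope W) / W).
Proof.
move=> W0; have s0 : 0 < Num.sqrt W by rewrite sqrtr_gt0.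
have sn : Num.sqrt W != 0 by rewrite gt_eqF.
have Wn : W != 0 by rewrite gt_eqF.
have v0 : W * Num.sqrt W != 0 by rewrite mulf_neq0.
have d1 := is_derive1_sqrt W0.
have d2 := is_derive_flux W.
have d3 : is_derive W 1 (fun w => (w * Num.sqrt w)^-1)
    (- (W * Num.sqrt W) ^- 2 *: (W *: (2 * Num.sqrt W)^-1 + Num.sqrt W *: 1)).
  exact: is_deriveV.
have d4 : is_derive W 1 (fun w => N w / (w * Num.sqrt w)) ((2 * pi * h W - 3 / 2 * slope W) / W).
  apply: is_derive_eq; rewrite /GRing.scale /= /slope W0 /shell.
  have e : W = Num.sqrt W ^+ 2 by rewrite sqr_sqrtr// ltW.
  set s := Num.sqrt W in sn e *; set n := N W; set k := h W.
  rewrite e; field.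
  by [].
apply: (near_eq_is_derive _ d4); near=> w; rewrite /slope ifT//; near: w; exact: lt_nbhsr.
Unshelve. all: by end_near. Qed.

Lemma continuous_slope : continuous slope.
Proof.
move=> W; case: (ltgtP W 0) => [W0|W0|->].
- have e : \forall w \near W, 4 / 3 * pi * h 0 = slope w.
    near=> w; rewrite /slope ifF//; apply/negbTE; rewrite -leNgt ltW//; near: w; exact: lt_nbhsl.
  rewrite /continuous_at {2}/slope ltNge ltW//=.
  by apply: (cvg_trans (near_eq_cvg e)); exact: cvg_cst.
- by have [d _] := is_derive_slope W0; exact/differentiable_continuous/derivable1_diffP.
- rewrite /continuous_at {2}/slope ltxx.
  apply: (@squeeze_cvgr _ _ _ _ (fun w => 4 / 3 * pi * h w) (cst (4 / 3 * pi * h 0))).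
  + by near=> w; exact: slope_bounds.
  + apply: cvgM; [exact: cvg_cst|exact: continuous_density].
  + exact: cvg_cst.
Unshelve. all: by end_near. Qed.

Lemma is_derive_radial_pot_sqrt (W : R) : 0 < W ->
  is_derive W 1 (fun w : R => - V (Num.sqrt w)) (2^-1 * slope W).
Proof. by move=> W0; rewrite /slope W0; exact: is_derive_radial_pot. Qed.

(** The derivative in W is known only for W > 0. The mean value theorem with the bound on [slope]
    gives the quadratic estimate in r that yields a zero gradient at the centre. *)
Lemma radial_pot_quadratic (W : R) : 0 <= W -> `|V (Num.sqrt W) - V 0| <= 2 / 3 * pi * h 0 * W.
Proof.
rewrite le_eqVlt => /orP[/eqP <-|W0]; first by rewrite sqrtr0 subrr normr0 mulr0.
have d x : x \in `]0, W[ -> is_derive x 1 (fun w : R => - V (Num.sqrt w)) (2^-1 * slope x).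
  by rewrite in_itv/= => /andP[x0 _]; exact: is_derive_radial_pot_sqrt.
have c : {within `[0, W], continuous (fun w : R => - V (Num.sqrt w))}.
  apply: continuous_subspaceT => x; apply: cvgN; apply: (@continuous_comp _ _ _ (@Num.sqrt R) V).
    exact: sqrt_continuous.
  exact: continuous_radial_pot.
have [x xW] := MVT W0 d c.
rewrite sqrtr0 subr0 opprK => e.
rewrite (_ : V _ - V 0 = - (2^-1 * slope x * W)); last by rewrite -e; ring.
have /andP[l1 l2] := slope_bounds x.
have q0 : 0 <= slope x by apply: le_trans l1; rewrite mulr_ge0// mulr_ge0// pi_ge0.
rewrite normrN ger0_norm; last by rewrite !mulr_ge0// ltW.
apply: ler_wpM2r; [exact: ltW|lra].
Qed.

End radial.

(** * From the minimizer to its radial profile *)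

Section bridge.
Variable R : realType.
Local Notation T1 := (measurableTypeR R).
Local Notation T2 := (T1 * T1)%type.
Local Notation T3 := (T2 * T1)%type.
Local Notation leb := (@lebesgue_measure R).
Local Notation mu3 := (@mu3 R).
Variables (Phi dPhi : R -> R) (H : profile Phi dPhi) (M : R) (M0 : 0 < M).
Variables (rho : T3 -> R) (minrho : is_minimizer Phi M rho).

Lemma minimizer_radial : exists E0 (x0 : T3) (u : R -> \bar R) (h : R -> R), E0 <= 0 /\
  [/\ measurable_fun setT h, forall w, 0 <= h w,
    (\int[leb]_w (h w * shell w)%:E = M%:E)%E &
    (\int[leb]_w (h w `^ (4 / 3) * shell w)%:E < +oo)%E] /\
  [/\ forall r, 0 <= r -> (u r = \int[leb]_w (h w * (shell w / Num.max r (Num.sqrt w)))%:E)%E,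
    forall w, h w = ginv dPhi (E0 + fine (u (Num.sqrt w))),
    forall x, pot rho x = u (enorm (x - x0)) &
    {ae mu3, forall x, rho x = h (sqn (x - x0))}].
Proof.
have Frho : FM Phi M rho by case: minrho.
have [mrho rho_ge0 _ rhoM] := FMP Frho.
have Lrho := FM_L43 H Frho; have [_ _ _ rho43] := Lrho.
have [E0 E00 hae] := euler_lagrange H minrho M0.
have [x0 rad] := minimizer_pot_radial H M0 minrho.
pose u (r : R) := pot rho ((0, 0, r) + x0).
(* Defined by the Euler-Lagrange relation, so that the relation holds at every w, while rho agrees
   with h only almost everywhere. *)
pose h (w : R) := ginv dPhi (E0 + fine (u (Num.sqrt w))).
have mpot := measurable_pot mrho rho_ge0.
have mu : measurable_fun (setT : set R) u.
  apply: (measurableT_comp mpot (g := fun r : R => ((0 + x0.1.1, 0 + x0.1.2), r + x0.2))).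
  by meas.
have mh : measurable_fun setT h.
  have mg : measurable_fun (setT : set R) (ginv dPhi).
    by apply: continuous_measurable_fun; exact: (continuous_ginv H).
  have mU : measurable_fun (setT : set R) (fun w => E0 + fine (u (Num.sqrt w))).
    apply: measurable_funD; first exact: measurable_cst.
    apply: (measurableT_comp (@fine_measurable R setT measurableT)).
    exact: (measurableT_comp mu (@measurable_sqrtr R)).
  exact: (measurableT_comp mg mU).
have h_ge0 w : 0 <= h w by exact: (ginv_ge0 H).
have hE : {ae mu3, forall x, rho x = h (sqn (x - x0))}.
  by apply: filterS hae => x ->; rewrite /h /u rad -enormE.
have msqn := @measurable_sqn R.
have mB : measurable_fun setT (fun y : T3 => (y - x0 : T3)) by case: (mpres_shift (- x0)).
have radial (k : R -> R) (g : T3 -> R) : measurable_fun setT (fun x => k (rho x) * g x) ->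
    measurable_fun setT (fun w => k (h w)) -> measurable_fun setT g ->
    (forall r, 0 <= r -> 0 <= k r) -> (forall x, 0 <= g x) ->
    (\int[mu3]_x (k (rho x) * g x)%:E = \int[mu3]_x (k (h (sqn x)) * g (x + x0))%:E)%E.
  move=> mk mkh mg k0 g0.
  have mk2 : measurable_fun setT (fun x : T3 => (k (h (sqn (x - x0))) * g x)%:E).
    apply/measurable_EFinP; apply: measurable_funM => //.
    exact: (measurableT_comp mkh (measurableT_comp msqn mB)).
  have k20 (x : T3) : (0 <= (k (h (sqn (x - x0))) * g x)%:E)%E by rewrite lee_fin mulr_ge0// k0.
  transitivity (\int[mu3]_x (k (h (sqn (x - x0))) * g x)%:E)%E.
    apply: ge0_ae_eq_integral => //.
    - exact/measurable_EFinP.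
    - by move=> x _; rewrite lee_fin mulr_ge0// k0.
    - by apply: filterS hE => x -> _.
  rewrite -((mpres_shift x0).2 _ mk2 k20).
  by apply: eq_integral => x _; rewrite addrK.
have radial1 (k : R -> R) : measurable_fun setT k -> (forall r, 0 <= r -> 0 <= k r) ->
    (\int[mu3]_x (k (rho x))%:E = \int[leb]_w (k (h w) * shell w)%:E)%E.
  move=> mk k0.
  have mkr : measurable_fun setT (fun x => k (rho x)) by exact: (measurableT_comp mk mrho).
  have mkh : measurable_fun setT (fun w => k (h w)) by exact: (measurableT_comp mk mh).
  transitivity (\int[mu3]_x (k (rho x) * cst 1 x)%:E)%E.
    by apply: eq_integral => x _; rewrite mulr1.
  rewrite (radial k (cst 1))//; last by apply: measurable_funM => //; exact: measurable_cst.
  transitivity (\int[mu3]_x (k (h (sqn x)))%:E)%E.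
    by apply: eq_integral => x _; rewrite mulr1.
  rewrite (@integral_radial R (fun w => (k (h w))%:E))//; first exact/measurable_EFinP.
  by move=> w; rewrite lee_fin k0.
have mpow : measurable_fun setT (fun r : R => r `^ (4 / 3)) by meas.
have e43 := radial1 _ mpow (fun r _ => powR_ge0 r _).
have e1 := radial1 id (@measurable_id _ _ _) (fun r r0 => r0).
exists E0, x0, u, h; split => //; split; split => //.
- exact: (etrans (esym e1) rhoM).
- by rewrite -e43.
- move=> r r0; set z := (0, 0, r) + x0.
  have mk : measurable_fun setT (fun y => ker z y).
    by apply: measurable_ker_comp => //; exact: measurable_cst.
  have -> : u r = (\int[mu3]_y (rho y * ker z y)%:E)%E by rewrite /u potEint.
  have k0 x : 0 <= ker z x by exact: ker_ge0.
  have mrk : measurable_fun setT (fun x => id (rho x) * ker z x) by exact: measurable_funM.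
  rewrite (radial id (ker z) mrk mh mk (fun r r0 => r0) k0).
  transitivity (\int[mu3]_y ((h (sqn y))%:E * (ker (0, 0, r) y)%:E))%E.
    apply: eq_integral => y _; rewrite -EFinM; congr (_ * _)%:E.
    by rewrite /ker /z opprD addrACA subrr addr0.
  rewrite (@newton_axis R (fun w => (h w)%:E))//; first exact/measurable_EFinP.
Qed.
End bridge.

(** * Regularity in R^3 *)

Section line_derivative.
Variables (R : realType) (f : pt R -> R) (x v : pt R).

Let quotientE : (fun h : R => h^-1 *: (((fun t : R => f (t *: v + x)) \o shift 0) (h *: (1 : R)) -
    f (0 *: v + x))) = (fun h : R => h^-1 *: ((f \o shift x) (h *: v) - f x)).
Proof. by apply/funext => h; rewrite /= addr0 [_%:A]mulr1 scale0r add0r. Qed.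

Lemma is_derive_line d : is_derive (0 : R) 1 (fun t : R => f (t *: v + x)) d -> is_derive x v f d.
Proof.
move=> [dv de]; split.
- by move: dv; rewrite /derivable quotientE.
- by move: de; rewrite /derive quotientE.
Qed.

Lemma is_derive_along d : is_derive x v f d -> is_derive (0 : R) 1 (fun t : R => f (t *: v + x)) d.
Proof.
move=> [dv de]; split.
- by rewrite /derivable quotientE.
- by rewrite /derive quotientE.
Qed.
End line_derivative.

Section radial_potential.
Variable R : realType.
Implicit Types x y : pt R.

Lemma coord_line (i j : 'I_3) (t : R) x x0 :
  Defs.coord i (t *: ebasis R j + x - x0) = Defs.coord i (x - x0) + t * (i == j)%:R.
Proof.
case: x => -[a b] c; case: x0 => -[a0 b0] c0.
case: i => -[|[|[|//]]] hi; case: j => -[|[|[|//]]] hj;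
rewrite /Defs.coord /ebasis /= /GRing.scale /=; ring.
Qed.

Lemma sqn_coord x : sqn x = \sum_(i < 3) Defs.coord i x ^+ 2.
Proof. by rewrite !big_ord_recl big_ord0 /Defs.coord /= addr0 /sqn addrA. Qed.

Lemma sqn_line (j : 'I_3) (t : R) x x0 :
  sqn (t *: ebasis R j + x - x0) = sqn (x - x0) + 2 * Defs.coord j (x - x0) * t + t ^+ 2.
Proof.
case: x => -[a b] c; case: x0 => -[a0 b0] c0.
case: j => -[|[|[|//]]] hj; rewrite /sqn /Defs.coord /ebasis /= /GRing.scale /=; ring.
Qed.

Lemma continuous_coord (i : 'I_3) (x0 : pt R) : continuous (fun x => Defs.coord i (x - x0)).
Proof.
move=> x; rewrite /continuous_at /Defs.coord.
case: i => -[|[|[|//]]] hi /=; apply: cvgB; try exact: cvg_cst.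
- apply: (@continuous_comp _ _ _ (fun x : pt R => x.1) fst); exact: cvg_fst.
- apply: (@continuous_comp _ _ _ (fun x : pt R => x.1) snd); [exact: cvg_fst|exact: cvg_snd].
- exact: cvg_snd.
Qed.

Lemma continuous_sqn_sub (x0 : pt R) : continuous (fun x => sqn (x - x0)).
Proof.
have -> : (fun x => sqn (x - x0)) = (fun x => Defs.coord 0 (x - x0) ^+ 2 + Defs.coord 1 (x - x0) ^+ 2 + Defs.coord 2 (x - x0) ^+ 2).
  by apply/funext => x; rewrite sqn_coord !big_ord_recl big_ord0 addr0 addrA; do !congr (_ + Defs.coord _ _ ^+ 2); exact/val_inj.
have sq (i : 'I_3) : continuous (fun x => Defs.coord i (x - x0) ^+ 2).
  move=> z; apply: (@continuous_comp _ _ _ (fun x => Defs.coord i (x - x0)) (fun u : R => u ^+ 2)).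
    exact: continuous_coord.
  exact: exprn_continuous.
by move=> x; apply: cvgD; [apply: cvgD|]; exact: sq.
Qed.

Variables (V slope h : R -> R) (x0 : pt R).
Hypothesis dV : forall W : R, 0 < W -> is_derive W 1 (fun w : R => - V (Num.sqrt w)) (2^-1 * slope W).
Hypothesis V_quad : exists C, forall W, 0 <= W -> `|V (Num.sqrt W) - V 0| <= C * W.
Hypothesis cslope : continuous slope.
Hypothesis ch : continuous h.
Hypothesis slope0 : slope 0 = 4 / 3 * pi * h 0.
Hypothesis dslope : forall W : R, 0 < W -> is_derive W 1 slope ((2 * pi * h W - 3 / 2 * slope W) / W).

Local Notation S x := (sqn (x - x0)).
Local Notation y i x := (Defs.coord i (x - x0)).
Let V0 (x : pt R) : R := - V (enorm (x - x0)).

Let parabola (j : 'I_3) x : is_derive (0 : R) 1 (fun t : R => S x + 2 * y j x * t + t ^+ 2) (2 * y j x).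
Proof. by apply: is_derive_eq; rewrite /GRing.scale /=; ring. Qed.

Let S0P x : ~~ (0 < S x) -> S x = 0 /\ forall i, y i x = 0.
Proof.
rewrite -leNgt => S0; have {}S0 : S x = 0 by apply/eqP; rewrite eq_le S0 sqn_ge0.
split => // i; have : x - x0 = 0 by apply/eqP; rewrite -sqn_eq0 S0.
by move=> ->; rewrite /Defs.coord /=; case: ifP => // _; case: ifP.
Qed.

Lemma is_derive_potential (i : 'I_3) x : is_derive x (ebasis R i) V0 (slope (S x) * y i x).
Proof.
apply: is_derive_line.
have -> : (fun t : R => V0 (t *: ebasis R i + x)) =
    (fun w : R => - V (Num.sqrt w)) \o (fun t : R => S x + 2 * y i x * t + t ^+ 2).
  by apply/funext => t; rewrite /V0 enormE sqn_line.
have [Sp|/S0P[Sz yz]] := boolP (0 < S x).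
  rewrite (_ : slope _ * _ = 2^-1 * slope (S x) * (2 * y i x)); last by field.
  apply: is_derive1_comp; last exact: parabola.
  by rewrite mulr0 addr0 expr0n addr0; exact: dV.
(* Along a coordinate line through the centre the potential changes by at most |C| t^2, so the
   comparison function t |-> C t serves as candidate derivative. *)
have [C hC] := V_quad.
rewrite (_ : slope (S x) * y i x = C * 0); last by rewrite yz !mulr0.
apply: (@is_derive_sandwich _ _ (fun t => C * t)).
  by apply: cvgM; [exact: cvg_cst|exact: cvg_id].
near=> t; rewrite /= Sz yz !mulr0 !mul0r !add0r expr0n /= sqrtr0 !subr0 opprK.
have := hC (t ^+ 2) (sqr_ge0 _); rewrite -normrN opprB addrC => h1.
apply: (le_trans h1).
have -> : `|t| * `|C * t| = `|C| * t ^+ 2 by rewrite normrM mulrCA -expr2 real_normK ?num_real.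
by apply: ler_wpM2r; [exact: sqr_ge0|exact: ler_norm].
Unshelve. all: by end_near. Qed.

Lemma pd_potential i : pd i V0 = fun x => slope (S x) * y i x.
Proof. by apply/funext => x; rewrite /pd (@derive_val _ _ _ _ _ _ _ (is_derive_potential i x)). Qed.

(** The Hessian of V0 minus slope times the identity: by [dslope], 2 slope'(S) y_i y_j takes this
    form. At the centre it is 0, because 0^-1 = 0. *)
Let cross i j x := (4 * pi * h (S x) - 3 * slope (S x)) * (y i x * y j x / S x).

Lemma is_derive_pd_potential (i j : 'I_3) x :
  is_derive x (ebasis R j) (pd i V0) (slope (S x) * (i == j)%:R + cross i j x).
Proof.
rewrite pd_potential; apply: is_derive_line.
have -> : (fun t : R => slope (S (t *: ebasis R j + x)) * y i (t *: ebasis R j + x)) =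
    (fun t : R => slope (S x + 2 * y j x * t + t ^+ 2) * (y i x + t * (i == j)%:R)).
  by apply/funext => t; rewrite sqn_line coord_line.
have [Sp|/S0P[Sz yz]] := boolP (0 < S x).
  have d1 : is_derive (0 : R) 1 (slope \o (fun t : R => S x + 2 * y j x * t + t ^+ 2))
      ((2 * pi * h (S x) - 3 / 2 * slope (S x)) / S x * (2 * y j x)).
    apply: is_derive1_comp; last exact: parabola.
    by rewrite mulr0 addr0 expr0n addr0; exact: dslope.
  have d2 : is_derive (0 : R) 1 (fun t : R => y i x + t * (i == j)%:R) (i == j)%:R.
    by apply: is_derive_eq; rewrite /GRing.scale /=; ring.
  rewrite -[X in is_derive _ _ X]/((slope \o (fun t : R => S x + 2 * y j x * t + t ^+ 2)) * (fun t : R => y i x + t * (i == j)%:R)).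
  apply: is_derive_eq; rewrite /GRing.scale /= /cross !(mulr0, mul0r, addr0, expr0n).
  by field; rewrite gt_eqF.
have -> : cross i j x = 0 by rewrite /cross yz !mul0r mulr0.
rewrite addr0; set d := (i == j)%:R; rewrite Sz yz.
have {1}-> : slope 0 * d = slope ((0 : R) ^+ 2) * d by rewrite expr0n.
(* Through the centre the partial derivative is t |-> t slope(t^2) d, for which the sandwich bound
   is an equality. *)
apply: (@is_derive_sandwich _ _ (fun t => slope (t ^+ 2) * d)).
  apply: cvgM; last exact: cvg_cst.
  apply: (@continuous_comp _ _ _ (fun t : R => t ^+ 2) slope); [exact: exprn_continuous|exact: cslope].
near=> t; rewrite /= yz !mulr0 !mul0r !add0r expr0n /= !subr0 mulr0 subr0.
by rewrite -normrM le_eqVlt; apply/orP; left; apply/eqP; congr (`|_|); ring.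
Unshelve. all: by end_near. Qed.


Let S0_cross i j x : S x = 0 -> cross i j x = 0.
Proof. by move=> Sz; rewrite /cross Sz invr0 !mulr0. Qed.

Let cross_le i j x : `|cross i j x| <= `|4 * pi * h (S x) - 3 * slope (S x)|.
Proof.
rewrite /cross normrM; apply: ler_piMr => //.
have [Sp|/S0P[Sz _]] := boolP (0 < S x); last by rewrite Sz invr0 mulr0 normr0.
have ci k : y k x ^+ 2 <= S x.
  by rewrite sqn_coord (bigD1 k)//= lerDl sumr_ge0// => l _; exact: sqr_ge0.
rewrite normrM normfV (gtr0_norm Sp) ler_pdivrMr// mul1r normrM.
have := ci i; have := ci j; rewrite -(real_normK (num_real (y i x))) -(real_normK (num_real (y j x))).
have := sqr_ge0 (`|y i x| - `|y j x|); nra.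
Qed.

(** At the centre y_i y_j / S is bounded without being continuous; its factor 4 pi h - 3 slope tends
    to 0 there because slope 0 = 4/3 pi h 0. *)
Let continuous_cross i j : continuous (cross i j).
Proof.
move=> x; have cS : {for x, continuous (fun z : pt R => S z : R)} by exact: continuous_sqn_sub.
have chS : h (S z) @[z --> x] --> h (S x) by exact: (@continuous_comp _ _ _ (fun z : pt R => S z : R) h x cS (@ch _)).
have csS : slope (S z) @[z --> x] --> slope (S x) by exact: (@continuous_comp _ _ _ (fun z : pt R => S z : R) slope x cS (@cslope _)).
have cB : 4 * pi * h (S z) - 3 * slope (S z) @[z --> x] --> 4 * pi * h (S x) - 3 * slope (S x).
  by apply: cvgB; apply: cvgM => //; exact: cvg_cst.
rewrite /continuous_at.
have [Sp|/S0P[Sz yz]] := boolP (0 < S x).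
  apply: cvgM => //; apply: cvgM; first by apply: cvgM; exact: continuous_coord.
  by apply: cvgV => //; rewrite gt_eqF.
rewrite S0_cross//.
have B0 : 4 * pi * h (S x) - 3 * slope (S x) = 0 by rewrite Sz slope0; field.
rewrite B0 in cB.
have cn : `|4 * pi * h (S z) - 3 * slope (S z)| @[z --> x] --> (0 : R).
  by rewrite -(@normr0 R R); apply: cvg_norm.
apply: (@squeeze_cvgr _ _ _ _ (fun z => - `|4 * pi * h (S z) - 3 * slope (S z)|)
  (fun z => `|4 * pi * h (S z) - 3 * slope (S z)|)) => //.
- by near=> z; rewrite -ler_norml; exact: cross_le.
- by rewrite -oppr0; apply: cvgN.
Unshelve. all: by end_near. Qed.

Lemma pd_pd_potential i j : pd j (pd i V0) = fun x => slope (S x) * (i == j)%:R + cross i j x.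
Proof. by apply/funext => x; rewrite /pd (@derive_val _ _ _ _ _ _ _ (is_derive_pd_potential i j x)). Qed.

Lemma continuous_slope_sqn : continuous (fun x => slope (S x)).
Proof.
move=> x; have cS : {for x, continuous (fun z : pt R => S z : R)} by exact: continuous_sqn_sub.
exact: (@continuous_comp _ _ _ (fun z : pt R => S z : R) slope x cS (@cslope _)).
Qed.

Lemma potential_C2 : C2 V0.
Proof.
split=> i.
  split; first by move=> x; have [] := is_derive_potential i x.
  rewrite pd_potential => x; apply: cvgM; [exact: continuous_slope_sqn|exact: continuous_coord].
move=> j; split; first by move=> x; have [] := is_derive_pd_potential i j x.
rewrite pd_pd_potential => x; apply: cvgD; last exact: continuous_cross.
by apply: cvgM; [exact: continuous_slope_sqn|exact: cvg_cst].
Qed.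

(** Away from the centre the trace of [cross] is 4 pi h - 3 slope, which cancels the three slopes;
    at the centre [cross] vanishes and three times slope 0 is 4 pi h 0. *)
Lemma laplacian_potential x : laplacian V0 x = 4 * pi * h (S x).
Proof.
rewrite /laplacian (eq_bigr (fun i => slope (S x) + cross i i x)); last first.
  by move=> i _; rewrite pd_pd_potential eqxx mulr1.
rewrite big_split /= sumr_const card_ord.
have [Sp|/S0P[Sz yz]] := boolP (0 < S x); last first.
  rewrite big1 => [|i _]; last exact: S0_cross.
  by rewrite Sz slope0 addr0 -mulr_natl; field.
rewrite /cross -mulr_sumr -mulr_suml (eq_bigr (fun i => y i x ^+ 2)); last by move=> i _; rewrite expr2.
by rewrite -sqn_coord divff ?gt_eqF// mulr1 -mulr_natl; ring.
Qed.

End radial_potential.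

(** * Pressure, sign of the multiplier and compact support *)

Section conclusion.
Variable R : realType.

Lemma pressure_ginv (Phi dPhi ddPhi : R -> R) U : profile Phi dPhi ->
  (forall r : R, 0 < r -> is_derive r 1 Phi (dPhi r)) ->
  (forall r : R, 0 < r -> is_derive r 1 dPhi (ddPhi r)) ->
  {within `]0, +oo[, continuous ddPhi} ->
  pressure ddPhi (ginv dPhi U) = legendre Phi dPhi U.
Proof.
move=> H dP ddP cdd; rewrite (pressureE H dP ddP cdd (ginv_ge0 H U)) /legendre.
have [U0|U0] := leP 0 U; first by rewrite (dPhi_ginv H U0) mulrC.
by rewrite ginv_npos ?(ltW U0)// mul0r mulr0.
Qed.

Lemma multiplier_neg (dPhi V h : R -> R) (E0 M n' : R) : E0 <= 0 -> 0 < n' < 3 ->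
  (forall r, 0 <= r -> h (r ^+ 2) = ginv dPhi (E0 + V r)) ->
  (forall u, 0 <= u -> dPhi (ginv dPhi u) = u) -> (forall u, 0 <= ginv dPhi u) ->
  (forall W, 0 < W -> h W * (4 / 3 * pi * (W * Num.sqrt W)) <= M) ->
  (exists2 c, 0 < c & exists2 r0, 0 < r0 & forall r, r0 <= r -> c / r <= V r) ->
  (exists2 C : R, 0 < C & exists2 d : R, 0 < d & forall r : R, 0 <= r <= d ->
        dPhi r <= C * r `^ (n'^-1)) -> E0 < 0.
Proof.
move=> E00 /andP[n0 n3] hE dg g0 hM [c c0 [r0 r00 Vc]] [C C0 [d d0 hC]].
rewrite lt_neqAle E00 andbT; apply/eqP => E0z.
pose K := Num.max 1 (M / (4 / 3 * pi)).
have p0 : 0 < 4 / 3 * pi :> R by rewrite mulr_gt0 ?pi_gt0//; lra.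
have K1 : 1 <= K by rewrite le_max lexx.
have K0 : 0 < K := lt_le_trans ltr01 K1.
(* With E0 = 0 the two decay estimates combine to c / r <= C (K / r^3)^(1/n'), that is r^e <= B,
   where e > 0 because n' < 3. *)
pose e := 3 / n' - 1.
have e0 : 0 < e by rewrite /e subr_gt0 ltr_pdivlMr// mul1r.
pose B := C * K `^ n'^-1 / c.
have B0 : 0 < B by rewrite divr_gt0// mulr_gt0// powR_gt0.
(* Large enough for the lower bound on V, for h (r^2) <= d, and for r^e >= B + 1. *)
pose r := Num.max (Num.max r0 1) (Num.max (K / d) ((B + 1) `^ e^-1)).
have r1 : 1 <= r by rewrite !le_max lexx orbT.
have rp : 0 < r := lt_le_trans ltr01 r1.
have rr0 : r0 <= r by rewrite !le_max lexx.
have rd : K / d <= r by rewrite !le_max lexx !orbT.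
have rB : (B + 1) `^ e^-1 <= r by rewrite !le_max lexx !orbT.
pose F := h (r ^+ 2).
have F0 : 0 <= F by rewrite /F hE ?(ltW rp).
have FK : F <= K / r ^+ 3.
  have := hM (r ^+ 2) (exprn_gt0 _ rp); rewrite sqrtr_sqr (gtr0_norm rp) -/F => h1.
  rewrite ler_pdivlMr ?exprn_gt0//; apply: (@le_trans _ _ (M / (4 / 3 * pi))); last by rewrite le_max lexx orbT.
  rewrite ler_pdivlMr//; apply: le_trans h1; rewrite le_eqVlt; apply/orP; left; apply/eqP; ring.
have Fd : F <= d.
  apply: (le_trans FK); rewrite ler_pdivrMr ?exprn_gt0//.
  move: rd; rewrite ler_pdivrMr// => h1; apply: (le_trans h1).
  rewrite mulrC ler_pM2l// -[leLHS]expr1; exact: ler_weXn2l.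
have Vr : 0 <= V r by apply: le_trans (Vc _ rr0); rewrite divr_ge0// ltW.
have dF : dPhi F = V r by rewrite /F hE ?(ltW rp)// E0z add0r dg.
have key : c / r <= C * (K / r ^+ 3) `^ n'^-1.
  apply: (le_trans (Vc _ rr0)); rewrite -dF; apply: (@le_trans _ _ (C * F `^ n'^-1)).
    by apply: hC; rewrite F0.
  rewrite ler_pM2l//; apply: ge0_ler_powR => //; rewrite ?nnegrE ?invr_ge0 ?(ltW n0)//.
  by rewrite divr_ge0 ?(ltW K0)// exprn_ge0// ltW.
have key2 : r `^ e <= B.
  have e1 : (K / r ^+ 3) `^ n'^-1 = K `^ n'^-1 * r `^ (- (e + 1)).
    rewrite powRM ?(ltW K0)// ?invr_ge0 ?exprn_ge0 ?(ltW rp)//; congr (_ * _).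
    rewrite -[r ^+ 3]powR_mulrn ?(ltW rp)// -powRN -powRrM; congr (_ `^ _).
    by rewrite /e; field; rewrite gt_eqF.
  rewrite e1 in key; rewrite /B ler_pdivlMr//.
  have er : r `^ e * r `^ (- (e + 1)) = r^-1.
    rewrite -powRD ?(gt_eqF rp) ?implybT// -[in RHS](powR_inv1 (ltW rp)); congr (_ `^ _); ring.
  have q0 : 0 < r `^ (- (e + 1)) by exact: powR_gt0.
  rewrite -(ler_pM2r q0) mulrAC er mulrC -mulrA; exact: key.
have : B + 1 <= r `^ e.
  have -> : B + 1 = ((B + 1) `^ e^-1) `^ e by rewrite -powRrM mulVf ?gt_eqF// powRr1// ltW// addr_gt0.
  apply: ge0_ler_powR; rewrite ?nnegrE ?powR_ge0 ?(ltW e0) ?(ltW rp)//.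
move=> h1; have := le_trans h1 key2; by rewrite gerDl ler10.
Qed.

Lemma compact_closure_enorm (A : set (pt R)) (x0 : pt R) (r : R) :
  (forall x, A x -> enorm (x - x0) <= r) -> compact (closure A).
Proof.
move=> h.
pose K : set (pt R) := (`[x0.1.1 - r, x0.1.1 + r] `*` `[x0.1.2 - r, x0.1.2 + r]) `*` `[x0.2 - r, x0.2 + r].
have cK : compact K.
  by apply: compact_setX; [apply: compact_setX|]; exact: segment_compact.
have AK : A `<=` K.
  move=> x /h xr.
  have co i : `|Defs.coord i (x - x0)| <= r.
    apply: le_trans xr; rewrite -(ler_pXn2r (n := 2)) ?nnegrE ?normr_ge0 ?enorm_ge0//.
    rewrite enorm_sqr real_normK ?num_real// sqn_coord (bigD1 i)//= lerDl sumr_ge0// => l _; exact: sqr_ge0.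
  have c0 := co 0; have c1 := co 1; have c2 := co 2.
  move: c0 c1 c2; rewrite /Defs.coord /= !ler_norml => /andP[a1 a2] /andP[b1 b2] /andP[d1 d2].
  by split; [split|]; rewrite /= in_itv/=; apply/andP; split; lra.
have clK : closed K by apply: compact_closed => //; exact: norm_hausdorff.
apply: (subclosed_compact _ cK); first exact: closed_closure.
rewrite [X in _ `<=` X]((closure_id K).1 clK); exact: closureS.
Qed.
End conclusion.

Unset Implicit Arguments.

Theorem theorem2 (R : realType) (M : R) (Phi dPhi ddPhi : R -> R) (n n' : R)
  (rho0 : pt R -> R)
  (* M > 0 *)
  (HM : 0 < M)
  (* Phi in C^1([0,oo[) with derivative dPhi *)
  (HPhi_cont : {within `[0, +oo[, continuous Phi})
  (HPhi_d0 : (fun h : R => h^-1 * (Phi h - Phi 0)) @ 0^'+ --> dPhi 0)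
  (HPhi_d : forall r : R, 0 < r -> is_derive r 1 Phi (dPhi r))
  (HdPhi_cont : {within `[0, +oo[, continuous dPhi})
  (* Phi in C^2(]0,oo[) with second derivative ddPhi *)
  (HdPhi_d : forall r : R, 0 < r -> is_derive r 1 dPhi (ddPhi r))
  (HddPhi_cont : {within `]0, +oo[, continuous ddPhi})
  (* Phi(0) = 0 = Phi'(0) *)
  (HPhi0 : Phi 0 = 0) (HdPhi0 : dPhi 0 = 0)
  (* (Phi1) strict convexity on [0,oo[ *)
  (HPhi1 : forall x y t : R, 0 <= x -> 0 <= y -> x != y -> 0 < t < 1 ->
      Phi (t * x + (1 - t) * y) < t * Phi x + (1 - t) * Phi y)
  (* (Phi2) *)
  (Hn : 0 < n < 3)
  (HPhi2 : exists2 C : R, 0 < C & exists r0 : R, forall r : R, r0 <= r -> 0 <= r ->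
      C * r `^ (1 + n^-1) <= Phi r)
  (* (Phi3) *)
  (Hn' : 0 < n' < 3)
  (HPhi3 : exists2 C : R, 0 < C & exists2 d : R, 0 < d & forall r : R, 0 <= r <= d ->
      Phi r <= C * r `^ (1 + n'^-1))
  (* rho0 is a minimizer of H_r over F_M *)
  (Hmin : is_minimizer Phi M rho0) :
  let V0 := Vpot rho0 in
  exists E0 : R, E0 <= 0 /\
  let rho0' := fun x => if V0 x < E0 then inv_on `[0, +oo[ dPhi (E0 - V0 x) else 0 in
  [/\
    (* Euler-Lagrange relation (for a.e. x, rho0' is the pointwise representative) *)
    {ae @leb3 R, forall x, rho0 x = rho0' x},
    (* spherical symmetry, monotonicity *)
    (exists x0 : pt R, exists f g : R -> R,
       (forall x, rho0' x = f (enorm (x - x0)) /\ V0 x = g (enorm (x - x0))) /\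
       (forall r s : R, 0 <= r <= s -> f s <= f r /\ g r <= g s)),
    (* regularity, mass, decay *)
    [/\ continuous rho0', (\int[@leb3 R]_x (rho0' x)%:E = M%:E)%E,
        C2 V0 & vanishes_at_infinity V0],
    (* stationary solution of Euler-Poisson with u = 0 *)
    EulerPoisson (pressure ddPhi) (fun _ => rho0') (fun _ _ => 0) (fun _ => V0) &
    (* compact support under the extra assumption *)
    ((exists2 C : R, 0 < C & exists2 d : R, 0 < d & forall r : R, 0 <= r <= d ->
        dPhi r <= C * r `^ (n'^-1)) ->
     E0 < 0 /\ compact (closure [set x | rho0' x != 0]))].
Proof.
move=> V0.
have H := profile_intro HPhi_cont HPhi_d0 HPhi_d HdPhi_cont HPhi0 HdPhi0 HPhi1 Hn HPhi2.
have [E0 [x0 [u [h [E00 [[mh h_ge0 hM h43] [uE hE potE hae]]]]]]] := minimizer_radial H HM Hmin.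
have [Frho _] := Hmin; have [mrho rho_ge0 _ rhoM] := FMP Frho.
have uV := radial_potE H E00 mh h_ge0 hM h43 uE hE.
have hV := densityE H E00 mh h_ge0 hM h43 uE hE.
have Vmono := radial_pot_mono H E00 mh h_ge0 hM h43 uE hE.
have Vmass := radial_pot_mass H E00 mh h_ge0 hM h43 uE hE.
have Vlow := radial_pot_lower H HM E00 mh h_ge0 hM h43 uE hE.
have V_ge0 := radial_pot_nonneg h_ge0.
have h_anti := density_anti H E00 mh h_ge0 hM h43 uE hE.
have h_mass := density_le_mass H E00 mh h_ge0 hM h43 uE hE.
have ch := continuous_density H E00 mh h_ge0 hM h43 uE hE.
have cs := continuous_slope H E00 mh h_ge0 hM h43 uE hE.
have ds := is_derive_slope H E00 mh h_ge0 hM h43 uE hE.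
have dV := is_derive_radial_pot_sqrt H E00 mh h_ge0 hM h43 uE hE.
have Vq := radial_pot_quadratic H E00 mh h_ge0 hM h43 uE hE.
pose V := radial_pot h; pose q := slope h.
have Vq' : exists C, forall W, 0 <= W -> `|V (Num.sqrt W) - V 0| <= C * W by eexists; exact: Vq.
have q0 : q 0 = 4 / 3 * pi * h 0 by rewrite /q /slope ltxx.
(* The extended potential is finite everywhere, so the real-valued integral in [Vpot] never falls
   back on a default value. *)
have V0E : V0 = fun x => - V (enorm (x - x0)).
  apply/funext => x; rewrite /V0 /Vpot /Rintegral leb3E; congr (- _).
  transitivity (fine (pot rho0 x)); first by rewrite potEint.
  by rewrite potE uV ?enorm_ge0.
have gE x : ginv dPhi (E0 - V0 x) = h (sqn (x - x0)).
  by rewrite hV -enormE V0E opprK.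
exists E0; split => // rho0'.
have rhoE : rho0' = fun x => h (sqn (x - x0)).
  by apply/funext => x; rewrite /rho0' -gE /ginv subr_gt0.
have crho : continuous rho0'.
  rewrite rhoE => x.
  have cS : {for x, continuous (fun z : pt R => sqn (z - x0) : R)} by exact: continuous_sqn_sub.
  exact: (@continuous_comp _ _ _ (fun z : pt R => sqn (z - x0) : R) h x cS (@ch _)).
have V_C2 : C2 V0 by rewrite V0E; exact: (@potential_C2 R V q h x0 dV Vq' cs ch q0 ds).
have lap x : laplacian V0 x = 4 * pi * rho0' x.
  by rewrite V0E rhoE; exact: (@laplacian_potential R V q h x0 dV Vq' cs q0 ds x).
have Vinf : vanishes_at_infinity V0.
  (* Beyond distance r0 from x0 the bound M / |x - x0| is below eps. The radius about the origin
     then comes from |x|^2 <= 2 |x - x0|^2 + 2 |x0|^2. *)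
  move=> eps eps0; pose r0 := M / eps + 1.
  have r00 : 0 < r0 by rewrite addr_gt0// divr_gt0.
  exists (Num.sqrt (2 * r0 ^+ 2 + 2 * sqn x0)) => x hx.
  have far : r0 < enorm (x - x0).
    have b0 : 0 <= 2 * r0 ^+ 2 + 2 * sqn x0 by rewrite addr_ge0// mulr_ge0 ?sqn_ge0 ?sqr_ge0.
    have : 2 * r0 ^+ 2 + 2 * sqn x0 < sqn x.
      rewrite -(enorm_sqr x) -[ltLHS](sqr_sqrtr b0) ltr_pXn2r// nnegrE ?sqrtr_ge0// enorm_ge0.
    have : sqn x <= 2 * sqn (x - x0) + 2 * sqn x0.
      case: (x) => -[a b] c; case: (x0) => -[a0 b0'] c0; rewrite /sqn /=.
      have := sqr_ge0 (a - 2 * a0); have := sqr_ge0 (b - 2 * b0'); have := sqr_ge0 (c - 2 * c0).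
      lra.
    move=> h1 h2; rewrite -(ltr_pXn2r (n := 2)) ?nnegrE ?enorm_ge0 ?(ltW r00)// enorm_sqr; lra.
  have e0 : 0 < enorm (x - x0) := lt_trans r00 far.
  rewrite V0E normrN ger0_norm//; apply: (le_lt_trans (Vmass _ e0)).
  rewrite ltr_pdivrMr// mulrC -ltr_pdivrMr//; apply: lt_trans far.
  by rewrite ltrDl.
have mrho' : measurable_fun setT (rho0' : measurableTypeR R * measurableTypeR R * measurableTypeR R -> R).
  have [mB _] := mpres_shift (- x0).
  by rewrite rhoE; exact: (measurableT_comp mh (measurableT_comp (@measurable_sqn R) mB)).
have coord0 i : Defs.coord i (0 : pt R) = 0 by rewrite /Defs.coord; case: ifP => // _; case: ifP.
have dV0 i x : is_derive x (ebasis R i) V0 (q (sqn (x - x0)) * Defs.coord i (x - x0)).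
  by rewrite V0E; exact: (@is_derive_potential R V q x0 dV Vq' i x).
(* The pressure is differentiated as the Legendre transform at E0 - V0, whose derivative is the
   density; differentiability of rho0' itself is never invoked. *)
have dP i x : is_derive x (ebasis R i) (fun y => pressure ddPhi (rho0' y))
    (rho0' x * - (q (sqn (x - x0)) * Defs.coord i (x - x0))).
  have -> : (fun y => pressure ddPhi (rho0' y)) = (fun y => legendre Phi dPhi (E0 - V0 y)).
    by apply/funext => y; rewrite rhoE -gE; exact: pressure_ginv.
  apply: is_derive_line; have dl := is_derive_along (dV0 i x).
  have dU : is_derive (0 : R) 1 (fun t : R => E0 - V0 (t *: ebasis R i + x))
      (- (q (sqn (x - x0)) * Defs.coord i (x - x0))).
    by have := is_deriveB (is_derive_cst E0 (0 : R) (1 : R)) dl; rewrite sub0r; exact: id.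
  have dL := is_derive_legendre (E0 - V0 (0 *: ebasis R i + x)) H.
  have := is_derive1_comp (f := legendre Phi dPhi) (g := fun t : R => E0 - V0 (t *: ebasis R i + x)) dL dU.
  by rewrite scale0r add0r gE rhoE.
have hsq r : 0 <= r -> h (r ^+ 2) = ginv dPhi (E0 + V r).
  by move=> r0; rewrite hV sqrtr_sqr ger0_norm.
split.
- rewrite leb3E; apply: filterS hae => x ->; by rewrite rhoE.
- exists x0, (fun r => h (r ^+ 2)), (fun r => - V r); split.
    by move=> x; rewrite rhoE V0E enorm_sqr.
  move=> r s /andP[r0 rs]; split; last by rewrite lerN2 Vmono.
  by apply: h_anti; rewrite ler_pXn2r ?nnegrE// (le_trans r0).
- split => //.
  rewrite leb3E -rhoM; apply: ge0_ae_eq_integral => //.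
  + exact/measurable_EFinP.
  + exact/measurable_EFinP.
  + by move=> x _; rewrite rhoE lee_fin.
  + by move=> x _; rewrite lee_fin.
  + by apply: filterS hae => x e _; rewrite rhoE -e.
- move=> t x.
  have u0 i : (fun y : pt R => Defs.coord i (0 : pt R)) = cst 0 by apply/funext => y; exact: coord0.
  have ru0 i : (fun y => rho0' y * Defs.coord i (0 : pt R)) = cst 0.
    by apply/funext => y; rewrite coord0 mulr0.
  split; [|split; [|split]] => //.
  + split; first exact: derivable_cst.
      by move=> i; rewrite ru0; exact: derivable_cst.
    rewrite derive_cst add0r big1// => i _; by rewrite ru0 /pd derive_cst.
  + move=> i; have [dPi ePi] := dP i x; have [dVi eVi] := dV0 i x; split.
    * exact: derivable_cst.
    * by move=> j; exact: derivable_cst.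
    * exact: dPi.
    * exact: dVi.
    * rewrite /pd ePi eVi derive_cst mulr0 big1 => [|j _]; last by rewrite coord0 mul0r.
      by rewrite mulr0 addr0 mulrN opprK subrr.
  + split; last exact: lap.
    move=> i; split; first by have [] := dV0 i x.
    by have [_ /(_ i i)[]] := V_C2.
- move=> hyp; have E0n : E0 < 0.
    apply: (multiplier_neg E00 Hn' hsq (dPhi_ginv H) (ginv_ge0 H) h_mass Vlow hyp).
  (* Beyond radius M / - E0 the bound V <= M / |x - x0| gives E0 - V0 <= 0, where [ginv]
     vanishes. *)
  split => //; apply: (@compact_closure_enorm R _ x0 (M / - E0)) => x /= hx.
  have p0 : 0 < - E0 by rewrite oppr_gt0.
  rewrite leNgt; apply/negP => far; move: hx; rewrite rhoE hV -enormE ginv_npos ?eqxx//.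
  have e0 : 0 < enorm (x - x0) by apply: lt_trans far; rewrite divr_gt0.
  rewrite -lerBrDl sub0r; apply: (le_trans (Vmass _ e0)).
  by rewrite ler_pdivrMr// mulrC -ler_pdivrMr// ltW.
Qed.
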